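(* Let $\mathfrak g=A^{(1)}_n$ and fix $1\le k\le n$. Let $B^{k,l}$ ($l\ge1$) be the perfect crystals of level $l$ and $B^{k,\infty}$ the crystal with distinguished element $b_\infty$ described in the context. Then $B^{k,\infty}$ (with $b_\infty$) is a limit of $\{B^{k,l}\}_{l\ge1}$; in particular $\{B^{k,l}\}_{l\ge1}$ is a coherent family of perfect crystals. Its associated automorphism is $\sigma_k$, the linear automorphism of $P_{cl}$ with $\sigma_k(\Lambda_i)=\Lambda_{i-k \bmod n+1}$, and $\sigma_k\varphi(b)=\varepsilon(b)$ for every $l\ge 1$ and every minimal element $b$ of $B^{k,l}$.
   Context: Notation for $\mathfrak g=A_n^{(1)}$: $I=\{0,\dots,n\}$, $h_i,\Lambda_i$ the simple coroots and fundamental weights, $c=\sum_ih_i$, $P_{cl}=\bigoplus_i\mathbb{Z}\Lambda_i$, $P_{cl}^0$ the sublattice of level $0$ ($\langle\lambda,c\rangle=0$), $(P_{cl}^+)_l$ the dominant weights ($\langle\lambda,h_i\rangle\ge0$) of level $l$. A crystal $B$ is a set with $\mathrm{wt}$ (here to $P_{cl}$), $\tilde e_i,\tilde f_i:B\to B\sqcup\{0\}$, $\varepsilon_i,\varphi_i:B\to\mathbb{Z}\sqcup\{-\infty\}$ satisfying the usual Kashiwara axioms; $\varepsilon(b)=\sum_i\varepsilon_i(b)\Lambda_i$, $\varphi(b)=\sum_i\varphi_i(b)\Lambda_i$, $\mathrm{wt}\,b=\varphi(b)-\varepsilon(b)$. A morphism $\psi$ satisfies $\psi(0)=0$, commutes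 with $\tilde e_i$ (resp. $\tilde f_i$) when $b,\tilde e_ib$ (resp. $b,\tilde f_ib$) lie in the source, and preserves $\mathrm{wt},\varepsilon_i,\varphi_i$ whenever $\psi(b)\neq0$; an embedding is an injective morphism. $T_\lambda=\{t_\lambda\}$ has $\mathrm{wt}\,t_\lambda=\lambda$, $\varepsilon_i=\varphi_i=-\infty$; on $T_\lambda\otimes B\otimes T_\mu$, $\tilde e_i,\tilde f_i$ act on $B$, weight is $\lambda+\mu+\mathrm{wt}\,b$, $\varepsilon_i=\varepsilon_i(b)-\langle h_i,\lambda\rangle$, $\varphi_i=\varphi_i(b)+\langle h_i,\mu\rangle$. The level of a finite regular crystal $B$ (weights in $P_{cl}^0$) is $\min_b\langle c,\varepsilon(b)\rangle$, and $B_{\min}$ is the set of $b$ attaining it. A perfect crystal of level $l$ is a finite crystal (a simple crystal base of a finite-dimensional $U_q'(\mathfrak g)$-module of level $l$, such that every dominant $\lambda$ of level $\ge l$ dominates, i.e. differs by a dominant weight from, some $\varepsilon(b)$ and some $\varphi(b)$) for which $\varepsilon,\varphi:B_{\min}\to(P_{cl}^+)_l$ are bijections. Coherent families. A limit of a family $\{B^l\}_{l\ge1}$ with $B^l$ perfect of level $l$ is a crystal $B^\infty$ with an element $b_\infty$ such that: $\mathrm{wt}\,b_\infty=0$, $\varepsilon(b_\infty)=\varphi(b_\infty)=0$; for every $l\ge1$, $b\in B^l_{\min}$ there is an embedding $f_{(l,b)}:T_{\varepsilon(b)}\otimes B^l\otimes T_{-\varphi(b)}\to B^\infty$ sending $t_{\varepsilon(b)}\otimes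 b\otimes t_{-\varphi(b)}$ to $b_\infty$; and $B^\infty$ is the union of the images of all $f_{(l,b)}$. A family having a limit is a coherent family. With $B^\infty_{\min}=\{b\in B^\infty:\langle c,\varepsilon(b)\rangle=0\}$, $\varepsilon,\varphi$ map $B^\infty_{\min}$ bijectively to $P^0_{cl}$ and the automorphism of $P_{cl}^0$ associated with the family is $\varepsilon\circ\varphi^{-1}$; the claim's $\sigma_k$ extends it to $P_{cl}$. The crystal $B^{k,l}$. Put $k'=n+1-k$. $B^{k,l}$ is the set of semistandard tableaux (rows weakly increasing, columns strictly increasing) of shape a $k\times l$ rectangle ($k$ rows) over $\{1,\dots,n+1\}$. A tableau $b$ is encoded by $x=x(b)=(x_{ji})$, $x_{ji}$ = number of letters $i$ in row $j$ ($1\le j\le k$); $x_{ji}=0$ unless $j\le i\le j+k'$, and $x_{0i}=x_{k+1,i}=0$ by convention. These crystals are known to be perfect of level $l$ (Kang–Kashiwara–Misra–Miwa–Nakashima–Nakayashiki). For $a=1,\dots,n$: let $\beta=\max(0,a-k')$, $\gamma=\min(k,a)$, $\Gamma(c)=\sum_{j=\beta+1}^{c-1}(x_{ja}-x_{j+1,a+1})$ for $\beta+1\le c\le\gamma$, and let $c_0$ (resp. $c_1$) be the smallest (resp. largest) $c$ at which $\Gamma$ attains its minimum. Then $\varepsilon_a(b)=\sum_{j=\beta}^{c_0-1}(x_{j+1,a+1}-x_{ja})$, $\varphi_a(b)=\sum_{j=c_1}^{\gamma}(x_{ja}-x_{j+1,a+1})$; if $\varepsilon_a(b)>0$, $\tilde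 e_a$ decreases $x_{c_0,a+1}$ by $1$ and increases $x_{c_0,a}$ by $1$ (otherwise $\tilde e_ab=0$); if $\varphi_a(b)>0$, $\tilde f_a$ decreases $x_{c_1,a}$ by $1$ and increases $x_{c_1,a+1}$ by $1$ (otherwise $\tilde f_ab=0$). For $a=0$: let $C$ be the set of sequences $c=(1=c_0<c_1<\dots<c_{k-1}<c_k=n+1)$ ordered componentwise, and $\Delta(c)=\sum_{j=1}^k\sum_{c_{j-1}<i<c_j}x_{ji}$. The set of minimizers of $\Delta$ has a unique minimum element $c$ and a unique maximum element $\hat c$ for the componentwise order. Then $\varepsilon_0(b)=l-x_{k,n+1}-\Delta(c)$, $\varphi_0(b)=l-x_{11}-\Delta(c)$. If $c=(1,2,\dots,k,n+1)$ and $x_{kk}=0$ then $\tilde e_0b=0$; otherwise $x(\tilde e_0b)_{ji}=x_{ji}-\delta_{i,c_{j-1}}+\delta_{i,c_j}$. If $\hat c=(1,k'+1,k'+2,\dots,n+1)$ and $x_{1,k'+1}=0$ then $\tilde f_0b=0$; otherwise $x(\tilde f_0b)_{ji}=x_{ji}-\delta_{i,\hat c_j}+\delta_{i,\hat c_{j-1}}$. The crystal $B^{k,\infty}$. As a set, $B^{k,\infty}=\{(\nu_{ji})_{1\le j\le k,\,j\le i\le j+k'}:\nu_{ji}\in\mathbb{Z},\ \sum_{i=j}^{j+k'}\nu_{ji}=0\text{ for all }j\}$, with $b_\infty=(0)$ and the convention $\nu_{0i}=\nu_{k+1,i}=0$ (and $\nu_{ji}=0$ outside the index range). For $a=1,\dots,n$,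 $\varepsilon_a,\varphi_a,\tilde e_a,\tilde f_a$ are given by the same formulas with $x$ replaced by $\nu$, except that $\tilde e_a,\tilde f_a$ are applied unconditionally (never $0$). $\tilde e_0,\tilde f_0$ are given by the same formulas (using $\Delta$ computed from $\nu$), also never $0$, while $\varepsilon_0(b)=-\nu_{k,n+1}-\Delta(c)$ and $\varphi_0(b)=-\nu_{11}-\Delta(c)$, where $\Delta(c)$ is the minimum value of $\Delta$. *)

(* Defs.v *)
From HB Require Import structures.
From mathcomp Require Import all_boot all_order all_algebra.
From mathcomp Require Import zify.
From mathcomp Require Import boolp classical_sets functions cardinality.

Set Implicit Arguments.
Unset Strict Implicit.
Unset Printing Implicit Defensive.
Import Order.TTheory GRing.Theory Num.Theory.
Local Open Scope ring_scope.
Local Open Scope classical_set_scope.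

(* lambda = \sum_i <lambda, h_i> Lambda_i is the row of its coordinates:
   <lambda, h_i> is lambda 0 i.  The index set I = {0, ..., n} is 'I_n.+1. *)
Definition Pcl (n : nat) := 'rV[int]_n.+1.

Definition Lam (n : nat) (i : 'I_n.+1) : Pcl n := delta_mx 0 i.

(* the canonical central element is c = \sum_i h_i *)
Definition level (n : nat) (la : Pcl n) : int := \sum_i la 0 i.

(* Classical simple root; the neighbours are cyclic, so for n = 1 this is
   2 Lambda_i - 2 Lambda_(1 - i). *)
Definition alpha (n : nat) (i : 'I_n.+1) : Pcl n :=
  Lam i *+ 2 - Lam (ordS i) - Lam (ord_pred i).

Definition dominant (n : nat) (la : Pcl n) : Prop := forall i, 0 <= la 0 i.

Definition Pcl0 (n : nat) : set (Pcl n) := [set la | level la = 0].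

Definition Pplus (n l : nat) : set (Pcl n) :=
  [set la | dominant la /\ level la = l%:Z].

Inductive weyl_orbit (n : nat) (la : Pcl n) : Pcl n -> Prop :=
| weyl_refl : weyl_orbit la la
| weyl_step mu i : weyl_orbit la mu -> weyl_orbit la (mu - alpha i *~ mu 0 i).

(* B |_| {0} is option B, with 0 = None; Z |_| {-oo} is option int, with
   -oo = None. *)
Record crystal (n : nat) := Crystal {
  car :> Type;
  wt : car -> Pcl n;
  eps : 'I_n.+1 -> car -> option int;
  phi : 'I_n.+1 -> car -> option int;
  etil : 'I_n.+1 -> car -> option car;
  ftil : 'I_n.+1 -> car -> option car }.

Definition is_crystal (n : nat) (B : crystal n) : Prop :=
  forall i (b : B),
  [/\ phi i b = omap (fun z => z + wt b 0 i) (eps i b),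
      forall b', etil i b = Some b' ->
        [/\ wt b' = wt b + alpha i,
            eps i b' = omap (fun z => z - 1) (eps i b)
          & phi i b' = omap (fun z => z + 1) (phi i b)],
      forall b', ftil i b = Some b' ->
        [/\ wt b' = wt b - alpha i,
            eps i b' = omap (fun z => z + 1) (eps i b)
          & phi i b' = omap (fun z => z - 1) (phi i b)],
      forall b', ftil i b = Some b' <-> etil i b' = Some b
    & phi i b = None -> etil i b = None /\ ftil i b = None].

(* epsilon(b) and varphi(b) as weights.  The default 0 for -oo is never used
   below: these are only taken in crystals where eps and phi are finite. *)
Definition epsw (n : nat) (B : crystal n) (b : B) : Pcl n :=
  \row_i odflt 0 (eps i b).
Definition phiw (n : nat) (B : crystal n) (b : B) : Pcl n :=
  \row_i odflt 0 (phi i b).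

Definition morphism (n : nat) (A B : crystal n) (psi : option A -> option B) :
    Prop :=
  [/\ psi None = None,
      forall i a a', etil i a = Some a' ->
        psi (Some a') = obind (etil i) (psi (Some a)),
      forall i a a', ftil i a = Some a' ->
        psi (Some a') = obind (ftil i) (psi (Some a))
    & forall a b, psi (Some a) = Some b ->
        wt b = wt a /\ forall i, eps i b = eps i a /\ phi i b = phi i a].

Definition embedding (n : nat) (A B : crystal n) (psi : option A -> option B) :
    Prop :=
  morphism psi /\ injective psi.

(* T_la (x) B (x) T_mu, with t_la (x) b (x) t_mu identified with b. *)
Definition TBT (n : nat) (la : Pcl n) (B : crystal n) (mu : Pcl n) : crystal n :=
  @Crystal n B (fun b => la + mu + wt b)
    (fun i b => omap (fun z => z - la 0 i) (eps i b))
    (fun i b => omap (fun z => z + mu 0 i) (phi i b))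
    (@etil n B) (@ftil n B).

Definition Kq := {fraction {poly rat}}.
Definition qq : Kq := @tofrac {poly rat} 'X.

(* The local ring of rational functions regular at q = 0. *)
Definition regular0 (a : Kq) : Prop :=
  exists p r : {poly rat},
    r.[0] != 0 /\ a = @tofrac {poly rat} p / @tofrac {poly rat} r.

Definition qint (m : nat) : Kq := (qq ^+ m - qq ^- m) / (qq - qq^-1).
Definition qfact (m : nat) : Kq := \prod_(s < m) qint s.+1.

(* U_q'(A_n^(1)) over Q(q), with weights in P_cl. *)
Section QuantumAffine.
Variables (n d : nat).

Definition divpow (A : 'M[Kq]_d) (m : nat) : 'M[Kq]_d :=
  (qfact m)^-1 *: A ^+ m.

(* The actions of e_i, f_i and t_i = q^(h_i) on a d-dimensional space of
   column vectors. *)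
Record Uq_action := UqAction {
  actE : 'I_n.+1 -> 'M[Kq]_d;
  actF : 'I_n.+1 -> 'M[Kq]_d;
  actT : 'I_n.+1 -> 'M[Kq]_d }.

Definition has_weight (V : Uq_action) (u : 'cV[Kq]_d) (la : Pcl n) : Prop :=
  forall i, actT V i *m u = qq ^ (la 0 i) *: u.

Definition q_serre (X : 'I_n.+1 -> 'M[Kq]_d) : Prop :=
  forall i j, i != j ->
    let N := `|(1 - alpha j 0 i)%R|%N in
    \sum_(s < N.+1) (-1) ^+ s *:
      (divpow (X i) s *m X j *m divpow (X i) (N - s)) = 0.

(* The last clause is the decomposition into weight spaces. *)
Definition is_Uq_module (V : Uq_action) : Prop :=
  [/\ forall i, actT V i \in unitmx
        /\ forall j, actT V i *m actT V j = actT V j *m actT V i,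
      forall i j,
        actT V i *m actE V j = qq ^ (alpha j 0 i) *: (actE V j *m actT V i)
        /\ actT V i *m actF V j
           = qq ^ (- alpha j 0 i) *: (actF V j *m actT V i),
      forall i j,
        actE V i *m actF V j - actF V j *m actE V i
        = if i == j then (qq - qq^-1)^-1 *: (actT V i - invmx (actT V i)) else 0,
      q_serre (actE V) /\ q_serre (actF V)
    & forall u, exists2 s : seq (Pcl n * 'cV[Kq]_d),
        u = \sum_(p <- s) p.2 & forall p, p \in s -> has_weight V p.2 p.1].

(* The linear Kashiwara operators: the vectors f_i^(m) u, with u a weight
   vector killed by e_i and 0 <= m <= <wt u, h_i>, span the module. *)
Definition is_kashiwara (V : Uq_action) (i : 'I_n.+1) (Et Ft : 'M[Kq]_d) :
    Prop :=
  forall (la : Pcl n) (u : 'cV[Kq]_d) (m : nat),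
    has_weight V u la -> actE V i *m u = 0 -> m%:Z <= la 0 i ->
    Et *m (divpow (actF V i) m *m u)
      = (if m is m'.+1 then divpow (actF V i) m' *m u else 0)
    /\ Ft *m (divpow (actF V i) m *m u) = divpow (actF V i) m.+1 *m u.

Definition congq (L : set 'cV[Kq]_d) (u v : 'cV[Kq]_d) : Prop :=
  exists2 w, L w & u - v = qq *: w.

(* L is free over the local ring at q = 0, it spans, it is the sum of its
   weight spaces, and it is stable under the Kashiwara operators. *)
Definition crystal_lattice (V : Uq_action) (Et Ft : 'I_n.+1 -> 'M[Kq]_d)
    (L : set 'cV[Kq]_d) : Prop :=
  [/\ exists2 G : 'M[Kq]_d, G \in unitmx
        & forall u, L u <-> forall i, regular0 ((invmx G *m u) i 0),
      forall u, L u -> exists2 s : seq (Pcl n * 'cV[Kq]_d),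
        u = \sum_(p <- s) p.2
        & forall p, p \in s -> L p.2 /\ has_weight V p.2 p.1
    & forall i u, L u -> L (Et i *m u) /\ L (Ft i *m u)].

(* beta b represents the element b of L / q L; en enumerates the crystal. *)
Definition crystal_basis (B : crystal n) (V : Uq_action)
    (Et Ft : 'I_n.+1 -> 'M[Kq]_d) (L : set 'cV[Kq]_d)
    (en : 'I_d -> B) (beta : B -> 'cV[Kq]_d) : Prop :=
  [/\ bijective en,
      forall b, L (beta b) /\ has_weight V (beta b) (wt b),
      forall u, L u -> exists! r : 'rV[rat]_d,
        congq L u (\sum_j @tofrac {poly rat} (r 0 j)%:P *: beta (en j)),
      forall i b, congq L (Et i *m beta b)
        (if etil i b is Some b' then beta b' else 0)
    & forall i b, congq L (Ft i *m beta b)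
        (if ftil i b is Some b' then beta b' else 0)].

End QuantumAffine.

Definition has_crystal_base (n : nat) (B : crystal n) : Prop :=
  exists (d : nat) (V : Uq_action n d) (Et Ft : 'I_n.+1 -> 'M[Kq]_d)
    (L : set 'cV[Kq]_d) (en : 'I_d -> B) (beta : B -> 'cV[Kq]_d),
  [/\ is_Uq_module V,
      forall i, is_kashiwara V i (Et i) (Ft i),
      crystal_lattice V Et Ft L
    & crystal_basis V Et Ft L en beta].

(* eps and phi are the lengths of the strings through b. *)
Definition string_crystal (n : nat) (B : crystal n) : Prop :=
  forall i (b : B), exists p r : nat,
  [/\ eps i b = Some p%:Z, phi i b = Some r%:Z,
      iter p (obind (etil i)) (Some b) <> None
        /\ iter p.+1 (obind (etil i)) (Some b) = None
    & iter r (obind (ftil i)) (Some b) <> None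
        /\ iter r.+1 (obind (ftil i)) (Some b) = None].

(* Kashiwara's action of the simple reflection s_i on a regular crystal. *)
Definition Srefl (n : nat) (B : crystal n) (i : 'I_n.+1) (b : B) : option B :=
  let m := wt b 0 i in
  iter `|m|%N (obind (if 0 <= m then ftil i else etil i)) (Some b).

Inductive weyl_reach (n : nat) (B : crystal n) (b : B) : B -> Prop :=
| reach_refl : weyl_reach b b
| reach_step b' b'' i :
    weyl_reach b b' -> Srefl i b' = Some b'' -> weyl_reach b b''.

Definition extremal (n : nat) (B : crystal n) (b : B) : Prop :=
  forall b', weyl_reach b b' ->
  forall i, etil i b' = None \/ ftil i b' = None.

(* Simple crystals in the sense of Akasaka and Kashiwara. *)
Definition simple_crystal (n : nat) (B : crystal n) : Prop :=
  exists la : Pcl n,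
  [/\ level la = 0,
      forall b : B, extremal b -> weyl_orbit la (wt b)
    & exists! b : B, wt b = la].

Definition has_level (n l : nat) (B : crystal n) : Prop :=
  (forall b : B, l%:Z <= level (epsw b)) /\ exists b : B, level (epsw b) = l%:Z.

Definition Bmin (n : nat) (B : crystal n) : set B :=
  [set b | forall b' : B, level (epsw b) <= level (epsw b')].
Arguments Bmin {n} B.

(* Everything in the definition of a perfect crystal of level l except the
   realization by a module. *)
Definition perfect_combinatorics (n l : nat) (B : crystal n) : Prop :=
  [/\ [/\ is_crystal B, finite_set [set: B], string_crystal B
        & forall b : B, Pcl0 (wt b)],
      simple_crystal B,
      has_level l B,
      forall la : Pcl n, dominant la -> l%:Z <= level la ->
        (exists b : B, dominant (la - epsw b))
        /\ (exists b : B, dominant (la - phiw b))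
    & set_bij (Bmin B) (@Pplus n l) (@epsw n B)
        /\ set_bij (Bmin B) (@Pplus n l) (@phiw n B)].

Definition perfect (n l : nat) (B : crystal n) : Prop :=
  has_crystal_base B /\ perfect_combinatorics l B.

(* Only the members B l with l >= 1 of a family B : nat -> crystal n matter. *)
Definition is_limit (n : nat) (B : nat -> crystal n) (Binf : crystal n)
    (binf : Binf) : Prop :=
  [/\ is_crystal Binf,
      wt binf = 0,
      forall i, eps i binf = Some 0 /\ phi i binf = Some 0
    & exists f : forall (l : nat) (b : B l),
        option (TBT (epsw b) (B l) (- phiw b)) -> option Binf,
      (forall (l : nat) (b : B l), (0 < l)%N -> Bmin (B l) b ->
         embedding (f l b) /\ f l b (Some b) = Some binf)
      /\ (forall y : Binf, exists (l : nat) (b b' : B l),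
         [/\ (0 < l)%N, Bmin (B l) b & f l b (Some b') = Some y])].

Definition coherent_family (n : nat) (B : nat -> crystal n) : Prop :=
  (forall l, (0 < l)%N -> perfect l (B l))
  /\ exists (Binf : crystal n) (binf : Binf), is_limit B binf.

Definition Binfmin (n : nat) (Binf : crystal n) : set Binf :=
  [set b | level (epsw b) = 0].
Arguments Binfmin {n} Binf.

(* s restricts to the automorphism eps o phi^-1 of P_cl^0, where eps and phi
   are the bijections from Binfmin to P_cl^0. *)
Definition associated_automorphism (n : nat) (Binf : crystal n)
    (s : Pcl n -> Pcl n) : Prop :=
  [/\ set_bij (Binfmin Binf) (@Pcl0 n) (@epsw n Binf),
      set_bij (Binfmin Binf) (@Pcl0 n) (@phiw n Binf)
    & forall b, Binfmin Binf b -> s (phiw b) = epsw b].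

Section Formulas.
Variables (n k : nat).

Definition kp : nat := n.+1 - k.

(* Entry x_{ji}, with indices starting from 1; it is 0 unless 1 <= j <= k and
   1 <= i <= n+1. *)
Definition ent (x : 'M[int]_(k, n.+1)) (j i : nat) : int :=
  \sum_(p : 'I_k * 'I_n.+1 | (p.1.+1 == j) && (p.2.+1 == i)) x p.1 p.2.

Section Classical.
Variables (a : nat) (x : 'M[int]_(k, n.+1)).

Definition bet : nat := a - kp.
Definition gam : nat := minn k a.

Definition Gam (c : nat) : int :=
  \sum_(bet.+1 <= j < c) (ent x j a - ent x j.+1 a.+1).

Definition argminG : seq nat :=
  [seq c <- index_iota bet.+1 gam.+1
     | all (fun c' => Gam c <= Gam c') (index_iota bet.+1 gam.+1)].

(* argminG is nonempty when 1 <= k, a <= n: the defaults are irrelevant. *)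
Definition clo : nat := head bet.+1 argminG.
Definition chi : nat := last bet.+1 argminG.

Definition eps_cl : int := \sum_(bet <= j < clo) (ent x j.+1 a.+1 - ent x j a).
Definition phi_cl : int := \sum_(chi <= j < gam.+1) (ent x j a - ent x j.+1 a.+1).

(* The row r : 'I_k and the column s : 'I_n.+1 stand for (j, i) = (r+1, s+1). *)
Definition e_cl : 'M[int]_(k, n.+1) :=
  \matrix_(r < k, s < n.+1) (x r s
    + ((r.+1 == clo) && (s.+1 == a))%:Z - ((r.+1 == clo) && (s.+1 == a.+1))%:Z).
Definition f_cl : 'M[int]_(k, n.+1) :=
  \matrix_(r < k, s < n.+1) (x r s
    - ((r.+1 == chi) && (s.+1 == a))%:Z + ((r.+1 == chi) && (s.+1 == a.+1))%:Z).

End Classical.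

(* A sequence (c_0, ..., c_k) with values in {0, ..., n+1}. *)
Definition cseq := k.+1.-tuple 'I_n.+2.
Definition cval (c : cseq) (j : nat) : nat := nth ord0 c j.

Definition in_C (c : cseq) : bool :=
  [&& cval c 0 == 1%N, cval c k == n.+1 & [forall j : 'I_k, cval c j < cval c j.+1]%N].

Definition cle (c c' : cseq) : bool :=
  [forall j : 'I_k.+1, cval c j <= cval c' j]%N.

(* (1, 2, ..., k, n+1) and (1, k'+1, k'+2, ..., n+1) *)
Definition cbot : cseq :=
  [tuple if j == ord_max then ord_max else inord j.+1 | j < k.+1].
Definition ctop : cseq :=
  [tuple if j == ord0 then inord 1 else inord (kp + j) | j < k.+1].

Section Zero.
Variable x : 'M[int]_(k, n.+1).

Definition Del (c : cseq) : int :=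
  \sum_(1 <= j < k.+1) \sum_((cval c j.-1).+1 <= i < cval c j) ent x j i.

Definition minimizer (c : cseq) : bool :=
  in_C c && [forall c', in_C c' ==> (Del c <= Del c')].

(* The minimum and the maximum of the set of minimizers; they exist when
   1 <= k <= n, so that the defaults cbot and ctop are irrelevant. *)
Definition cmin : cseq :=
  odflt cbot [pick c | minimizer c && [forall c', minimizer c' ==> cle c c']].
Definition cmax : cseq :=
  odflt ctop [pick c | minimizer c && [forall c', minimizer c' ==> cle c' c]].

Definition e_0 : 'M[int]_(k, n.+1) :=
  \matrix_(r < k, s < n.+1) (x r s
    - (s.+1 == cval cmin r)%:Z + (s.+1 == cval cmin r.+1)%:Z).
Definition f_0 : 'M[int]_(k, n.+1) :=
  \matrix_(r < k, s < n.+1) (x r s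
    - (s.+1 == cval cmax r.+1)%:Z + (s.+1 == cval cmax r)%:Z).

End Zero.

(* The parameter l is the level for B^{k,l}, and 0 for B^{k,oo}. *)
Definition eps_val (l : int) (i : 'I_n.+1) (x : 'M[int]_(k, n.+1)) : int :=
  if i == ord0 then l - ent x k n.+1 - Del x (cmin x) else eps_cl i x.
Definition phi_val (l : int) (i : 'I_n.+1) (x : 'M[int]_(k, n.+1)) : int :=
  if i == ord0 then l - ent x 1 1 - Del x (cmin x) else phi_cl i x.
Definition wt_val (l : int) (x : 'M[int]_(k, n.+1)) : Pcl n :=
  \row_i (phi_val l i x - eps_val l i x).

Definition e_mx (i : 'I_n.+1) (x : 'M[int]_(k, n.+1)) : 'M[int]_(k, n.+1) :=
  if i == ord0 then e_0 x else e_cl i x.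
Definition f_mx (i : 'I_n.+1) (x : 'M[int]_(k, n.+1)) : 'M[int]_(k, n.+1) :=
  if i == ord0 then f_0 x else f_cl i x.

Section Tableaux.
Variable l : nat.

(* The letter i in {1, ..., n+1} is the ordinal i - 1 : 'I_n.+1. *)
Definition semistandard (t : 'M['I_n.+1]_(k, l)) : bool :=
  [forall r : 'I_k, forall c : 'I_l, forall c' : 'I_l,
     (c <= c')%N ==> (t r c <= t r c')%N]
  && [forall c : 'I_l, forall r : 'I_k, forall r' : 'I_k,
     (r < r')%N ==> (t r c < t r' c)%N].

Definition tableau := {t : 'M['I_n.+1]_(k, l) | semistandard t}.

Definition enc (b : tableau) : 'M[int]_(k, n.+1) :=
  \matrix_(r < k, s < n.+1) #|[pred c : 'I_l | val b r c == s]|%:Z.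

Definition e_vanishes (i : 'I_n.+1) (b : tableau) : bool :=
  if i == ord0 then (cmin (enc b) == cbot) && (ent (enc b) k k == 0)
  else ~~ (0 < eps_val l%:Z i (enc b)).
Definition f_vanishes (i : 'I_n.+1) (b : tableau) : bool :=
  if i == ord0 then (cmax (enc b) == ctop) && (ent (enc b) 1 kp.+1 == 0)
  else ~~ (0 < phi_val l%:Z i (enc b)).

(* A tableau is determined by its encoding, so that [pick ..] is the tableau
   with the given encoding. *)
Definition e_tab (i : 'I_n.+1) (b : tableau) : option tableau :=
  if e_vanishes i b then None
  else [pick b' : tableau | enc b' == e_mx i (enc b)].
Definition f_tab (i : 'I_n.+1) (b : tableau) : option tableau :=
  if f_vanishes i b then None
  else [pick b' : tableau | enc b' == f_mx i (enc b)].

Definition Bkl : crystal n :=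
  @Crystal n tableau (fun b => wt_val l%:Z (enc b))
    (fun i b => Some (eps_val l%:Z i (enc b)))
    (fun i b => Some (phi_val l%:Z i (enc b)))
    e_tab f_tab.

End Tableaux.

(* nu_{ji} = 0 unless j <= i <= j + k', and all row sums vanish. *)
Definition in_Bkinf (nu : 'M[int]_(k, n.+1)) : bool :=
  [forall r : 'I_k, forall s : 'I_n.+1,
     ~~ (r <= s <= r + kp)%N ==> (nu r s == 0)]
  && [forall r : 'I_k, \sum_s nu r s == 0].

Definition Bkinf_elt := {nu : 'M[int]_(k, n.+1) | in_Bkinf nu}.

(* insub is never None here: see etil_Bkinf_neq0 and ftil_Bkinf_neq0. *)
Definition Bkinf : crystal n :=
  @Crystal n Bkinf_elt (fun nu => wt_val 0 (val nu))
    (fun i nu => Some (eps_val 0 i (val nu)))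
    (fun i nu => Some (phi_val 0 i (val nu)))
    (fun i nu => insub (e_mx i (val nu)))
    (fun i nu => insub (f_mx i (val nu))).

Lemma zero_in_Bkinf : in_Bkinf 0.
Proof.
apply/andP; split; apply/forallP => r; last first.
  by rewrite big1 // => s _; rewrite mxE.
by apply/forallP => s; rewrite mxE eqxx implybT.
Qed.

Definition b_infty : Bkinf := exist _ 0 zero_in_Bkinf.

(* Moving one unit inside each row of a set of rows preserves B^{k,oo}. *)
Lemma in_Bkinf_move (x y : 'M[int]_(k, n.+1)) (b : pred 'I_k)
    (p q : 'I_k -> nat) :
  (k <= n)%N ->
  (forall r, b r -> (r < p r <= (r + kp).+1)%N) ->
  (forall r, b r -> (r < q r <= (r + kp).+1)%N) ->
  (forall r s, y r s = x r s + (b r && (s.+1 == p r))%:Z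
                       - (b r && (s.+1 == q r))%:Z) ->
  in_Bkinf x -> in_Bkinf y.
Proof.
move=> hkn hp hq hy /andP[/forallP hx0 /forallP hx1].
apply/andP; split; apply/forallP => r.
  apply/forallP => s; apply/implyP => hs.
  have /forallP/(_ s)/implyP/(_ hs)/eqP x0 := hx0 r.
  rewrite hy x0; case hb: (b r); last by rewrite subrr.
  have [P1 P2] := andP (hp _ hb); have [Q1 Q2] := andP (hq _ hb).
  have out m : (r < m)%N -> (m <= (r + kp).+1)%N -> (s.+1 == m) = false.
    move=> m1 m2; apply/negbTE/eqP => e; move: hs; rewrite -e in m1 m2.
    by rewrite -ltnS m1 -ltnS m2.
  by rewrite !out.
have sum1 m : (b r -> (r < m <= (r + kp).+1)%N) ->
    \sum_(s < n.+1) (b r && (s.+1 == m))%:Z = (b r)%:Z.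
  move=> hm; case hb: (b r); last by rewrite big1.
  have /andP[m1 m2] := hm hb.
  have mn : (m.-1 < n.+1)%N.
    rewrite prednK ?(leq_ltn_trans _ m1) // (leq_trans m2) //.
    by rewrite -addSn /kp -[X in (_ <= X)%N](subnKC (leqW hkn)) leq_add2r.
  rewrite (bigD1 (Ordinal mn)) //= prednK ?(leq_ltn_trans _ m1) // eqxx.
  rewrite big1 ?addr0 // => s ns; case: eqP => // e; case/eqP: ns.
  by apply/val_inj; rewrite /= -e.
under eq_bigr do rewrite hy.
rewrite sumrB big_split /= !sum1; [|exact: hq|exact: hp].
by rewrite addrK.
Qed.

Lemma in_bounds_G (a c : nat) (x : 'M[int]_(k, n.+1)) :
  (0 < k <= n)%N -> (0 < a <= n)%N -> c = clo a x \/ c = chi a x ->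
  (bet a < c <= gam a)%N.
Proof.
move=> /andP[k0 kn] /andP[a0 an] hc.
have bg : (bet a < gam a)%N by rewrite /bet /gam /kp; lia.
have hd c' : c' \in argminG a x -> (bet a < c' <= gam a)%N.
  by rewrite mem_filter mem_index_iota ltnS => /andP[].
case: hc => ->; rewrite /clo /chi; case E: (argminG a x) => [|c0 s] /=;
  rewrite ?ltnSn //; apply: hd; rewrite E ?mem_head //; exact: mem_last.
Qed.

Lemma in_C_bounds (c : cseq) (r : 'I_k) : (k <= n)%N -> in_C c ->
  (r < cval c r <= (r + kp).+1)%N /\ (r < cval c r.+1 <= (r + kp).+1)%N.
Proof.
move=> kn /and3P[/eqP c0 /eqP ck /forallP hc].
have lo j : (j <= k)%N -> (j < cval c j)%N.
  elim: j => [|j IH] hj; first by rewrite c0.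
  exact: leq_ltn_trans (IH (ltnW hj)) (hc (Ordinal hj)).
have hi j : (j <= k)%N -> (cval c (k - j) + j <= n.+1)%N.
  elim: j => [|j IH] hj; first by rewrite subn0 ck addn0.
  have kj : (k - j.+1 < k)%N by rewrite ltn_subrL /= (leq_ltn_trans _ hj).
  have := hc (Ordinal kj); rewrite /= -subSn // subSS => lt.
  by rewrite addnS -addSn (leq_trans _ (IH (ltnW hj))) // leq_add2r.
have up j : (j <= k)%N -> (cval c j <= j + kp)%N.
  move=> hj; have := hi _ (leq_subr j k); rewrite subKn // => h.
  rewrite -(leq_add2r (k - j)) (leq_trans h) // addnAC subnKC // /kp.
  by rewrite subnKC // leqW.
have rk := ltn_ord r; split; apply/andP; split.
- exact: lo (ltnW rk).
- exact: leqW (up _ (ltnW rk)).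
- exact: leq_trans (lo _ rk).
- by rewrite -addSn up.
Qed.

Lemma in_C_cbot : (0 < k <= n)%N -> in_C cbot.
Proof.
move=> /andP[k0 kn].
have cE j : (j <= k)%N -> cval cbot j = if j == k then n.+1 else j.+1.
  rewrite -ltnS => hj; rewrite /cval /cbot (nth_mktuple _ _ (Ordinal hj)).
  rewrite -val_eqE /=; case: eqP => [//|/eqP jk]; rewrite inordK //.
  have jk' : (j < k)%N by rewrite ltn_neqAle jk.
  by rewrite !ltnS (leq_trans (ltnW jk')).
have k1 : (0 == k)%N = false by apply/eqP => e; rewrite -e in k0.
rewrite /in_C !cE // k1 !eqxx /=; apply/forallP => j; have jk := ltn_ord j.
rewrite !cE ?(ltnW jk) // (ltn_eqF jk); case: eqP => // _.
by rewrite ltnS (leq_trans jk).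
Qed.

Lemma in_C_ctop : (0 < k <= n)%N -> in_C ctop.
Proof.
move=> /andP[k0 kn].
have kp0 : (0 < kp)%N by rewrite /kp subn_gt0 ltnS.
have kkp : (kp + k = n.+1)%N by rewrite /kp subnK // leqW.
have cE j : (j <= k)%N -> cval ctop j = if j == 0%N then 1%N else (kp + j)%N.
  move=> hk; have hj : (j < k.+1)%N by [].
  rewrite /cval /ctop (nth_mktuple _ _ (Ordinal hj)).
  rewrite -val_eqE /=; case: eqP => _; rewrite inordK //.
  by rewrite ltnS -kkp leq_add2l.
rewrite /in_C !cE // (gtn_eqF k0) kkp !eqxx /=.
apply/forallP => j; have jk := ltn_ord j.
rewrite !cE ?(ltnW jk) //=; case: eqP => [->|_]; last by rewrite addnS.
by rewrite addn1 ltnS.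
Qed.

Lemma in_C_cmin (x : 'M[int]_(k, n.+1)) : (0 < k <= n)%N -> in_C (cmin x).
Proof.
move=> hk; rewrite /cmin; case: pickP => [c|_] /=; last exact: in_C_cbot.
by case/andP => /andP[].
Qed.

Lemma in_C_cmax (x : 'M[int]_(k, n.+1)) : (0 < k <= n)%N -> in_C (cmax x).
Proof.
move=> hk; rewrite /cmax; case: pickP => [c|_] /=; last exact: in_C_ctop.
by case/andP => /andP[].
Qed.

Lemma bounds_row (a c : nat) (r : 'I_k) : (bet a < c <= gam a)%N ->
  r.+1 == c -> (r < a <= (r + kp).+1)%N /\ (r < a.+1 <= (r + kp).+1)%N.
Proof.
move=> /andP[h1 h2] /eqP e; rewrite -e in h1 h2.
move: h2; rewrite /gam leq_min => /andP[_ ra].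
have ak : (a <= r + kp)%N.
  by move: h1; rewrite /bet ltnS leq_subLR addnC.
by rewrite ra (leqW ak) (leqW ra) ltnS ak.
Qed.

Lemma in_Bkinf_e (i : 'I_n.+1) (x : 'M[int]_(k, n.+1)) :
  (0 < k <= n)%N -> in_Bkinf x -> in_Bkinf (e_mx i x).
Proof.
move=> hk; have kn : (k <= n)%N by case/andP: hk.
rewrite /e_mx; case: eqP => [_|/eqP i0].
  have B r := in_C_bounds r kn (in_C_cmin x hk).
  apply: (in_Bkinf_move (b := predT) (p := fun r => cval (cmin x) r.+1)
    (q := fun r => cval (cmin x) r)) => // [r _|r _|r s].
  - by case: (B r).
  - by case: (B r).
  - by rewrite mxE /= addrAC.
have hi : (0 < i <= n)%N.
  rewrite lt0n -ltnS ltn_ord andbT; apply: contra i0 => /eqP e.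
  by apply/eqP/val_inj.
have G := in_bounds_G hk hi (or_introl (erefl (clo i x))).
apply: (in_Bkinf_move (b := fun r : 'I_k => r.+1 == clo i x)
  (p := fun=> nat_of_ord i) (q := fun=> i.+1)) => // [r hr|r hr|r s].
- by case: (bounds_row G hr).
- by case: (bounds_row G hr).
- by rewrite mxE.
Qed.

Lemma in_Bkinf_f (i : 'I_n.+1) (x : 'M[int]_(k, n.+1)) :
  (0 < k <= n)%N -> in_Bkinf x -> in_Bkinf (f_mx i x).
Proof.
move=> hk; have kn : (k <= n)%N by case/andP: hk.
rewrite /f_mx; case: eqP => [_|/eqP i0].
  have B r := in_C_bounds r kn (in_C_cmax x hk).
  apply: (in_Bkinf_move (b := predT) (p := fun r => cval (cmax x) r)
    (q := fun r => cval (cmax x) r.+1)) => // [r _|r _|r s].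
  - by case: (B r).
  - by case: (B r).
  - by rewrite mxE /= addrAC.
have hi : (0 < i <= n)%N.
  rewrite lt0n -ltnS ltn_ord andbT; apply: contra i0 => /eqP e.
  by apply/eqP/val_inj.
have G := in_bounds_G hk hi (or_intror (erefl (chi i x))).
apply: (in_Bkinf_move (b := fun r : 'I_k => r.+1 == chi i x)
  (p := fun=> i.+1) (q := fun=> nat_of_ord i)) => // [r hr|r hr|r s].
- by case: (bounds_row G hr).
- by case: (bounds_row G hr).
- by rewrite mxE addrAC.
Qed.

Lemma etil_Bkinf_neq0 (i : 'I_n.+1) (nu : Bkinf) :
  (0 < k <= n)%N -> etil i nu <> None.
Proof.
by move=> hk; rewrite /= insubT //; exact: in_Bkinf_e hk (valP nu).
Qed.

Lemma ftil_Bkinf_neq0 (i : 'I_n.+1) (nu : Bkinf) :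
  (0 < k <= n)%N -> ftil i nu <> None.
Proof.
by move=> hk; rewrite /= insubT //; exact: in_Bkinf_f hk (valP nu).
Qed.

End Formulas.

(* Main.v *)
Require Import Defs.
From HB Require Import structures.
From mathcomp Require Import all_boot all_order all_algebra.
From mathcomp Require Import zify.
From mathcomp Require Import boolp classical_sets functions cardinality.
Set Implicit Arguments.
Unset Strict Implicit.
Unset Printing Implicit Defensive.
Import Order.TTheory GRing.Theory Num.Theory.
Local Open Scope ring_scope.

(** Everything rests on two ways of reading the formulas for the operators.

    For the index 0, summation by parts ([DelE]) rewrites Delta as a constant
    plus a sum of terms [gap x j (c_j)], one for each interior point of the path
    [c]. Being separable, this cost is modular on the lattice of increasing
    paths, so it has a least and a greatest minimizer. The operator [e_0]
    changes the gaps along the least minimizer in such a way that the minimal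
    cost stays the same and that path becomes the greatest minimizer
    ([first_min_push]); hence [f_0] inverts [e_0], and the half-turn of the
    rectangle gives the other composition. For an index [a] different from 0,
    [epsilon_a] is the maximum of a function ([rise]) on an interval, and the
    same happens with its first and last maximum. This gives the crystal axioms
    for integer matrices with constant row sums, hence for both families at once
    ([is_crystal_of_matrices]).

    A matrix encodes a tableau when its entries and its gaps are nonnegative and
    its rows have sum [l] ([tableau_like_enc]). The minimality of the chosen
    paths and positions shows that an operator keeps these conditions whenever
    the corresponding [epsilon] or [varphi] is positive, which yields the
    crystals of tableaux and the lengths of their strings.

    The level of [epsilon] is [l] plus a sum of nonnegative defects
    ([sum_eps_defect]). All of them vanish exactly when every inner diagonal of
    the matrix is constant ([flat_of_level], [level_of_flat]). Such flat matrices
    are parametrized by the value of [epsilon] ([eps_flat_mx], [flat_eps_inj]),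
    and their [varphi] is the cyclic shift of [epsilon] by [k] ([phi_flat_eps]).
    On a flat matrix all paths have the same cost and [rise] is constant, so that
    subtracting it commutes with all operators ([e_mx_sub], [f_mx_sub]) and
    subtracts its [epsilon] and [varphi]: the embedding attached to a minimal
    tableau is subtraction of its encoding. A flat tableau with large entries
    and gaps reaches any given element of the limit ([embed_surj]).

    The crystals of tableaux are simple because an extremal element can be
    reflected to one of classically dominant weight ([reach_dominant]), which by
    extremality is a highest weight tableau, and there is only one of these
    ([diagonal_of_eps], [diagonal_of_wt]). *)

(** * Sums over intervals of integers *)

Lemma sum_nat_eqz (m p a : nat) :
  \sum_(m <= s < p) (s == a)%:Z = (m <= a < p)%N%:Z.
Proof.
case: (boolP (m <= a < p)%N) => [hap|hap].
  rewrite (bigD1_seq a) ?mem_index_iota ?iota_uniq //= eqxx big1 ?addr0 //.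
  by move=> s /negbTE ->.
by rewrite big_nat big1 // => s hs; case: eqP => // e; move: hap; rewrite -e hs.
Qed.

Lemma sum_nat_split (m p q : nat) (F : nat -> int) : (m <= p <= q)%N ->
  \sum_(m <= i < q) F i = \sum_(m <= i < p) F i + \sum_(p <= i < q) F i.
Proof. by move=> /andP[h1 h2]; rewrite (big_cat_nat h1 h2). Qed.

Lemma sum_trim (m p q r : nat) (F : nat -> int) : (m <= p <= q)%N -> (q <= r)%N ->
  (forall j, (m <= j < p)%N -> F j = 0) -> (forall j, (q <= j < r)%N -> F j = 0) ->
  \sum_(m <= j < r) F j = \sum_(p <= j < q) F j.
Proof.
move=> hpq qr h1 h2; rewrite (sum_nat_split (p := p)); last by lia.
rewrite big_nat big1 // add0r (sum_nat_split (p := q)); last by lia.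
by rewrite [X in _ + X]big_nat [X in _ + X]big1 // addr0.
Qed.

Section Entries.
Variables (n k : nat).
Implicit Types (x y : 'M[int]_(k, n.+1)).

Lemma entS x (r : 'I_k) (s : 'I_n.+1) : ent x r.+1 s.+1 = x r s.
Proof.
rewrite /ent (big_pred1 (r, s)) //= => -[r' s'] /=.
Qed.

Lemma ent_out x j i : ~~ ((0 < j <= k) && (0 < i <= n.+1))%N -> ent x j i = 0.
Proof.
move=> h; rewrite /ent big1 // => -[r s] /= /andP[/eqP e1 /eqP e2].
by move: h; rewrite -e1 -e2 /= !ltn_ord.
Qed.

Lemma ent_mx y (F : nat -> nat -> int) j i : (0 < j <= k)%N -> (0 < i <= n.+1)%N ->
  (forall r s, y r s = F r.+1 s.+1) -> ent y j i = F j i.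
Proof.
case: j => // j; case: i => // i /= hj hi hy.
by rewrite -[j.+1]/((Ordinal hj : nat).+1) -[i.+1]/((Ordinal hi : nat).+1) entS hy.
Qed.

Lemma ent_inj x y :
  (forall j i, (0 < j <= k)%N -> (0 < i <= n.+1)%N -> ent x j i = ent y j i) -> x = y.
Proof. by move=> h; apply/matrixP => r s; rewrite -!entS h ?ltn_ord. Qed.

Lemma entB x y j i : ent (x - y) j i = ent x j i - ent y j i.
Proof. by rewrite /ent -sumrB; apply: eq_bigr => p _; rewrite !mxE. Qed.

Lemma entD x y j i : ent (x + y) j i = ent x j i + ent y j i.
Proof. by rewrite /ent -big_split; apply: eq_bigr => p _; rewrite !mxE. Qed.

Lemma ent0 j i : ent (0 : 'M[int]_(k, n.+1)) j i = 0.
Proof. by rewrite /ent big1 // => p _; rewrite mxE. Qed.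

(** For the encoding of a tableau, [psum x j (j + m)] as a function of [j] and
    [m] is a plane partition; the operators of nonzero index change one of its
    parts by one, and those of index 0 change it by one along a lattice path. *)
Definition psum x (j i : nat) : int := \sum_(1 <= s < i.+1) ent x j s.

(** The letters at most [i - 1] in row [j] minus the letters at most [i] in row
    [j + 1]: columns increase strictly when this is nonnegative. The function
    [Del] is a sum of gaps over the interior points of the path. *)
Definition gap x (j i : nat) : int := psum x j i.-1 - psum x j.+1 i.

Definition supported x : Prop :=
  forall j i, ~~ (j <= i <= j + kp n k)%N -> ent x j i = 0.

Lemma psum0 x j : psum x j 0 = 0.
Proof. by rewrite /psum big_geq. Qed.

Lemma psumS x j i : psum x j i.+1 = psum x j i + ent x j i.+1.
Proof. by rewrite /psum big_nat_recr. Qed.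

Lemma psum_pred x j i : (0 < i)%N -> psum x j i = psum x j i.-1 + ent x j i.
Proof. by case: i => // i _; rewrite psumS. Qed.

Lemma psumB x y j i : psum (x - y) j i = psum x j i - psum y j i.
Proof. by rewrite /psum -sumrB; apply: eq_bigr => s _; rewrite entB. Qed.

Lemma psumD x y j i : psum (x + y) j i = psum x j i + psum y j i.
Proof. by rewrite /psum -big_split; apply: eq_bigr => s _; rewrite entD. Qed.

Lemma gapD x y j i : gap (x + y) j i = gap x j i + gap y j i.
Proof. rewrite /gap !psumD; lia. Qed.

Lemma gapB x y j i : gap (x - y) j i = gap x j i - gap y j i.
Proof. rewrite /gap !psumB; lia. Qed.

Lemma gapS x j a : (0 < a)%N -> gap x j a.+1 = gap x j a + ent x j a - ent x j.+1 a.+1.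
Proof. by case: a => // a _; rewrite /gap /= !psumS; lia. Qed.

Lemma psum_low x j i : supported x -> (i < j)%N -> psum x j i = 0.
Proof.
move=> sx hij; rewrite /psum big_nat big1 // => s hs; apply: sx.
by apply/negP; lia.
Qed.

Lemma psum_high x j i i' : supported x -> (j + kp n k <= i)%N -> (j + kp n k <= i')%N ->
  psum x j i = psum x j i'.
Proof.
move=> sx; wlog: i i' / (i <= i')%N => [H h1 h2|le h1 h2].
  by case: (leqP i i') => [/H|/ltnW/H e]; [|symmetry]; auto.
rewrite /psum (sum_nat_split (p := i.+1) (q := i'.+1)); last by lia.
rewrite [X in _ = _ + X]big_nat [X in _ = _ + X]big1 ?addr0 // => s hs.
by apply: sx; apply/negP; lia.
Qed.

Lemma psum_row x j : (0 < j)%N -> psum x j n.+1 = \sum_(s < n.+1) ent x j s.+1.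
Proof. by rewrite /psum big_add1 /= big_mkord. Qed.

Definition colsum x (i : nat) : int := \sum_(1 <= j < k.+1) ent x j i.

End Entries.

(** * Separable functions on increasing sequences *)

Section Paths.
Variables (k N : nat).
Implicit Types (g h c : nat -> nat) (w : nat -> nat -> int).

Definition increasing g : Prop :=
  [/\ g 0%N = 1%N, g k = N & forall j, (j < k)%N -> (g j < g j.+1)%N].

Definition pcost w g : int := \sum_(1 <= j < k) w j (g j).

Definition first_min w c : Prop :=
  increasing c /\ forall h, increasing h ->
    pcost w c <= pcost w h
    /\ (pcost w h <= pcost w c -> forall j, (j <= k)%N -> (c j <= h j)%N).

Definition last_min w c : Prop :=
  increasing c /\ forall h, increasing h ->
    pcost w c <= pcost w h
    /\ (pcost w h <= pcost w c -> forall j, (j <= k)%N -> (h j <= c j)%N).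

Lemma eq_pcost w g h : (forall j, (0 < j < k)%N -> g j = h j) ->
  pcost w g = pcost w h.
Proof. by move=> e; rewrite /pcost !big_nat; apply: eq_bigr => j /e ->. Qed.

Lemma pcost_eqw w w' g : (forall j, (0 < j < k)%N -> w j (g j) = w' j (g j)) ->
  pcost w g = pcost w' g.
Proof. by move=> e; rewrite /pcost !big_nat; apply: eq_bigr => j /e ->. Qed.

Lemma increasing_min g h : increasing g -> increasing h ->
  increasing (fun j => minn (g j) (h j)).
Proof.
move=> [a0 ak a] [b0 bk b]; split; [lia|lia|] => j hj.
by have := a j hj; have := b j hj; lia.
Qed.

Lemma increasing_max g h : increasing g -> increasing h ->
  increasing (fun j => maxn (g j) (h j)).
Proof.
move=> [a0 ak a] [b0 bk b]; split; [lia|lia|] => j hj.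
by have := a j hj; have := b j hj; lia.
Qed.

(** The cost is separable, hence modular for the componentwise lattice. *)
Lemma pcost_modular w g h :
  pcost w (fun j => minn (g j) (h j)) + pcost w (fun j => maxn (g j) (h j))
  = pcost w g + pcost w h.
Proof.
rewrite /pcost -!big_split /=; apply: eq_bigr => j _.
by rewrite /minn /maxn; case: ltnP => _ //; rewrite addrC.
Qed.

Lemma increasing_homo g i j : increasing g -> (i <= j <= k)%N ->
  (g i + (j - i) <= g j)%N.
Proof.
move=> [_ _ a] /andP[]; elim: j => [|j IH] hij hj.
  by rewrite (_ : i = 0%N) ?subnn ?addn0 //; lia.
case: (eqVneq i j.+1) => [->|ne]; first by rewrite subnn addn0.
by have := a j hj; have := IH ltac:(lia) ltac:(lia); lia.
Qed.

(** Cutting [h] at the places where it can be joined to [c] yields blocks;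
    exchanging a block of [c] for that of [h] lowers the path, so it raises the
    cost strictly unless the two blocks are equal. Only the first index of a
    block can be counted on the left, and only when the blocks differ. *)
Lemma first_min_drop_from w c h : first_min w c -> increasing h ->
  (forall j, (j <= k)%N -> (h j <= c j)%N) ->
  forall m s, (k <= s + m)%N -> (0 < s <= k)%N -> (c s.-1 < h s)%N ->
  \sum_(s <= j < k) (c j.-1 < h j < c j)%N%:Z
  <= \sum_(s <= j < k) (w j (h j) - w j (c j)).
Proof.
move=> [pc minc] ph hc; elim=> [|m IH] s hm hs hcs.
  by rewrite !big_geq //; lia.
case: (eqVneq s k) => [->|sk]; first by rewrite !big_geq.
have [c0 ck c1] := pc; have [h0 hk h1] := ph.
have ex : exists t, [&& (s <= t)%N, (t < k)%N & (c t < h t.+1)%N].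
  exists k.-1; have := c1 k.-1 ltac:(lia); rewrite prednK; last by lia.
  by rewrite hk -ck => ->; rewrite andbT; apply/andP; split; lia.
case: (ex_minnP ex) => t /and3P[st tk ct] tmin {ex}.
rewrite (sum_nat_split (p := t.+1)); last by lia.
rewrite [X in _ <= X](sum_nat_split (p := t.+1)); last by lia.
apply: lerD; last by apply: IH => //=; lia.
pose g j := if (s <= j <= t)%N then h j else c j.
have pg : increasing g.
  split; rewrite /g ?ifF //; [by lia|by lia|].
  move=> j hj; case: (boolP (s <= j <= t)%N) => a1;
    case: (boolP (s <= j.+1 <= t)%N) => a2.
  - exact: h1.
  - exact: leq_ltn_trans (hc _ (ltnW hj)) (c1 _ hj).
  - by move: hcs; have -> : s = j.+1 by lia.
  - exact: c1.
have -> : \sum_(s <= j < t.+1) (c j.-1 < h j < c j)%N%:Z = (h s < c s)%N%:Z.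
  rewrite big_ltn; last by lia.
  rewrite hcs /= big_nat big1 ?addr0 // => j hj.
  have /negbTE-> // : ~~ (c j.-1 < h j)%N.
  apply/negP => lt; have := tmin j.-1.
  by rewrite prednK ?lt ?andbT; lia.
have gE : pcost w g - pcost w c = \sum_(s <= j < t.+1) (w j (h j) - w j (c j)).
  rewrite /pcost -sumrB [LHS](sum_nat_split (p := s)); last by lia.
  rewrite [X in _ + X = _](sum_nat_split (p := t.+1)); last by lia.
  rewrite [X in X + _ = _]big_nat big1 ?add0r; last first.
    move=> j hj; rewrite /g (_ : (s <= j <= t)%N = false) ?subrr //.
    by apply/negP; lia.
  rewrite [X in _ + X = _]big_nat [X in _ + X = _]big1 ?addr0; last first.
    move=> j hj; rewrite /g (_ : (s <= j <= t)%N = false) ?subrr //.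
    by apply/negP; lia.
  by rewrite !big_nat; apply: eq_bigr => j hj; rewrite /g ifT.
have [m1 m2] := minc _ pg; rewrite -gE.
case: ltnP => [lt|_]; last by lia.
case: (lerP (pcost w g) (pcost w c)) => [/m2 /(_ s)|]; last by lia.
by rewrite /g ifT; lia.
Qed.

Lemma first_min_drop w c h : first_min w c -> increasing h ->
  (forall j, (j <= k)%N -> (h j <= c j)%N) ->
  \sum_(1 <= j < k) (c j.-1 < h j < c j)%N%:Z <= pcost w h - pcost w c.
Proof.
move=> fc ph hc; rewrite /pcost -sumrB; case: (leqP k 1) => k1.
  by rewrite !big_geq.
have [[c0 _ _] _] := fc; have [h0 _ h1] := ph.
apply: (first_min_drop_from fc ph hc (m := k)) => //=; try lia.
by have := h1 0%N ltac:(lia); rewrite h0 c0.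
Qed.

(** Pushing the costs along the first minimizer turns it into the last
    minimizer, with the same cost: this is why the two Kashiwara operators are
    inverse to each other. *)
Lemma first_min_push w w' c : first_min w c ->
  (forall j i, (0 < j < k)%N -> w' j i =
     w j i - (c j.-1 < i < c j)%N%:Z + (c j < i < c j.+1)%N%:Z) ->
  pcost w' c = pcost w c /\ last_min w' c.
Proof.
move=> fc w'E; have [pc minc] := fc; have [c0 ck c1] := pc.
have cE : pcost w' c = pcost w c.
  by apply: pcost_eqw => j hj; rewrite w'E // !ltnn andbF /=; lia.
have low h : increasing h -> (forall j, (j <= k)%N -> (h j <= c j)%N) ->
    pcost w' c <= pcost w' h.
  move=> ph hc; have := first_min_drop fc ph hc.
  have -> : pcost w' h = pcost w h - \sum_(1 <= j < k) (c j.-1 < h j < c j)%N%:Z.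
    rewrite /pcost -sumrB !big_nat; apply: eq_bigr => j hj.
    rewrite w'E //; have := hc j ltac:(lia).
    by case: (ltnP (c j) (h j)) => //=; lia.
  by rewrite cE; lia.
have high h : increasing h -> (forall j, (j <= k)%N -> (c j <= h j)%N) ->
    pcost w' c <= pcost w' h
    /\ (pcost w' h <= pcost w' c -> forall j, (j <= k)%N -> (h j <= c j)%N).
  move=> ph hc; have [m1 _] := minc _ ph; have [h0 hk h1] := ph.
  have -> : pcost w' h = pcost w h + \sum_(1 <= j < k) (c j < h j < c j.+1)%N%:Z.
    rewrite /pcost -big_split /= !big_nat; apply: eq_bigr => j hj.
    rewrite w'E //; have := hc j ltac:(lia).
    by case: (ltnP (h j) (c j)) => //=; rewrite ?andbF; lia.
  set S := \sum_(_ <= _ < _) _.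
  have S0 : 0 <= S by apply: sumr_ge0 => j _; lia.
  split=> [|le]; first by lia.
  have S00 : S = 0 by lia.
  have z j : (0 < j < k)%N -> ~~ (c j < h j < c j.+1)%N.
    move=> hj; apply/negP => hh; move: S00; rewrite /S.
    rewrite (bigD1_seq j) ?mem_index_iota ?iota_uniq //= hh.
    set T := (\sum_(_ <- _ | _) _) => e.
    have T0 : 0 <= T by apply: sumr_ge0 => i _; lia.
    by lia.
  have down i : (i <= k)%N -> (h (k - i)%N <= c (k - i)%N)%N.
    elim: i => [|i IH] hi; first by rewrite subn0 hk ck.
    case: (eqVneq i.+1 k) => [->|ne]; first by rewrite subnn h0 c0.
    have [j [e1 e2]] : exists j, (k - i = j.+1 /\ k - i.+1 = j)%N.
      by exists (k - i.+1)%N; lia.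
    have := IH ltac:(lia); rewrite e1 e2 => le1.
    have := z j ltac:(lia); have := h1 j ltac:(lia); lia.
  by move=> j hj; have := down (k - j)%N ltac:(lia); rewrite subKn.
split=> //; split=> // h ph.
have md := pcost_modular w' c h.
have [M1 M2] := high _ (increasing_max pc ph) (fun j _ => leq_maxl _ _).
have L := low _ (increasing_min pc ph) (fun j _ => geq_minl _ _).
split; first by lia.
move=> le j hj; have := M2 ltac:(lia) j hj; lia.
Qed.

Lemma first_min_uniq w c c' : first_min w c -> first_min w c' ->
  forall j, (j <= k)%N -> c j = c' j.
Proof.
move=> [p m] [p' m'] j hj; have [a b] := m _ p'; have [a' b'] := m' _ p.
by have := b a' j hj; have := b' a j hj; lia.
Qed.

Lemma last_min_uniq w c c' : last_min w c -> last_min w c' ->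
  forall j, (j <= k)%N -> c j = c' j.
Proof.
move=> [p m] [p' m'] j hj; have [a b] := m _ p'; have [a' b'] := m' _ p.
by have := b a' j hj; have := b' a j hj; lia.
Qed.

(** Reversal exchanges first and last minimizers. *)
Definition path_rev g (j : nat) : nat := (N.+1 - g (k - j))%N.
Definition cost_rev w (j i : nat) : int := w (k - j)%N (N.+1 - i)%N.

Lemma increasing_bounds g j : increasing g -> (j <= k)%N -> (j < g j <= N)%N.
Proof.
move=> pg hj; have [g0 gk _] := pg.
have := @increasing_homo g 0 j pg ltac:(lia);
  have := @increasing_homo g j k pg ltac:(lia).
lia.
Qed.

Lemma increasing_rev g : increasing g -> increasing (path_rev g).
Proof.
move=> pg; have [g0 gk g1] := pg; rewrite /path_rev; split.
- by rewrite subn0 gk; lia.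
- by rewrite subnn g0; lia.
move=> j hj; have := g1 (k - j.+1)%N ltac:(lia).
rewrite -subSn // subSS; have := increasing_bounds pg (leq_subr j k).
lia.
Qed.

Lemma path_revK g j : increasing g -> (j <= k)%N -> path_rev (path_rev g) j = g j.
Proof.
by move=> pg hj; rewrite /path_rev (subKn hj); have := increasing_bounds pg hj; lia.
Qed.

Lemma pcost_rev w g : increasing g -> pcost (cost_rev w) (path_rev g) = pcost w g.
Proof.
move=> pg; rewrite /pcost big_nat_rev /= !big_nat; apply: eq_bigr => j hj.
have -> : (1 + k - j.+1 = k - j)%N by lia.
rewrite /cost_rev /path_rev subKn; last by lia.
by congr (w _ _); have := @increasing_bounds g j pg; lia.
Qed.

Lemma pcost_rev' w g : increasing g -> pcost (cost_rev w) g = pcost w (path_rev g).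
Proof.
move=> pg; rewrite -(pcost_rev w (increasing_rev pg)).
by apply: eq_pcost => j hj; rewrite path_revK //; lia.
Qed.

Lemma first_min_rev w c : first_min w c -> last_min (cost_rev w) (path_rev c).
Proof.
move=> [pc m]; split; first exact: increasing_rev.
move=> h ph; have [m1 m2] := m _ (increasing_rev ph).
rewrite pcost_rev // pcost_rev' //; split=> // /m2 le j hj.
have := le (k - j)%N ltac:(lia); rewrite /path_rev subKn //.
by have := increasing_bounds ph hj; lia.
Qed.

End Paths.

(** * The operators of index 0 *)

Section Zero.
Variables (n k : nat).
Hypothesis hk : (0 < k <= n)%N.
Implicit Types (x y : 'M[int]_(k, n.+1)) (c : cseq n k).

Lemma in_CP c : in_C c <-> increasing k n.+1 (cval c).
Proof.
split; first by case/and3P => /eqP ? /eqP ? /forallP h; split=> // j hj;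
  apply: (h (Ordinal hj)).
by case=> a b h; apply/and3P; split; [exact/eqP|exact/eqP|apply/forallP => j; exact: h].
Qed.

Lemma cleP c c' : cle c c' <-> forall j, (j <= k)%N -> (cval c j <= cval c' j)%N.
Proof.
split; first by move/forallP => h j; rewrite -ltnS => hj; apply: (h (Ordinal hj)).
by move=> h; apply/forallP => j; apply: h; rewrite -ltnS.
Qed.

Lemma cseq_eq c c' : (forall j, (j <= k)%N -> cval c j = cval c' j) -> c = c'.
Proof.
move=> h; apply: eq_from_tnth => j; apply: val_inj.
by have := h j (ltac:(by rewrite -ltnS)); rewrite /cval -!tnth_nth.
Qed.

Lemma cseq_of_path g : increasing k n.+1 g ->
  exists c, in_C c /\ forall j, (j <= k)%N -> cval c j = g j.
Proof.
move=> pg; pose c : cseq n k := [tuple inord (g j) | j < k.+1].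
have gE j : (j <= k)%N -> cval c j = g j.
  rewrite -ltnS => hj; rewrite /cval (nth_mktuple _ _ (Ordinal hj)) inordK //=.
  by have := increasing_bounds pg hj; lia.
exists c; split=> //; apply/in_CP.
case: pg => [g0 g1 g2]; split; rewrite ?gE //.
by move=> j hj; rewrite !gE //; [exact: g2|lia].
Qed.

(** Summation by parts. *)
Lemma DelE x c : in_C c ->
  Del x c = psum x k n - psum x 1 1 + pcost k (gap x) (cval c).
Proof.
move/in_CP => [c0 ck c1]; rewrite /Del.
transitivity (\sum_(1 <= j < k.+1) (psum x j (cval c j).-1 - psum x j (cval c j.-1))).
  rewrite !big_nat; apply: eq_bigr => j hj.
  have := c1 j.-1 ltac:(lia); rewrite prednK => [lt|]; last by lia.
  rewrite /psum [in X in X - _](sum_nat_split (p := (cval c j.-1).+1)); last by lia.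
  by rewrite addrC addKr prednK //; lia.
rewrite sumrB big_nat_recr /=; last by lia.
rewrite [X in _ - X]big_ltn; last by lia.
rewrite [X in _ - (_ + X)]big_add1 /= ck c0 /= /pcost.
under [X in _ = _ + X]eq_bigr do rewrite /gap.
rewrite sumrB; set A := \sum_(_ <= i < _) psum x i _;
  set B := \sum_(_ <= i < _) psum x i.+1 _; lia.
Qed.

(** By modularity of the cost, meets and joins of minimizers are minimizers;
    hence a least and a greatest one exist. *)
Lemma minimizer_lattice x c c' : minimizer x c -> minimizer x c' ->
  exists d e, [/\ minimizer x d, minimizer x e,
    forall j, (j <= k)%N -> cval d j = minn (cval c j) (cval c' j)
    & forall j, (j <= k)%N -> cval e j = maxn (cval c j) (cval c' j)].
Proof.
move=> /andP[ic /forallP mc] /andP[ic' /forallP mc'].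
have [pc pc'] := conj (proj1 (in_CP c) ic) (proj1 (in_CP c') ic').
have [d [id dE]] := cseq_of_path (increasing_min pc pc').
have [e [ie eE]] := cseq_of_path (increasing_max pc pc').
have dW : pcost k (gap x) (cval d)
    = pcost k (gap x) (fun j => minn (cval c j) (cval c' j)).
  by apply: eq_pcost => j hj; apply: dE; lia.
have eW : pcost k (gap x) (cval e)
    = pcost k (gap x) (fun j => maxn (cval c j) (cval c' j)).
  by apply: eq_pcost => j hj; apply: eE; lia.
have md := pcost_modular k (gap x) (cval c) (cval c').
have /implyP/(_ ie) := mc e; have /implyP/(_ id) := mc d.
have /implyP/(_ ic) := mc' c; rewrite !DelE // dW eW => l1 l2 l3.
exists d, e; split=> //; apply/andP; split=> //; apply/forallP => g.
  by apply/implyP => ig; have /implyP/(_ ig) := mc g; rewrite !DelE // dW; lia.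
by apply/implyP => ig; have /implyP/(_ ig) := mc g; rewrite !DelE // eW; lia.
Qed.

Lemma minimizer_exists x : exists c, minimizer x c.
Proof.
have ib := in_C_cbot hk.
case: (@Order.TotalTheory.arg_minP _ _ _ (cbot n k) (@in_C n k) (Del x) ib) => c ic mc.
by exists c; rewrite /minimizer ic; apply/forallP => c'; apply/implyP => /mc.
Qed.

Lemma minimizer_least x :
  exists2 c, minimizer x c & forall c', minimizer x c' -> cle c c'.
Proof.
have [c0 m0] := minimizer_exists x.
case: (@arg_minnP _ c0 (minimizer x) (fun c => \sum_(j < k.+1) cval c j) m0)
  => c mc mincard.
exists c => // c' mc'; have [d [_ [md _ dE _]]] := minimizer_lattice mc mc'.
apply/forallP => j; have := mincard d md; apply: contraTT; rewrite -!ltnNge => lt.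
rewrite (bigD1 j) //= [X in (_ < X)%N](bigD1 j) //=.
rewrite -addSn; apply: leq_add; last first.
  by apply: leq_sum => i _; rewrite dE ?geq_minl // -ltnS.
by rewrite dE -1?ltnS //; lia.
Qed.

Lemma minimizer_greatest x :
  exists2 c, minimizer x c & forall c', minimizer x c' -> cle c' c.
Proof.
have [c0 m0] := minimizer_exists x.
have bd c : minimizer x c -> (\sum_(j < k.+1) cval c j <= \sum_(j < k.+1) n.+1)%N.
  move=> _; apply: leq_sum => j _; rewrite /cval -ltnS; exact: ltn_ord.
case: (@arg_maxnP _ c0 (minimizer x) (fun c => \sum_(j < k.+1) cval c j) m0)
  => c mc maxcard.
exists c => // c' mc'; have [_ [d [_ md _ dE]]] := minimizer_lattice mc mc'.
apply/forallP => j; have := maxcard d md; apply: contraTT; rewrite -!ltnNge => lt.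
rewrite (bigD1 j) //= [X in (_ < X)%N](bigD1 j) //=.
rewrite -addSn; apply: leq_add; last first.
  by apply: leq_sum => i _; rewrite dE ?leq_maxl // -ltnS.
by rewrite dE -1?ltnS //; lia.
Qed.

Lemma minimizer_cost x c : minimizer x c -> forall h, increasing k n.+1 h ->
  pcost k (gap x) (cval c) <= pcost k (gap x) h.
Proof.
move=> /andP[ic /forallP mc] h /cseq_of_path[d [id dE]].
have /implyP/(_ id) := mc d; rewrite !DelE //.
rewrite (@eq_pcost k _ (cval d) h); first by lia.
by move=> j hj; apply: dE; lia.
Qed.

Lemma minimizer_of_cost x c d : minimizer x c -> in_C d ->
  pcost k (gap x) (cval d) <= pcost k (gap x) (cval c) -> minimizer x d.
Proof.
move=> mc id le; apply/andP; split=> //; apply/forallP => f; apply/implyP => ff.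
have := minimizer_cost mc (proj1 (in_CP f) ff); rewrite !DelE //; lia.
Qed.

Lemma cmin_first x : first_min k n.+1 (gap x) (cval (cmin x)).
Proof.
have [c mc lc] := minimizer_least x.
have cE : minimizer x (cmin x) && [forall c', minimizer x c' ==> cle (cmin x) c'].
  rewrite /cmin; case: pickP => [//|/(_ c)]; rewrite mc /= => /negP; case.
  by apply/forallP => c'; apply/implyP => /lc.
have /andP[mm /forallP lm] := cE; have /andP[im _] := mm.
split; first exact/in_CP.
move=> h ph; split; first exact: minimizer_cost mm _ ph.
have [d [id dE]] := cseq_of_path ph => le j hj; rewrite -dE //.
have /cleP : cle (cmin x) d; last exact.
apply: (implyP (lm d)); apply: (minimizer_of_cost mm id).
by rewrite (@eq_pcost k _ (cval d) h) // => i hi; apply: dE; lia.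
Qed.

Lemma cmax_last x : last_min k n.+1 (gap x) (cval (cmax x)).
Proof.
have [c mc lc] := minimizer_greatest x.
have cE : minimizer x (cmax x) && [forall c', minimizer x c' ==> cle c' (cmax x)].
  rewrite /cmax; case: pickP => [//|/(_ c)]; rewrite mc /= => /negP; case.
  by apply/forallP => c'; apply/implyP => /lc.
have /andP[mm /forallP lm] := cE; have /andP[im _] := mm.
split; first exact/in_CP.
move=> h ph; split; first exact: minimizer_cost mm _ ph.
have [d [id dE]] := cseq_of_path ph => le j hj; rewrite -dE //.
have /cleP : cle d (cmax x); last exact.
apply: (implyP (lm d)); apply: (minimizer_of_cost mm id).
by rewrite (@eq_pcost k _ (cval d) h) // => i hi; apply: dE; lia.
Qed.

Lemma cmax_uniq x g : last_min k n.+1 (gap x) g ->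
  forall j, (j <= k)%N -> cval (cmax x) j = g j.
Proof. exact: last_min_uniq (cmax_last x). Qed.

Lemma cmin_uniq x g : first_min k n.+1 (gap x) g ->
  forall j, (j <= k)%N -> cval (cmin x) j = g j.
Proof. exact: first_min_uniq (cmin_first x). Qed.

Lemma ent_e0 x j i : (0 < j <= k)%N -> (0 < i <= n.+1)%N ->
  ent (e_0 x) j i = ent x j i - (i == cval (cmin x) j.-1)%:Z + (i == cval (cmin x) j)%:Z.
Proof.
move=> hj hi; apply: (ent_mx hj hi (F := fun j i =>
  ent x j i - (i == cval (cmin x) j.-1)%:Z + (i == cval (cmin x) j)%:Z)).
by move=> r s; rewrite mxE entS.
Qed.

Lemma ent_f0 x j i : (0 < j <= k)%N -> (0 < i <= n.+1)%N ->
  ent (f_0 x) j i = ent x j i - (i == cval (cmax x) j)%:Z + (i == cval (cmax x) j.-1)%:Z.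
Proof.
move=> hj hi; apply: (ent_mx hj hi (F := fun j i =>
  ent x j i - (i == cval (cmax x) j)%:Z + (i == cval (cmax x) j.-1)%:Z)).
by move=> r s; rewrite mxE entS.
Qed.

Lemma psum_e0 x j i : (0 < j <= k)%N -> (i <= n.+1)%N ->
  psum (e_0 x) j i
  = psum x j i - (cval (cmin x) j.-1 <= i < cval (cmin x) j)%N%:Z.
Proof.
move=> hj hi; have [pc _] := cmin_first x; have [_ _ c1] := pc.
have := c1 j.-1 ltac:(lia); rewrite prednK => [lt|]; last by lia.
have := increasing_bounds pc (j := j.-1) ltac:(lia).
have := increasing_bounds pc (j := j) ltac:(lia).
transitivity (psum x j i - \sum_(1 <= s < i.+1) (s == cval (cmin x) j.-1)%:Z
     + \sum_(1 <= s < i.+1) (s == cval (cmin x) j)%:Z).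
  rewrite /psum -sumrB -big_split /= !big_nat; apply: eq_bigr => s hs.
  by rewrite ent_e0 //; lia.
by rewrite !sum_nat_eqz; lia.
Qed.

Lemma gap_e0 x j i : (0 < j < k)%N -> (0 < i <= n.+1)%N ->
  gap (e_0 x) j i = gap x j i
     - (cval (cmin x) j.-1 < i < cval (cmin x) j)%N%:Z
     + (cval (cmin x) j < i < cval (cmin x) j.+1)%N%:Z.
Proof.
move=> hj hi; have [pc _] := cmin_first x; have [_ _ c1] := pc.
have := c1 j.-1 ltac:(lia); rewrite prednK => [lt|]; last by lia.
have := c1 j ltac:(lia).
by rewrite /gap !psum_e0 /=; try lia.
Qed.

(** In terms of gaps, [e_0] pushes the cost along its own path, so that the
    path becomes the greatest minimizer and [f_0] undoes the move. *)
Lemma cmax_e0 x : last_min k n.+1 (gap (e_0 x)) (cval (cmin x)) /\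
  pcost k (gap (e_0 x)) (cval (cmin x)) = pcost k (gap x) (cval (cmin x)).
Proof.
have fm := cmin_first x; have [pc _] := fm.
pose w' j i := gap x j i - (cval (cmin x) j.-1 < i < cval (cmin x) j)%N%:Z
     + (cval (cmin x) j < i < cval (cmin x) j.+1)%N%:Z.
have [e l] := first_min_push fm (w' := w') (fun j i _ => erefl).
have wE h : increasing k n.+1 h -> pcost k (gap (e_0 x)) h = pcost k w' h.
  move=> ph; apply: pcost_eqw => j hj; rewrite gap_e0 //.
  by have := @increasing_bounds _ _ _ j ph; lia.
split; last by rewrite wE.
case: l => _ l; split=> // h ph; rewrite !wE //; exact: l.
Qed.

Lemma f0_e0 x : f_0 (e_0 x) = x.
Proof.
have [l _] := cmax_e0 x; have cE := cmax_uniq l.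
apply: ent_inj => j i hj hi; rewrite ent_f0 // ent_e0 // !cE; lia.
Qed.

Definition mincost x : int := pcost k (gap x) (cval (cmin x)).

Lemma mincost_max x : mincost x = pcost k (gap x) (cval (cmax x)).
Proof.
have [p1 m1] := cmin_first x; have [p2 m2] := cmax_last x.
by have [a _] := m1 _ p2; have [b _] := m2 _ p1; rewrite /mincost; lia.
Qed.

Lemma mincost_e0 x : mincost (e_0 x) = mincost x.
Proof.
have [l e] := cmax_e0 x; rewrite mincost_max -[RHS]e.
by apply: eq_pcost => j hj; apply: cmax_uniq => //; lia.
Qed.

(** The half-turn of the rectangle exchanges [e_0] and [f_0]. *)
Definition rotate x : 'M[int]_(k, n.+1) :=
  \matrix_(r < k, s < n.+1) x (rev_ord r) (rev_ord s).

Lemma rotateK : involutive rotate.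
Proof. by move=> x; apply/matrixP => r s; rewrite !mxE !rev_ordK. Qed.

Lemma ent_rotate x j i : (0 < j <= k)%N -> (0 < i <= n.+1)%N ->
  ent (rotate x) j i = ent x (k.+1 - j) (n.+2 - i).
Proof.
move=> hj hi; apply: (ent_mx hj hi (F := fun j i => ent x (k.+1 - j) (n.+2 - i))).
move=> r s; rewrite mxE -entS /= -subSn ?ltn_ord //; congr (ent x _ _); rewrite subSS //.
by rewrite subSn // ltnS -ltnS.
Qed.

Lemma psum_rotate x j i : (0 < j <= k)%N -> (i <= n.+1)%N ->
  psum (rotate x) j i = psum x (k.+1 - j) n.+1 - psum x (k.+1 - j) (n.+1 - i).
Proof.
move=> hj; elim: i => [|i IH] hi; first by rewrite psum0 subn0 subrr.
rewrite psumS IH; last by lia.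
rewrite ent_rotate //; rewrite (psum_pred _ _ (i := (n.+1 - i)%N)); last by lia.
have -> : ((n.+1 - i).-1 = n.+1 - i.+1)%N by lia.
by rewrite !subSS; lia.
Qed.

End Zero.

Section Rotation.
Variables (n k : nat).
Hypothesis hk : (0 < k <= n)%N.
Implicit Types (x y : 'M[int]_(k, n.+1)).

Definition rowsums (l : int) x : Prop :=
  forall j, (0 < j <= k)%N -> psum x j n.+1 = l.

Lemma rowsums_e0 l x : rowsums l x -> rowsums l (e_0 x).
Proof.
move=> rx j hj; rewrite psum_e0 // rx //.
have [pc _] := cmin_first hk x; have := increasing_bounds pc (j := j) ltac:(lia); lia.
Qed.

Lemma rowsums_rotate l x : rowsums l x -> rowsums l (rotate x).
Proof. by move=> rx j hj; rewrite psum_rotate // rx ?subnn ?psum0 ?subr0 //; lia. Qed.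

Lemma gap_rotate l x j i : rowsums l x -> (0 < j < k)%N -> (0 < i <= n.+1)%N ->
  gap (rotate x) j i = cost_rev k n.+1 (gap x) j i.
Proof.
move=> rx hj hi; rewrite /cost_rev /gap !psum_rotate; try lia.
rewrite !rx; try lia.
have -> : (n.+1 - i.-1 = n.+2 - i)%N by lia.
have -> : ((n.+2 - i).-1 = n.+1 - i)%N by lia.
rewrite subSS (_ : (k.+1 - j)%N = (k - j).+1); last by lia.
by lia.
Qed.

Lemma last_min_rotate l x : rowsums l x ->
  last_min k n.+1 (gap (rotate x)) (path_rev k n.+1 (cval (cmin x))).
Proof.
move=> rx; have [pr lr] := first_min_rev (cmin_first hk x).
have wE h : increasing k n.+1 h ->
    pcost k (gap (rotate x)) h = pcost k (cost_rev k n.+1 (gap x)) h.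
  move=> ph; apply: pcost_eqw => j hj; apply: (gap_rotate rx) => //.
  by have := @increasing_bounds _ _ _ j ph; lia.
by split=> // h ph; rewrite !wE //; apply: lr.
Qed.

Lemma cmax_rotate l x j : rowsums l x -> (j <= k)%N ->
  cval (cmax (rotate x)) j = (n.+2 - cval (cmin x) (k - j))%N.
Proof. by move=> rx hj; rewrite (cmax_uniq hk (last_min_rotate rx)). Qed.

Lemma cmin_rotate l x j : rowsums l x -> (j <= k)%N ->
  cval (cmin (rotate x)) j = (n.+2 - cval (cmax x) (k - j))%N.
Proof.
move=> rx hj; have := cmax_rotate (rowsums_rotate rx) (leq_subr j k).
rewrite rotateK subKn // => ->.
have [pc _] := cmin_first hk (rotate x).
by have := increasing_bounds pc hj; lia.
Qed.

Lemma mincost_rotate l x : rowsums l x -> mincost (rotate x) = mincost x.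
Proof.
move=> rx; rewrite (mincost_max hk) /mincost.
have [pc _] := cmin_first hk x; rewrite -(pcost_rev _ pc).
transitivity (pcost k (gap (rotate x)) (path_rev k n.+1 (cval (cmin x)))).
  by apply: eq_pcost => j hj; rewrite (cmax_rotate rx) //; lia.
apply: pcost_eqw => j hj; apply: (gap_rotate rx) => //.
by have := increasing_bounds (increasing_rev pc) (j := j); lia.
Qed.

Lemma f0_rotate l x : rowsums l x -> f_0 (rotate x) = rotate (e_0 x).
Proof.
move=> rx; apply: ent_inj => j i hj hi.
rewrite ent_f0 // !ent_rotate // ent_e0; try lia.
rewrite !(cmax_rotate rx); try lia.
have -> : ((k.+1 - j).-1 = k - j)%N by lia.
have -> : (k - j.-1 = k.+1 - j)%N by lia.
have [pc _] := cmin_first hk x.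
have := @increasing_bounds _ _ _ (k - j) pc;
  have := @increasing_bounds _ _ _ (k.+1 - j) pc.
by lia.
Qed.

Lemma e0_rotate l x : rowsums l x -> e_0 (rotate x) = rotate (f_0 x).
Proof.
by move=> rx; rewrite -{2}(rotateK x) (f0_rotate (rowsums_rotate rx)) rotateK.
Qed.

Lemma e0_f0 l x : rowsums l x -> e_0 (f_0 x) = x.
Proof.
move=> rx; rewrite -{1}(rotateK x) (f0_rotate (rowsums_rotate rx)).
by rewrite (e0_rotate (rowsums_e0 (rowsums_rotate rx))) f0_e0 // rotateK.
Qed.

Lemma eps0E l x : rowsums l x -> eps_val l ord0 x = ent x 1 1 - mincost x.
Proof.
move=> rx; rewrite /eps_val eqxx DelE //; last exact: in_C_cmin.
have := rx k ltac:(lia); rewrite psumS /mincost => <-.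
by rewrite [psum x 1 1]psumS psum0; lia.
Qed.

Lemma phi0E l x : rowsums l x -> phi_val l ord0 x = ent x k n.+1 - mincost x.
Proof.
move=> rx; rewrite /phi_val eqxx DelE //; last exact: in_C_cmin.
have := rx k ltac:(lia); rewrite psumS /mincost => <-.
by rewrite [psum x 1 1]psumS psum0; lia.
Qed.

Lemma eps0_e0 l x : rowsums l x -> eps_val l ord0 (e_0 x) = eps_val l ord0 x - 1.
Proof.
move=> rx; rewrite !eps0E //; last exact: rowsums_e0.
rewrite mincost_e0 // ent_e0 //=; last by lia.
have [pc _] := cmin_first hk x; have [c0 _ _] := pc.
by rewrite c0; have := increasing_bounds pc (j := 1%N) ltac:(lia); lia.
Qed.

End Rotation.

(** * Encodings of tableaux *)

Section Encodings.
Variables (n k : nat).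
Hypothesis hk : (0 < k <= n)%N.
Implicit Types (x y : 'M[int]_(k, n.+1)).

(** The matrices that encode tableaux with rows of length [l]. *)
Definition tableau_like (l : int) x : Prop :=
  [/\ forall j i, 0 <= ent x j i,
      forall j i, (0 < j < k)%N -> (0 < i <= n.+1)%N -> 0 <= gap x j i
    & rowsums l x].

Lemma psum_mono l x j i i' : tableau_like l x -> (i <= i')%N ->
  psum x j i <= psum x j i'.
Proof.
move=> [nn _ _]; elim: i' => [|i' IH]; first by rewrite leqn0 => /eqP->.
rewrite leq_eqVlt => /orP[/eqP->//|]; rewrite ltnS => /IH; rewrite psumS.
by have := nn j i'.+1; lia.
Qed.

(** The gaps squeeze the partial sums: those of row [j] are at most 0 before
    letter [j], and equal to the full sum from letter [j + kp] on. *)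
Lemma tableau_like_supported l x : tableau_like l x -> supported x.
Proof.
move=> tx; have [nn gp rs] := tx.
have kkp : (k + kp n k = n.+1)%N by rewrite /kp; lia.
have lo j : (j < k)%N -> psum x j.+1 j <= 0.
  elim: j => [|j IH] hj; first by rewrite psum0.
  by have := gp j.+1 j.+1 ltac:(lia) ltac:(lia); rewrite /gap /=;
    have := IH ltac:(lia); lia.
have hi j : (j < k)%N -> l <= psum x (k - j) (k - j + kp n k).
  elim: j => [|j IH] hj; first by rewrite subn0 kkp rs; lia.
  have := IH ltac:(lia).
  have [m [e1 e2]] : exists m, (k - j = m.+1 /\ k - j.+1 = m)%N.
    by exists (k - j.+1)%N; lia.
  rewrite e1 e2; have := gp m (m.+1 + kp n k)%N ltac:(lia) ltac:(lia).
  by rewrite /gap addSn /=; lia.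
move=> j i hji; case: (boolP ((0 < j <= k) && (0 < i <= n.+1))%N) => [h|h];
  last exact: ent_out.
have := nn j i; case: (ltnP i j) => ij.
  have := psum_mono j tx (i := i) (i' := j.-1) ltac:(lia).
  have := lo j.-1 ltac:(lia); rewrite prednK; last by lia.
  have := psum_mono j tx (leq0n i.-1); rewrite psum0.
  by rewrite (psum_pred x j (i := i)); lia.
have := psum_mono j tx (i := i) (i' := n.+1) ltac:(lia).
have := psum_mono j tx (i := (j + kp n k)%N) (i' := i.-1) ltac:(lia).
have := hi (k - j)%N ltac:(lia); rewrite subKn; last by lia.
by rewrite (psum_pred x j (i := i)) ?rs; lia.
Qed.

Lemma pcost_update w c j i : (0 < j < k)%N ->
  pcost k w (fun s => if s == j then i else c s) = pcost k w c - w j (c j) + w j i.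
Proof.
move=> hj; rewrite /pcost (bigD1_seq j) ?mem_index_iota ?iota_uniq //= eqxx.
rewrite [in RHS](bigD1_seq j) ?mem_index_iota ?iota_uniq //=.
rewrite (eq_bigr (fun s => w s (c s))); last by move=> s /negbTE->.
set A := \sum_(_ <- _ | _) _; lia.
Qed.

(** Moving the single point [c_j] down to [i] keeps the path increasing. *)
Lemma first_min_gap w c j i : first_min k n.+1 w c -> (0 < j < k)%N ->
  (c j.-1 < i < c j)%N -> w j (c j) < w j i.
Proof.
move=> [pc mc] hj hi; have [c0 ck c1] := pc.
pose h s := if s == j then i else c s.
have ph : increasing k n.+1 h.
  split; rewrite /h; [by rewrite ifF //; lia|by rewrite ifF //; lia|].
  move=> s hs; case: eqVneq => [->|n1]; case: eqVneq => [e|n2]; try lia.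
  - by have := c1 j; lia.
  - by move: hi; rewrite -e /=; lia.
  - exact: c1.
have [m1 m2] := mc _ ph; move: m1 m2; rewrite pcost_update // => m1 m2.
case: ltP => // le; have := m2 ltac:(lia) j ltac:(lia).
by rewrite /h eqxx; lia.
Qed.

Lemma diag_cost x m : (0 < m)%N ->
  \sum_(1 <= s < m) gap x s s.+1 = psum x 1 1 - psum x m m.
Proof.
case: m => // m _; elim: m => [|m IH]; first by rewrite big_geq // subrr.
by rewrite big_nat_recr //= IH /gap /=; lia.
Qed.

(** The entry decreased by [e_0] in row [j] is positive: otherwise the run of
    consecutive values of the minimizer ending at [c_(j-1)] could be lowered
    by one, or, when that run starts at [c_0], its cost would be too large. *)
Lemma e0_entry_pos l x j : tableau_like l x -> 0 < eps_val l ord0 x ->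
  (0 < j <= k)%N -> 0 < ent x j (cval (cmin x) j.-1).
Proof.
move=> tx; have [nn gp rs] := tx; rewrite eps0E // => e0 hj.
have fm := cmin_first hk x; have [pc mc] := fm; have [c0 ck c1] := pc.
move: e0; rewrite /mincost; set c := cval (cmin x) in fm pc mc c0 ck c1 *.
move=> e0.
have ex : exists r, ((r <= j.-1) && (c r + (j.-1 - r) == c j.-1))%N.
  by exists j.-1; rewrite leqnn subnn addn0 eqxx.
case: (ex_minnP ex) => r /andP[rj /eqP cr] rmin {ex}.
have run s : (r <= s <= j.-1)%N -> (c s = c r + (s - r))%N.
  move=> hs; have := increasing_homo pc (i := r) (j := s) ltac:(lia).
  by have := increasing_homo pc (i := s) (j := j.-1) ltac:(lia); lia.
(* The run starts at c_0, and the gaps along 2, 3, ..., j telescope to the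
   difference of the first and the j-th entry of the main diagonal. *)
case: (posnP r) => [r0|r0].
  have cs s : (0 < s < j)%N -> c s = s.+1.
    by move=> hs; rewrite run r0 ?c0; lia.
  have : psum x 1 1 - psum x j j <= pcost k (gap x) c.
    rewrite -diag_cost; last by lia.
    rewrite /pcost (sum_nat_split (p := j) (q := k)); last by lia.
    rewrite (eq_big_nat _ _ (F2 := fun s => gap x s (c s))); last first.
      by move=> s hs; rewrite cs.
    rewrite lerDl big_nat sumr_ge0 // => s hs; apply: gp; first by lia.
    by have := increasing_bounds pc (j := s) ltac:(lia); lia.
  have -> : c j.-1 = j by rewrite run r0 ?c0; lia.
  rewrite (psum_pred x j (i := j)); last by lia.
  rewrite (psum_low (tableau_like_supported tx) (j := j) (i := j.-1)); last by lia.
  by rewrite psumS psum0; lia.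
have cr1 : (c r.-1 < (c r).-1)%N.
  have := c1 r.-1 ltac:(lia); rewrite prednK // => lt.
  case: (eqVneq (c r.-1) (c r).-1) => [e|]; last by lia.
  by have := rmin r.-1; have -> : (j.-1 - r.-1 = (j.-1 - r).+1)%N by [lia]; lia.
(* Lowering the whole run by one gives an increasing path again. *)
pose h s := if (r <= s < j)%N then (c s).-1 else c s.
have ph : increasing k n.+1 h.
  split; rewrite /h.
  - by rewrite leqn0 (gtn_eqF r0).
  - by rewrite ifF //; apply/negbTE/negP; lia.
  move=> s hs; have := c1 s hs.
  case: (boolP (r <= s < j)%N) => a1; case: (boolP (r <= s.+1 < j)%N) => a2; try lia.
  - by have := increasing_bounds pc (j := s) ltac:(lia); lia.
  - by move: cr1; have -> : r = s.+1 by lia.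
have tele m : (r <= m < j)%N ->
    \sum_(r <= s < m.+1) (gap x s (c s) - gap x s (c s).-1)
    = ent x r (c r).-1 - ent x m.+1 (c m).
  elim: m => [|m IH] hm; first by lia.
  have cpos : (1 < c m.+1)%N by have := increasing_bounds pc (j := m.+1) ltac:(lia); lia.
  have gS : gap x m.+1 (c m.+1) - gap x m.+1 (c m.+1).-1
            = ent x m.+1 (c m.+1).-1 - ent x m.+2 (c m.+1).
    rewrite -{1 4}(prednK (n := c m.+1)); last by lia.
    by rewrite gapS; lia.
  case: (eqVneq r m.+1) => [e|ne]; first by rewrite e big_nat1 gS.
  rewrite big_nat_recr /=; last by lia.
  rewrite IH; last by lia.
  have e1 := run m.+1 ltac:(lia); have e2 := run m ltac:(lia).
  by rewrite gS (_ : (c m.+1).-1 = c m); lia.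
have hcost : pcost k (gap x) c - pcost k (gap x) h
    = \sum_(r <= s < j) (gap x s (c s) - gap x s (c s).-1).
  rewrite /pcost -sumrB [LHS](sum_nat_split (p := r)); last by lia.
  rewrite [X in _ + X = _](sum_nat_split (p := j)); last by lia.
  rewrite [X in X + _ = _]big_nat big1 ?add0r; last first.
    by move=> s hs; rewrite /h (_ : (r <= s < j)%N = false) ?subrr //; apply/negP; lia.
  rewrite [X in _ + X = _]big_nat [X in _ + X = _]big1 ?addr0; last first.
    by move=> s hs; rewrite /h (_ : (r <= s < j)%N = false) ?subrr //; apply/negP; lia.
  by rewrite !big_nat; apply: eq_bigr => s hs; rewrite /h ifT.
have [m1 m2] := mc _ ph.
have hlt : pcost k (gap x) c < pcost k (gap x) h.
  case: ltP => // le; have := m2 le r ltac:(lia).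
  by rewrite /h ifT; have := increasing_bounds pc (j := r) ltac:(lia); lia.
have := tele j.-1 ltac:(lia); rewrite prednK; last by lia.
rewrite -hcost; have := nn r (c r).-1.
by set A := ent x r _; lia.
Qed.

Lemma tableau_like_e0 l x : tableau_like l x -> 0 < eps_val l ord0 x ->
  tableau_like l (e_0 x).
Proof.
move=> tx ep; have [nn gp rs] := tx; split; last exact: rowsums_e0.
  move=> j i; case: (boolP ((0 < j <= k) && (0 < i <= n.+1))%N) => [h|h];
    last by rewrite ent_out.
  have [hj hi] := andP h; rewrite ent_e0 //.
  have := e0_entry_pos tx ep hj; have := nn j i.
  by case: eqVneq => [<-|_]; lia.
move=> j i hj hi; rewrite gap_e0 //.
have := gp j i hj hi.
case: (boolP (cval (cmin x) j.-1 < i < cval (cmin x) j)%N) => [hh|_]; last by lia.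
have := first_min_gap (cmin_first hk x) hj hh.
have [pc _] := cmin_first hk x.
have := gp j (cval (cmin x) j) hj; have := increasing_bounds pc (j := j) ltac:(lia).
by lia.
Qed.

Lemma cbotE j : (j <= k)%N -> cval (cbot n k) j = if j == k then n.+1 else j.+1.
Proof.
rewrite -ltnS => hj; rewrite /cval /cbot (nth_mktuple _ _ (Ordinal hj)).
rewrite -val_eqE /=; case: eqP => [//|/eqP jk]; rewrite inordK //.
by lia.
Qed.

Lemma ctopE j : (j <= k)%N ->
  cval (ctop n k) j = if j == 0%N then 1%N else (kp n k + j)%N.
Proof.
rewrite -ltnS => hj; rewrite /cval /ctop (nth_mktuple _ _ (Ordinal hj)).
by rewrite -val_eqE /=; case: eqP => [//|/eqP jk]; rewrite inordK // /kp; lia.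
Qed.

Lemma cbot_cost x : pcost k (gap x) (cval (cbot n k)) = psum x 1 1 - psum x k k.
Proof.
rewrite -diag_cost; last by lia.
by rewrite /pcost !big_nat; apply: eq_bigr => j hj; rewrite cbotE ?ifF //; lia.
Qed.

(** The cost of [cbot] telescopes to the difference of the two end entries of
    the main diagonal. Both summands are nonnegative for a tableau, which is
    why the vanishing condition for [e_0] is that of [epsilon_0]. *)
Lemma eps0_cbot l x : supported x -> rowsums l x ->
  eps_val l ord0 x = ent x k k + (pcost k (gap x) (cval (cbot n k)) - mincost x).
Proof.
move=> sx rs; rewrite eps0E // cbot_cost psumS psum0 (psum_pred x k (i := k));
  last by lia.
by rewrite (psum_low sx (j := k)); lia.
Qed.

Lemma cbot_increasing : increasing k n.+1 (cval (cbot n k)).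
Proof. by apply/in_CP => //; apply: in_C_cbot. Qed.

Lemma ctop_increasing : increasing k n.+1 (cval (ctop n k)).
Proof. by apply/in_CP => //; apply: in_C_ctop. Qed.

Lemma eps0_nneg l x : tableau_like l x -> 0 <= eps_val l ord0 x.
Proof.
move=> tx; have [nn gp rs] := tx; rewrite eps0_cbot //;
  last exact: tableau_like_supported tx.
by have [_ /(_ _ cbot_increasing)[]] := cmin_first hk x; have := nn k k;
  rewrite /mincost; lia.
Qed.

Lemma e0_vanish l x : tableau_like l x ->
  ((cmin x == cbot n k) && (ent x k k == 0)) = ~~ (0 < eps_val l ord0 x).
Proof.
move=> tx; have [nn gp rs] := tx; rewrite eps0_cbot //;
  last exact: tableau_like_supported tx.
have [pc /(_ _ cbot_increasing)[m1 m2]] := cmin_first hk x.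
have := nn k k; rewrite -leNgt /mincost => x0.
apply/idP/idP => [/andP[/eqP-> /eqP->]|le]; first by lia.
rewrite (_ : ent x k k == 0); last by lia.
rewrite andbT; apply/eqP/cseq_eq => j hj.
have := m2 ltac:(lia) j hj; have := increasing_bounds pc hj; have [_ ck _] := pc.
by rewrite cbotE //; case: eqVneq => [->|_]; rewrite ?ck; lia.
Qed.

Lemma tableau_like_rotate l x : tableau_like l x -> tableau_like l (rotate x).
Proof.
move=> tx; have [nn gp rs] := tx; split; last exact: rowsums_rotate.
  move=> j i; case: (boolP ((0 < j <= k) && (0 < i <= n.+1))%N) => [h|h];
    last by rewrite ent_out.
  by have [hj hi] := andP h; rewrite ent_rotate.
by move=> j i hj hi; rewrite (gap_rotate hk rs) // gp; lia.
Qed.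

Lemma phi0_rotate l x : rowsums l x ->
  phi_val l ord0 x = eps_val l ord0 (rotate x).
Proof.
move=> rs; rewrite phi0E // eps0E //; last exact: rowsums_rotate.
rewrite (mincost_rotate hk rs) ent_rotate //; last by lia.
by rewrite !subSS !subn0.
Qed.

Lemma tableau_like_f0 l x : tableau_like l x -> 0 < phi_val l ord0 x ->
  tableau_like l (f_0 x).
Proof.
move=> tx; have [_ _ rs] := tx; rewrite phi0_rotate // => e0.
rewrite -(rotateK x) (f0_rotate hk (rowsums_rotate hk rs)).
by apply: tableau_like_rotate; apply: tableau_like_e0 => //; apply: tableau_like_rotate.
Qed.

Lemma phi0_nneg l x : tableau_like l x -> 0 <= phi_val l ord0 x.
Proof.
move=> tx; have [_ _ rs] := tx; rewrite phi0_rotate //.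
by apply: eps0_nneg; apply: tableau_like_rotate.
Qed.

Lemma f0_vanish l x : tableau_like l x ->
  ((cmax x == ctop n k) && (ent x 1 (kp n k).+1 == 0)) = ~~ (0 < phi_val l ord0 x).
Proof.
move=> tx; have [_ _ rs] := tx; rewrite phi0_rotate // -e0_vanish;
  last exact: tableau_like_rotate.
rewrite ent_rotate //; try lia.
have -> : (k.+1 - k = 1)%N by lia.
have -> : (n.+2 - k = (kp n k).+1)%N by rewrite /kp; lia.
congr (_ && _); apply/eqP/eqP => e; apply: cseq_eq => j hj.
  by rewrite (cmin_rotate hk rs hj) e ctopE ?leq_subr // cbotE // /kp; case: ifP;
    case: ifP; lia.
have := cmin_rotate hk rs (leq_subr j k); rewrite subKn // e cbotE ?leq_subr // ctopE //.
have [pc _] := cmax_last hk x; have := increasing_bounds pc hj.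
by rewrite /kp; case: ifP; case: ifP; lia.
Qed.

End Encodings.

(** * The operators of nonzero index *)

Section Classical.
Variables (n k a : nat).
Hypothesis hk : (0 < k <= n)%N.
Hypothesis ha : (0 < a <= n)%N.
Implicit Types (x y : 'M[int]_(k, n.+1)).

Local Notation lo := (bet n k a).
Local Notation hi := (gam k a).

Lemma lo_lt_hi : (lo < hi)%N.
Proof. by rewrite /bet /gam /kp; lia. Qed.

(** [rise x c] is, up to a constant, the opposite of [Gam x c]; it starts one
    term earlier, so that its maximum is [eps_cl]. *)
Definition rise x (c : nat) : int :=
  \sum_(lo <= j < c) (ent x j.+1 a.+1 - ent x j a).

Lemma riseS x c : (lo <= c)%N -> rise x c.+1 = rise x c + ent x c.+1 a.+1 - ent x c a.
Proof. by move=> h; rewrite /rise big_nat_recr //= addrA. Qed.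

Lemma rise_lo x : rise x lo = 0.
Proof. by rewrite /rise big_geq. Qed.

Lemma rise_Gam x c : (lo < c)%N ->
  rise x c = ent x lo.+1 a.+1 - ent x lo a - Gam a x c.
Proof.
move=> h; rewrite /rise big_ltn // /Gam.
rewrite (eq_bigr (fun j => - (ent x j a - ent x j.+1 a.+1))); last by move=> j _; lia.
by rewrite sumrN.
Qed.

Definition first_top x c : Prop := (lo < c <= hi)%N /\
  forall c', (lo < c' <= hi)%N -> rise x c' <= rise x c /\
    ((c' < c)%N -> rise x c' < rise x c).

Definition last_top x c : Prop := (lo < c <= hi)%N /\
  forall c', (lo < c' <= hi)%N -> rise x c' <= rise x c /\
    ((c < c')%N -> rise x c' < rise x c).

Lemma argminGP x c :
  c \in argminG a x <-> (lo < c <= hi)%N /\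
    forall c', (lo < c' <= hi)%N -> rise x c' <= rise x c.
Proof.
rewrite mem_filter mem_index_iota ltnS; split.
  move=> /andP[/allP h hc]; split=> // c' hc'.
  have := h c'; rewrite mem_index_iota ltnS => /(_ hc').
  by rewrite !rise_Gam; lia.
case=> hc h; rewrite hc andbT; apply/allP => c'; rewrite mem_index_iota ltnS => hc'.
by have := h c' hc'; rewrite !rise_Gam; lia.
Qed.

Lemma argminG_nonempty x : exists c, c \in argminG a x.
Proof.
suff: forall m, (lo + m < hi)%N -> exists c, (lo < c <= lo + m.+1)%N /\
    forall c', (lo < c' <= lo + m.+1)%N -> rise x c' <= rise x c.
  case/(_ (hi - lo).-1); first by have := lo_lt_hi; lia.
  move=> c [hc h]; exists c; apply/argminGP; split; first by have := lo_lt_hi; lia.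
  by move=> c' hc'; apply: h; have := lo_lt_hi; lia.
elim=> [|m IH] hm.
  by exists lo.+1; split=> [|c' hc']; [lia|rewrite (_ : c' = lo.+1) //; lia].
have [c [hc h]] := IH ltac:(lia).
case: (lerP (rise x (lo + m.+2)) (rise x c)) => le.
  exists c; split=> [|c' hc']; first by lia.
  by case: (eqVneq c' (lo + m.+2)%N) => [->//|ne]; apply: h; lia.
exists (lo + m.+2)%N; split=> [|c' hc']; first by lia.
case: (eqVneq c' (lo + m.+2)%N) => [->//|ne].
by have := h c' ltac:(lia); lia.
Qed.

Lemma argminG_sorted x : sorted ltn (argminG a x).
Proof. by apply: sorted_filter; [exact: ltn_trans|exact: iota_ltn_sorted]. Qed.

Lemma clo_top x : first_top x (clo a x).
Proof.
have [c0 m0] := argminG_nonempty x; have srt := argminG_sorted x.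
have mc : clo a x \in argminG a x.
  by rewrite /clo; case: (argminG a x) m0 => // c s _; rewrite mem_head.
have low c : c \in argminG a x -> (clo a x <= c)%N.
  move: srt; rewrite /clo; case: (argminG a x) => //= c1 s srt.
  rewrite inE => /orP[/eqP->//|cs]; apply: ltnW.
  by have /allP := order_path_min ltn_trans srt; apply.
have /argminGP[hc h] := mc; split=> // c' hc'; split; first exact: h.
move=> lt; have := h c' hc'; rewrite le_eqVlt => /orP[/eqP e|//].
have := low c'; have -> : c' \in argminG a x.
  by apply/argminGP; rewrite e.
by move=> /(_ isT); lia.
Qed.

Lemma chi_top x : last_top x (chi a x).
Proof.
have [c0 m0] := argminG_nonempty x; have srt := argminG_sorted x.
have mc : chi a x \in argminG a x.
  by rewrite /chi; case: (argminG a x) m0 => // c s _; apply: mem_last.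
have high c : c \in argminG a x -> (c <= chi a x)%N.
  move: srt; rewrite /chi; case/lastP: (argminG a x) => // s c1 srt.
  rewrite last_rcons mem_rcons inE => /orP[/eqP->//|cs]; apply: ltnW.
  move: srt; rewrite -(rev_sorted) rev_rcons /= => srt.
  have /allP := order_path_min (rev_trans ltn_trans) srt.
  by apply; rewrite mem_rev.
have /argminGP[hc h] := mc; split=> // c' hc'; split; first exact: h.
move=> lt; have := h c' hc'; rewrite le_eqVlt => /orP[/eqP e|//].
have := high c'; have -> : c' \in argminG a x.
  by apply/argminGP; rewrite e.
by move=> /(_ isT); lia.
Qed.

Lemma clo_uniq x c : first_top x c -> clo a x = c.
Proof.
move=> [hc h]; have [hd h'] := clo_top x.
have [a1 a2] := h _ hd; have [b1 b2] := h' _ hc.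
by case: (ltngtP (clo a x) c) => // lt; [have := a2 lt|have := b2 lt]; lia.
Qed.

Lemma chi_uniq x c : last_top x c -> chi a x = c.
Proof.
move=> [hc h]; have [hd h'] := chi_top x.
have [a1 a2] := h _ hd; have [b1 b2] := h' _ hc.
by case: (ltngtP (chi a x) c) => // lt; [have := b2 lt|have := a2 lt]; lia.
Qed.

Lemma eps_clE x : eps_cl a x = rise x (clo a x).
Proof. by []. Qed.

Lemma rise_clo_chi x : rise x (clo a x) = rise x (chi a x).
Proof.
have [hc h] := clo_top x; have [hd h'] := chi_top x.
by have [] := h _ hd; have [] := h' _ hc; lia.
Qed.

Lemma phi_clE x : phi_cl a x = eps_cl a x - rise x hi.+1.
Proof.
have [hd _] := chi_top x; rewrite eps_clE rise_clo_chi /rise.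
rewrite [X in _ = _ - X](sum_nat_split (p := chi a x)); last by lia.
rewrite /phi_cl (eq_bigr (fun j => - (ent x j.+1 a.+1 - ent x j a)));
  last by move=> j _; lia.
by rewrite sumrN opprD addrA subrr add0r.
Qed.

Lemma ent_e_cl x j i : (0 < j)%N -> (0 < i)%N ->
  ent (e_cl a x) j i = ent x j i + ((j == clo a x) && (i == a))%:Z
     - ((j == clo a x) && (i == a.+1))%:Z.
Proof.
move=> hj hi'; case: (boolP ((j <= k) && (i <= n.+1))%N) => [/andP[h1 h2]|h].
  apply: (ent_mx (F := fun j i => ent x j i + ((j == clo a x) && (i == a))%:Z
     - ((j == clo a x) && (i == a.+1))%:Z)); rewrite ?hj ?hi' //.
  by move=> r s; rewrite mxE entS.
rewrite !ent_out; try lia; have [] := clo_top x; rewrite /gam; lia.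
Qed.

Lemma ent_f_cl x j i : (0 < j)%N -> (0 < i)%N ->
  ent (f_cl a x) j i = ent x j i - ((j == chi a x) && (i == a))%:Z
     + ((j == chi a x) && (i == a.+1))%:Z.
Proof.
move=> hj hi'; case: (boolP ((j <= k) && (i <= n.+1))%N) => [/andP[h1 h2]|h].
  apply: (ent_mx (F := fun j i => ent x j i - ((j == chi a x) && (i == a))%:Z
     + ((j == chi a x) && (i == a.+1))%:Z)); rewrite ?hj ?hi' //.
  by move=> r s; rewrite mxE entS.
rewrite !ent_out; try lia; have [] := chi_top x; rewrite /gam; lia.
Qed.

Lemma ent_row0 x i : ent x 0 i = 0.
Proof. by rewrite ent_out. Qed.

Lemma rise_e_cl x c : (lo <= c)%N ->
  rise (e_cl a x) c = rise x c - (clo a x <= c)%N%:Z - (clo a x < c)%N%:Z.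
Proof.
have [hc _] := clo_top x; elim: c => [|c IH] hl.
  have e : lo = 0%N by lia.
  by rewrite /rise e !big_geq //; lia.
case: (eqVneq lo c.+1) => [e|ne]; first by rewrite -{1 2}e !rise_lo; lia.
rewrite !riseS; try lia; rewrite IH; last by lia.
rewrite ent_e_cl //; case: (posnP c) => [->|c0]; last by rewrite ent_e_cl; lia.
by rewrite !ent_row0; lia.
Qed.

Lemma rise_f_cl x c : (lo <= c)%N ->
  rise (f_cl a x) c = rise x c + (chi a x <= c)%N%:Z + (chi a x < c)%N%:Z.
Proof.
have [hc _] := chi_top x; elim: c => [|c IH] hl.
  have e : lo = 0%N by lia.
  by rewrite /rise e !big_geq //; lia.
case: (eqVneq lo c.+1) => [e|ne]; first by rewrite -{1 2}e !rise_lo; lia.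
rewrite !riseS; try lia; rewrite IH; last by lia.
rewrite ent_f_cl //; case: (posnP c) => [->|c0]; last by rewrite ent_f_cl; lia.
by rewrite !ent_row0; lia.
Qed.

(** Lowering [rise] by one at its first maximum and by two afterwards makes
    that point the last maximum. *)
Lemma chi_e_cl x : chi a (e_cl a x) = clo a x.
Proof.
have [hc h] := clo_top x; apply: chi_uniq; split=> // c' hc'.
rewrite !rise_e_cl; try lia; have [h1 h2] := h c' hc'.
by split=> [|lt]; [case: (ltnP c' (clo a x)) => [/h2|]|]; lia.
Qed.

Lemma clo_f_cl x : clo a (f_cl a x) = chi a x.
Proof.
have [hc h] := chi_top x; apply: clo_uniq; split=> // c' hc'.
rewrite !rise_f_cl; try lia; have [h1 h2] := h c' hc'.
by split=> [|lt]; [case: (ltnP (chi a x) c') => [/h2|]|]; lia.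
Qed.

Lemma f_cl_e_cl x : f_cl a (e_cl a x) = x.
Proof.
apply: ent_inj => j i hj hi'; rewrite ent_f_cl; try lia.
by rewrite ent_e_cl; try lia; rewrite chi_e_cl; lia.
Qed.

Lemma e_cl_f_cl x : e_cl a (f_cl a x) = x.
Proof.
apply: ent_inj => j i hj hi'; rewrite ent_e_cl; try lia.
by rewrite ent_f_cl; try lia; rewrite clo_f_cl; lia.
Qed.

Lemma eps_cl_e_cl x : eps_cl a (e_cl a x) = eps_cl a x - 1.
Proof.
have [hc _] := clo_top x; rewrite eps_clE rise_clo_chi chi_e_cl rise_e_cl; last by lia.
by rewrite -eps_clE; lia.
Qed.

(** The sum of all the terms of [rise], from [bet] to [gam], counts the whole
    columns [a] and [a + 1]. *)
Lemma wt_cl x : supported x -> phi_cl a x - eps_cl a x = colsum x a - colsum x a.+1.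
Proof.
move=> sx; rewrite phi_clE /rise sumrB.
have hlh := lo_lt_hi.
have -> : colsum x a = \sum_(lo <= j < hi.+1) ent x j a.
  transitivity (\sum_(0 <= j < k.+1) ent x j a).
    by rewrite big_ltn // ent_row0 add0r.
  apply: sum_trim => [||j hj|j hj]; first [by lia|by rewrite /gam; lia|idtac].
    by apply: sx; apply/negP; move: hj; rewrite /bet; lia.
  by apply: sx; apply/negP; move: hj; rewrite /gam; lia.
have -> : colsum x a.+1 = \sum_(lo <= j < hi.+1) ent x j.+1 a.+1.
  transitivity (\sum_(0 <= j < k.+1) ent x j.+1 a.+1).
    rewrite big_nat_recr //= (ent_out x (j := k.+1)) ?ltnn ?andbF // addr0.
    by rewrite /colsum big_add1.
  apply: sum_trim => [||j hj|j hj]; first [by lia|by rewrite /gam; lia|idtac].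
    by apply: sx; apply/negP; move: hj; rewrite /bet; lia.
  by apply: sx; apply/negP; move: hj; rewrite /gam; lia.
set A := \sum_(_ <= _ < _) _; set B := \sum_(_ <= _ < _) _; lia.
Qed.

Section Tableau.
Variables (l : int) (x : 'M[int]_(k, n.+1)).
Hypothesis tx : tableau_like l x.

Lemma eps_cl_ge : rise x lo.+1 <= eps_cl a x.
Proof.
have hl := lo_lt_hi; have [_ h] := clo_top x; rewrite eps_clE.
by have [] := h lo.+1 ltac:(lia).
Qed.

Lemma eps_cl_nneg : 0 <= eps_cl a x.
Proof.
have [nn gp rs] := tx; have sx := tableau_like_supported hk tx.
apply: le_trans eps_cl_ge; rewrite riseS // rise_lo add0r.
case: (posnP lo) => [->|l0]; first by rewrite ent_row0 subr0.
have e : (lo + kp n k = a)%N by move: l0; rewrite /bet; lia.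
have lk : (lo < k)%N by move: e; rewrite /kp; lia.
have := gp lo a ltac:(lia) ltac:(lia); rewrite /gap.
have := psum_high sx (j := lo) (i := a) (i' := n.+1) ltac:(lia) ltac:(lia).
have := psum_high sx (j := lo.+1) (i := a.+1) (i' := n.+1) ltac:(lia) ltac:(lia).
rewrite !rs ?psumS; try lia; rewrite (psum_pred x lo (i := a)); last by lia.
by lia.
Qed.

Lemma phi_cl_nneg : 0 <= phi_cl a x.
Proof.
have [nn gp rs] := tx; have sx := tableau_like_supported hk tx.
have hlh := lo_lt_hi; rewrite phi_clE eps_clE.
have [_ h] := clo_top x; have [] := h hi; first by lia.
move=> le _; rewrite riseS; last by lia.
have : ent x hi.+1 a.+1 <= ent x hi a.
  case: (ltnP a k) => ak; last first.
    by rewrite (_ : hi = k) ?(ent_out x (j := k.+1)) ?ltnn ?andbF // /gam; lia.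
  have -> : hi = a by rewrite /gam; lia.
  have := gp a a.+1 ltac:(lia) ltac:(lia); rewrite /gap /= psumS.
  rewrite (psum_pred x a (i := a)); last by lia.
  by rewrite (psum_low sx (j := a)) ?(psum_low sx (j := a.+1)); lia.
by lia.
Qed.

(** Just before its first maximum [rise] increases, so the entry that [e_cl]
    lowers exceeds its upper left neighbour; this makes that entry positive,
    and also the only gap that [e_cl] lowers. The case of [f_cl] is dual. *)
Lemma tableau_like_e_cl : 0 < eps_cl a x -> tableau_like l (e_cl a x).
Proof.
have [nn gp rs] := tx; rewrite eps_clE => e0; have [hc h] := clo_top x.
set r := clo a x in e0 hc h.
have up : ent x r.-1 a < ent x r a.+1.
  have : rise x r.-1 < rise x r.
    case: (eqVneq r.-1 lo) => [->|ne]; first by rewrite rise_lo.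
    by have [_] := h r.-1 ltac:(lia); apply; lia.
  have e : (r = r.-1.+1)%N by lia.
  by rewrite {2}e riseS; [rewrite -e|]; lia.
have rk : (r <= k)%N by move: hc; rewrite /gam; lia.
have psumE j i : (0 < j)%N ->
    psum (e_cl a x) j i = psum x j i + ((j == r) && (i == a))%:Z.
  move=> j0; elim: i => [|i IH]; first by rewrite !psum0; lia.
  by rewrite !psumS IH ent_e_cl //; lia.
split.
- move=> j i; case: (boolP ((0 < j <= k) && (0 < i <= n.+1))%N) => hji;
  last by rewrite ent_out.
  rewrite ent_e_cl; try lia; rewrite -/r; have := nn j i; have := nn r.-1 a.
  case: (eqVneq j r) => [->|_]; last by lia.
  by case: (eqVneq i a.+1) => [->|_]; lia.
- move=> j i hj hi'; rewrite /gap !psumE; try lia.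
  have := gp j i hj hi'; rewrite /gap.
  case: (eqVneq j.+1 r) => [e|_]; last by lia.
  case: (eqVneq i a) => [->|_]; last by lia.
  have := gp j a.+1 hj ltac:(lia); rewrite gapS; last by lia.
  by move: up; rewrite -e /= /gap; lia.
- by move=> j hj; rewrite psumE ?rs; lia.
Qed.

Lemma tableau_like_f_cl : 0 < phi_cl a x -> tableau_like l (f_cl a x).
Proof.
have [nn gp rs] := tx; rewrite phi_clE eps_clE rise_clo_chi => e0;
  have [hc h] := chi_top x.
set r := chi a x in e0 hc h.
have up : ent x r.+1 a.+1 < ent x r a.
  have : rise x r.+1 < rise x r.
    case: (eqVneq r hi) => [e|ne]; first by move: e0; rewrite e; lia.
    by have [_] := h r.+1 ltac:(lia); apply; lia.
  by rewrite riseS; lia.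
have rk : (r <= k)%N by move: hc; rewrite /gam; lia.
have psumE j i : (0 < j)%N ->
    psum (f_cl a x) j i = psum x j i - ((j == r) && (i == a))%:Z.
  move=> j0; elim: i => [|i IH]; first by rewrite !psum0; lia.
  by rewrite !psumS IH ent_f_cl //; lia.
split.
- move=> j i; case: (boolP ((0 < j <= k) && (0 < i <= n.+1))%N) => hji;
  last by rewrite ent_out.
  rewrite ent_f_cl; try lia; rewrite -/r; have := nn j i; have := nn r.+1 a.+1.
  case: (eqVneq j r) => [->|_]; last by lia.
  by case: (eqVneq i a) => [->|_]; lia.
- move=> j i hj hi'; rewrite /gap !psumE; try lia.
  have := gp j i hj hi'; rewrite /gap.
  case: (eqVneq j r) => [e|_]; last by lia.
  case: (eqVneq i a.+1) => [->|ne]; last by lia.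
  have := gp j a hj ltac:(lia); have := gapS x j (a := a) ltac:(lia).
  by move: up; rewrite -e /= /gap succnK; lia.
- by move=> j hj; rewrite psumE ?rs; lia.
Qed.

End Tableau.
End Classical.

(** * The crystal axioms *)

Lemma LamE n (i j : 'I_n.+1) : Lam i 0 j = (j == i)%:Z.
Proof. by rewrite mxE eqxx /=; case: eqP. Qed.

Lemma alphaE n (i j : 'I_n.+1) :
  alpha i 0 j = (j == i)%:Z *+ 2 - (j == ordS i)%:Z - (j == ord_pred i)%:Z.
Proof. by rewrite /alpha mulr2n !mxE !eqxx /= -mulr2n; do 3!case: eqP. Qed.

Lemma ordS_val n (i : 'I_n.+1) : (ordS i : nat) = if (i == n :> nat) then 0%N else i.+1.
Proof.
case: i => i hi /=; case: eqP => [->|ne]; first by rewrite modnn.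
by rewrite modn_small //; lia.
Qed.

Lemma ord_pred_val n (i : 'I_n.+1) :
  (ord_pred i : nat) = if (i == 0 :> nat) then n else i.-1.
Proof.
case: i => i hi /=; case: eqP => [->|ne]; first by rewrite add0n /= modn_small.
by rewrite (_ : (i + n.+1).-1 = i.-1 + n.+1)%N ?modnDr ?modn_small //; lia.
Qed.

Lemma alpha_diag n (i : 'I_n.+1) : (0 < n)%N -> alpha i 0 i = 2%:Z.
Proof.
move=> n0; rewrite alphaE eqxx.
have -> : (i == ordS i) = false.
  by apply/eqP => /(congr1 (@nat_of_ord _)); rewrite ordS_val; case: eqP; lia.
have -> : (i == ord_pred i) = false.
  by apply/eqP => /(congr1 (@nat_of_ord _)); rewrite ord_pred_val; case: eqP; lia.
by [].
Qed.

Section Operators.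
Variables (n k : nat).
Hypothesis hk : (0 < k <= n)%N.
Implicit Types (x y : 'M[int]_(k, n.+1)).

Lemma index_cases (i : 'I_n.+1) :
  (i = ord0) \/ ((i == ord0) = false /\ (0 < i <= n)%N).
Proof.
case: (eqVneq i ord0) => [->|ne]; [by left|right; split; first by []].
have : (i : nat) != 0%N by apply: contra ne => /eqP e; apply/eqP/val_inj.
by have := ltn_ord i; lia.
Qed.

Lemma rowsums_e_cl l a x : (0 < a <= n)%N -> rowsums l x -> rowsums l (e_cl a x).
Proof.
move=> ha rx j hj.
transitivity (psum x j n.+1 + \sum_(1 <= s < n.+2) ((j == clo a x) && (s == a))%:Z
   - \sum_(1 <= s < n.+2) ((j == clo a x) && (s == a.+1))%:Z).
  rewrite /psum -big_split -sumrB /= !big_nat; apply: eq_bigr => s hs.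
  by rewrite ent_e_cl //; lia.
rewrite rx //; case: (j == _) => /=; last by rewrite !big1; lia.
by rewrite !sum_nat_eqz; lia.
Qed.

Lemma rowsums_e l i x : rowsums l x -> rowsums l (e_mx i x).
Proof.
rewrite /e_mx; case: (index_cases i) => [->|[-> hi]]; rewrite ?eqxx.
  exact: rowsums_e0.
exact: rowsums_e_cl.
Qed.

Lemma f_mx_e_mx i x : f_mx i (e_mx i x) = x.
Proof.
rewrite /e_mx /f_mx; case: (index_cases i) => [->|[-> hi]]; rewrite ?eqxx.
  exact: f0_e0.
exact: f_cl_e_cl.
Qed.

Lemma e_mx_f_mx l i x : rowsums l x -> e_mx i (f_mx i x) = x.
Proof.
rewrite /e_mx /f_mx; case: (index_cases i) => [->|[-> hi]] rx; rewrite ?eqxx.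
  exact: e0_f0 rx.
exact: e_cl_f_cl.
Qed.

Lemma eps_e_mx l i x : rowsums l x -> eps_val l i (e_mx i x) = eps_val l i x - 1.
Proof.
rewrite /e_mx; case: (index_cases i) => [->|[i0 hi]] rx; rewrite ?eqxx.
  exact: eps0_e0.
by rewrite /eps_val i0 eps_cl_e_cl.
Qed.

(** This makes the weight linear in the matrix, so that its change under an
    operator can be read off from the letters that move. *)
Lemma wt_valE l i x : supported x -> rowsums l x ->
  wt_val l x 0 i = colsum x (ord_pred i).+1 - colsum x i.+1.
Proof.
move=> sx rx; rewrite mxE ord_pred_val.
case: (index_cases i) => [->|[i0 hi]]; last first.
  rewrite /phi_val /eps_val i0 wt_cl //.
  by rewrite (_ : (i == 0 :> nat) = false) ?prednK //; lia.
rewrite phi0E // eps0E //= [colsum x 1](_ : _ = ent x 1 1); last first.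
  rewrite /colsum big_ltn; last by lia.
  by rewrite big_nat big1 ?addr0 // => j hj; apply: sx; apply/negP; lia.
rewrite [colsum x n.+1](_ : _ = ent x k n.+1); last first.
  rewrite /colsum big_nat_recr /=; last by lia.
  by rewrite big_nat big1 ?add0r // => j hj; apply: sx; apply/negP; rewrite /kp; lia.
by lia.
Qed.

Lemma colsum_e i x a : (0 < a <= n.+1)%N ->
  colsum (e_mx i x) a
  = colsum x a + (a == (ord_pred i).+1)%:Z - (a == i.+1)%:Z.
Proof.
move=> ha; rewrite ord_pred_val /e_mx.
case: (index_cases i) => [->|[-> hi]]; rewrite ?eqxx /=.
  have [[c0 ck c1] _] := cmin_first hk x.
  transitivity (colsum x a + \sum_(1 <= j < k.+1)
     ((a == cval (cmin x) j)%:Z - (a == cval (cmin x) j.-1)%:Z)).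
    rewrite /colsum -big_split /= !big_nat; apply: eq_bigr => j hj.
    by rewrite ent_e0 //; lia.
  rewrite big_add1 /= telescope_sumr // c0 ck; lia.
rewrite (_ : (i == 0 :> nat) = false) ?prednK; try lia.
transitivity (colsum x a + \sum_(1 <= j < k.+1) ((j == clo i x)%:Z * (a == i)%:Z)
   - \sum_(1 <= j < k.+1) ((j == clo i x)%:Z * (a == i.+1)%:Z)).
  rewrite /colsum -big_split -sumrB /= !big_nat; apply: eq_bigr => j hj.
  by rewrite ent_e_cl //; lia.
rewrite -!mulr_suml sum_nat_eqz; have [] := clo_top hk hi x.
by rewrite /gam; lia.
Qed.

Lemma wt_e_mx l i x : supported x -> supported (e_mx i x) -> rowsums l x ->
  wt_val l (e_mx i x) = wt_val l x + alpha i.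
Proof.
move=> sx sx' rx; apply/rowP => j; rewrite [in RHS]mxE alphaE.
rewrite !wt_valE //; last exact: rowsums_e.
rewrite (colsum_e _ _ (a := j.+1) (ltn_ord j)).
rewrite (colsum_e _ _ (a := (ord_pred j).+1) (ltn_ord (ord_pred j))).
rewrite !eqSS !val_eqE (inj_eq (@ord_pred_inj _)).
rewrite (can2_eq (@ord_predK _) (@ordSK _)).
by case: (j == i); case: (j == ordS i); case: (j == ord_pred i); lia.
Qed.

(** Both kinds of crystal are carried by matrices with constant row sums on
    which the operators are [e_mx] and [f_mx]. *)
Lemma is_crystal_of_matrices l (B : crystal n) (v : B -> 'M[int]_(k, n.+1)) :
  (forall b : B, wt b = wt_val l (v b)) ->
  (forall i (b : B), eps i b = Some (eps_val l i (v b))) ->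
  (forall i (b : B), phi i b = Some (phi_val l i (v b))) ->
  (forall b, supported (v b)) -> (forall b, rowsums l (v b)) ->
  (forall i (b b' : B), etil i b = Some b' -> v b' = e_mx i (v b)) ->
  (forall i (b b' : B), ftil i b = Some b' <-> etil i b' = Some b) ->
  is_crystal B.
Proof.
move=> wtE epsE phiE sv rv eE fe.
have phi_eps i (b : B) : phi_val l i (v b) = eps_val l i (v b) + wt b 0 i.
  by rewrite wtE mxE; lia.
have e_ax i (b b' : B) : etil i b = Some b' ->
   [/\ wt b' = wt b + alpha i, eps_val l i (v b') = eps_val l i (v b) - 1
     & phi_val l i (v b') = phi_val l i (v b) + 1].
  move=> /eE e; have w : wt b' = wt b + alpha i.
    by rewrite !wtE e wt_e_mx // -e.
  split=> //; first by rewrite e eps_e_mx.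
  have wi : (wt b + alpha i) 0 i = wt b 0 i + 2%:Z.
    by rewrite mxE alpha_diag //; lia.
  by rewrite !phi_eps w wi e eps_e_mx //; lia.
move=> i b; split.
- by rewrite phiE epsE /= phi_eps.
- by move=> b' /e_ax[w e p]; rewrite !epsE !phiE /= e p w.
- move=> b' /fe /e_ax[w e p]; rewrite !epsE !phiE /= e p w addrK; split=> //.
    by congr Some; lia.
  by congr Some; lia.
- by move=> b'; apply: fe.
- by rewrite phiE.
Qed.

End Operators.

Section Infinity.
Variables (n k : nat).
Hypothesis hk : (0 < k <= n)%N.
Implicit Types (x y : 'M[int]_(k, n.+1)).

Lemma psum_full x (r : 'I_k) : psum x r.+1 n.+1 = \sum_s x r s.
Proof. by rewrite psum_row //; apply: eq_bigr => s _; rewrite entS. Qed.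

Lemma in_BkinfP x : in_Bkinf x <-> supported x /\ rowsums 0 x.
Proof.
split.
  move=> /andP[/forallP h1 /forallP h2]; split.
    move=> j i hji; case: (boolP ((0 < j <= k) && (0 < i <= n.+1))%N) => h;
      last exact: ent_out.
    case: j i hji h => // j [|i] hji /andP[] //= hj hi.
    rewrite -[j.+1]/((Ordinal hj : nat).+1) -[i.+1]/((Ordinal hi : nat).+1) entS.
    have /forallP/(_ (Ordinal hi))/implyP := h1 (Ordinal hj).
    by move=> h; apply/eqP/h; move: hji; rewrite /= addSn !ltnS.
  case=> // j /= hj; rewrite -[j.+1]/((Ordinal hj : nat).+1) psum_full.
  exact/eqP/h2.
case=> sx rx; apply/andP; split; apply/forallP => r.
  apply/forallP => s; apply/implyP => hs; rewrite -entS; apply/eqP/sx.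
  by rewrite addSn !ltnS.
by rewrite -psum_full; apply/eqP/rx; rewrite /= ltn_ord.
Qed.

Lemma is_crystal_Bkinf : is_crystal (Bkinf n k).
Proof.
apply: (@is_crystal_of_matrices n k hk 0 (Bkinf n k) (@sval _ _)) => //.
- by move=> b; have [] := proj1 (in_BkinfP _) (valP b).
- by move=> b; have [] := proj1 (in_BkinfP _) (valP b).
- by move=> i b b' /=; case: insubP => // u _ uE [<-].
move=> i b b' /=.
have rs (c : Bkinf n k) : rowsums 0 (val c) by have [] := proj1 (in_BkinfP _) (valP c).
split; case: insubP => // u _ uE [<-]; rewrite uE.
  by rewrite (e_mx_f_mx hk _ (rs b)) valK.
by rewrite (f_mx_e_mx hk) valK.
Qed.

End Infinity.

(** * Tableaux and their encodings *)

Lemma card_ord_lt (l m : nat) : (m <= l)%N -> #|[pred c : 'I_l | (c < m)%N]| = m.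
Proof.
move=> ml; rewrite -sum1_card big_mkcond /=.
rewrite -(big_mkord xpredT (fun c => if (c < m)%N then 1 else 0)%N).
rewrite (big_cat_nat (n := m)) //= (eq_big_nat _ _ (F2 := fun=> 1%N)); last first.
  by move=> i /andP[_ ->].
rewrite sum_nat_const_nat subn0 muln1 big_nat big1 ?addn0 //.
by move=> i /andP[h _]; rewrite ltnNge h.
Qed.

(** A down-closed set of columns is determined by its cardinality. *)
Lemma initial_segment (l : nat) (A : pred 'I_l) (c : 'I_l) :
  (forall c' c'' : 'I_l, (c' <= c'')%N -> A c'' -> A c') -> A c = (c < #|A|)%N.
Proof.
move=> dA; apply/idP/idP => [Ac|].
  apply: (leq_trans (n := #|[pred c' : 'I_l | (c' < c.+1)%N]|)).
    by rewrite card_ord_lt.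
  by apply: subset_leq_card; apply/fintype.subsetP => c'; rewrite inE ltnS => /dA; apply.
apply: contraTT => nA; rewrite -leqNgt.
apply: (leq_trans (n := #|[pred c' : 'I_l | (c' < c)%N]|)); last first.
  by rewrite card_ord_lt // ltnW.
apply: subset_leq_card; apply/fintype.subsetP => c' Ac'; rewrite inE ltnNge.
by apply: contra nA => /dA; apply.
Qed.

Section Tableaux.
Variables (n k l : nat).
Hypothesis hk : (0 < k <= n)%N.
Implicit Types (b : tableau n k l) (x : 'M[int]_(k, n.+1)).

Lemma tableau_row b (r : 'I_k) (c c' : 'I_l) : (c <= c')%N -> (val b r c <= val b r c')%N.
Proof.
move=> h.
by have /andP[/forallP/(_ r)/forallP/(_ c)/forallP/(_ c')/implyP/(_ h)] := valP b.
Qed.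

Lemma tableau_col b (r r' : 'I_k) (c : 'I_l) : (r < r')%N -> (val b r c < val b r' c)%N.
Proof.
move=> h.
by have /andP[_ /forallP/(_ c)/forallP/(_ r)/forallP/(_ r')/implyP/(_ h)] := valP b.
Qed.

Lemma psum_enc b (r : 'I_k) (i : nat) : (i <= n.+1)%N ->
  psum (enc b) r.+1 i = #|[pred c : 'I_l | (val b r c < i)%N]|%:Z.
Proof.
elim: i => [|i IH] hi; first by rewrite psum0 eq_card0.
rewrite psumS IH; last by lia.
rewrite (entS _ _ (Ordinal hi)) mxE -PoszD; congr Posz.
have cE (P : pred 'I_l) : #|[pred c | P c]| = (\sum_(c < l) P c)%N.
  by rewrite -sum1_card big_mkcond; apply: eq_bigr => c _; rewrite inE; case: (P c).
rewrite !cE -big_split /=; apply: eq_bigr => c _.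
by rewrite -val_eqE /= ltnS; case: ltngtP.
Qed.

Lemma enc_tableau_like b : tableau_like l (enc b).
Proof.
split.
- by move=> j i; apply: sumr_ge0 => p _; rewrite mxE.
- case=> // j [|i] // hj hi; rewrite /gap.
  have hj1 : (j < k)%N by lia.
  have hj2 : (j.+1 < k)%N by lia.
  rewrite /= (psum_enc b (Ordinal hj1)); last by lia.
  rewrite (psum_enc b (Ordinal hj2)); last by lia.
  rewrite subr_ge0 lez_nat; apply: subset_leq_card; apply/fintype.subsetP => c.
  rewrite !inE => h; have := @tableau_col b (Ordinal hj1) (Ordinal hj2) c (leqnn _); lia.
case=> // j /= hj; rewrite (psum_enc b (Ordinal hj)) //.
congr Posz; rewrite -[RHS](card_ord l); apply: eq_card => c.
by rewrite !inE ltn_ord.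
Qed.

Lemma ent_of_psum x y : (forall (r : 'I_k) i, (i <= n.+1)%N ->
  psum x r.+1 i = psum y r.+1 i) ->
  x = y.
Proof.
move=> h; apply/matrixP => r s; rewrite -!entS.
have := h r s ltac:(by apply: ltnW; apply: ltn_ord); have := h r s.+1 (ltn_ord s).
by rewrite !psumS; lia.
Qed.

Lemma tableau_lt b (r : 'I_k) (c : 'I_l) i : (i <= n.+1)%N ->
  (val b r c < i)%N = (c%:Z < psum (enc b) r.+1 i).
Proof.
move=> hi; rewrite psum_enc // ltz_nat.
apply: (@initial_segment l (fun c : 'I_l => (val b r c < i)%N)) => c' c'' h.
by apply: leq_ltn_trans; apply: tableau_row.
Qed.

Lemma enc_inj : injective (@enc n k l).
Proof.
move=> b b' e; apply: val_inj; apply/matrixP => r c; apply: val_inj.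
have h i : (i <= n.+1)%N -> (val b r c < i)%N = (val b' r c < i)%N.
  by move=> hi; rewrite !tableau_lt // e.
have := h (val b r c).+1 (ltn_ord _); have := h (val b' r c).+1 (ltn_ord _).
by rewrite !ltnSn /=; lia.
Qed.

(** The letter in column [c] of a row is the first one at which the partial
    sums of the row exceed [c]. *)
Lemma tableau_like_enc x : tableau_like l x -> exists b, enc b = x.
Proof.
move=> tx; have [nn gp rs] := tx.
pose P (r : 'I_k) (c : 'I_l) (s : nat) := c%:Z < psum x r.+1 s.+1.
have exP r c : exists s : nat, P r c s.
  by exists n; rewrite /P rs; [have := ltn_ord c; lia|rewrite /= ltn_ord].
pose f r c := ex_minn (exP r c).
have fP (r : 'I_k) (c : 'I_l) i : (f r c < i)%N = (c%:Z < psum x r.+1 i).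
  rewrite /f; case: ex_minnP => s Ps mins; apply/idP/idP => [lt|].
    by apply: lt_le_trans Ps _; apply: (psum_mono hk _ tx).
  by case: i => [|i]; [rewrite psum0; lia|rewrite ltnS; apply: mins].
have fn r c : (f r c < n.+1)%N.
  by rewrite fP rs; [have := ltn_ord c; lia|rewrite /= ltn_ord].
pose t := \matrix_(r < k, c < l) Ordinal (fn r c).
have tE r c : t r c = f r c :> nat by rewrite mxE.
have step (r r' : 'I_k) c : r' = r.+1 :> nat -> (f r c < f r' c)%N.
  move=> e; rewrite fP; have : c%:Z < psum x r'.+1 (f r' c).+1 by rewrite -fP.
  have := gp r.+1 (f r' c).+1; rewrite /gap /= -e => /(_ _ _).
  have := ltn_ord r'; have := fn r' c; rewrite e => h1 h2.
  by move=> /(_ ltac:(lia) ltac:(lia)); lia.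
have ss : semistandard t.
  apply/andP; split.
    apply/forallP => r; apply/forallP => c; apply/forallP => c'; apply/implyP => hc.
    rewrite !tE -ltnS fP; apply: (@le_lt_trans _ _ c'%:Z); first by lia.
    by rewrite -fP.
  apply/forallP => c; apply/forallP => r; apply/forallP => r'; apply/implyP => hr.
  rewrite !tE; case: r' hr => r' hr'; elim: r' hr' => [|m IH] hm //=.
  rewrite ltnS leq_eqVlt => /orP[/eqP e|lt]; first by apply: step; rewrite /= e.
  apply: ltn_trans (IH (ltnW hm) lt) _; by apply: step.
exists (exist _ t ss); apply: ent_of_psum => r i hi; rewrite psum_enc //=.
have le_l : psum x r.+1 i <= l%:Z.
  by rewrite -(rs r.+1); [apply: (psum_mono hk _ tx)|rewrite /= ltn_ord].
have ge_0 : 0 <= psum x r.+1 i.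
  by rewrite -(psum0 x r.+1); apply: (psum_mono hk _ tx).
rewrite -[RHS]gez0_abs //; congr Posz.
rewrite -[RHS](card_ord_lt (l := l)); last by lia.
by apply: eq_card => c; rewrite !inE tE fP; lia.
Qed.

Lemma tableau_like_e i x : tableau_like l x -> 0 < eps_val l i x ->
  tableau_like l (e_mx i x).
Proof.
rewrite /e_mx; case: (index_cases hk i) => [->|[i0 hi]] tx; rewrite ?eqxx.
  exact: tableau_like_e0.
by rewrite /eps_val i0; apply: tableau_like_e_cl.
Qed.

Lemma tableau_like_f i x : tableau_like l x -> 0 < phi_val l i x ->
  tableau_like l (f_mx i x).
Proof.
rewrite /f_mx; case: (index_cases hk i) => [->|[i0 hi]] tx; rewrite ?eqxx.
  exact: tableau_like_f0.
by rewrite /phi_val i0; apply: tableau_like_f_cl.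
Qed.

Lemma eps_nneg i x : tableau_like l x -> 0 <= eps_val l i x.
Proof.
case: (index_cases hk i) => [->|[i0 hi]] tx; first exact: eps0_nneg.
by rewrite /eps_val i0; apply: eps_cl_nneg tx.
Qed.

Lemma phi_nneg i x : tableau_like l x -> 0 <= phi_val l i x.
Proof.
case: (index_cases hk i) => [->|[i0 hi]] tx; first exact: phi0_nneg.
by rewrite /phi_val i0; apply: phi_cl_nneg tx.
Qed.

Lemma e_vanishesE i b : e_vanishes i b = ~~ (0 < eps_val l i (enc b)).
Proof.
rewrite /e_vanishes; case: (index_cases hk i) => [->|[-> hi]] //; rewrite eqxx.
by apply: e0_vanish => //; apply: enc_tableau_like.
Qed.

Lemma f_vanishesE i b : f_vanishes i b = ~~ (0 < phi_val l i (enc b)).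
Proof.
rewrite /f_vanishes; case: (index_cases hk i) => [->|[-> hi]] //; rewrite eqxx.
by apply: f0_vanish => //; apply: enc_tableau_like.
Qed.

Lemma e_tabP i b b' :
  e_tab i b = Some b' <-> 0 < eps_val l i (enc b) /\ enc b' = e_mx i (enc b).
Proof.
rewrite /e_tab e_vanishesE; case: ifP => [/negbTE->|/negbFE e0]; first by split=> // -[].
case: pickP => [b1 /eqP e1|none]; split=> //.
- by case=> <-.
- by case=> _ e; congr Some; apply: enc_inj; rewrite e1 e.
- by case=> _ e; have := none b'; rewrite e eqxx.
Qed.

Lemma f_tabP i b b' :
  f_tab i b = Some b' <-> 0 < phi_val l i (enc b) /\ enc b' = f_mx i (enc b).
Proof.
rewrite /f_tab f_vanishesE; case: ifP => [/negbTE->|/negbFE e0]; first by split=> // -[].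
case: pickP => [b1 /eqP e1|none]; split=> //.
- by case=> <-.
- by case=> _ e; congr Some; apply: enc_inj; rewrite e1 e.
- by case=> _ e; have := none b'; rewrite e eqxx.
Qed.

Lemma e_tab_None i b : e_tab i b = None <-> eps_val l i (enc b) = 0.
Proof.
have tb := enc_tableau_like b; have e0 := eps_nneg i tb; split=> [|e].
  case: (ltrP 0 (eps_val l i (enc b))) => [e1|]; last by lia.
  have [b' e'] := tableau_like_enc (tableau_like_e tb e1).
  by rewrite (proj2 (e_tabP i b b')).
by case E: (e_tab i b) => [b'|//]; have [] := proj1 (e_tabP i b b') E; rewrite e ltxx.
Qed.

Lemma f_tab_None i b : f_tab i b = None <-> phi_val l i (enc b) = 0.
Proof.
have tb := enc_tableau_like b; have e0 := phi_nneg i tb; split=> [|e].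
  case: (ltrP 0 (phi_val l i (enc b))) => [e1|]; last by lia.
  have [b' e'] := tableau_like_enc (tableau_like_f tb e1).
  by rewrite (proj2 (f_tabP i b b')).
by case E: (f_tab i b) => [b'|//]; have [] := proj1 (f_tabP i b b') E; rewrite e ltxx.
Qed.

Lemma enc_supported b : supported (enc b).
Proof. exact (tableau_like_supported hk (enc_tableau_like b)). Qed.

Lemma enc_rowsums b : rowsums l (enc b).
Proof. by have [] := enc_tableau_like b. Qed.

Lemma phi_e_mx i x : supported x -> supported (e_mx i x) -> rowsums l x ->
  phi_val l i (e_mx i x) = phi_val l i x + 1.
Proof.
move=> sx sx' rx; have := wt_e_mx hk sx sx' rx => /rowP/(_ i).
have -> : (wt_val l x + alpha i) 0 i = wt_val l x 0 i + 2%:Z.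
  by rewrite mxE alpha_diag //; lia.
by rewrite !mxE eps_e_mx //; lia.
Qed.

Lemma is_crystal_Bkl : is_crystal (Bkl n k l).
Proof.
apply: (@is_crystal_of_matrices n k hk l (Bkl n k l) (@enc n k l)) => //.
- exact: enc_supported.
- exact: enc_rowsums.
- by move=> i b b' /e_tabP[].
have ef (x : 'M_(k, n.+1)) i := e_mx_f_mx hk i (x := x) (l := l).
move=> i b b'; split=> [/f_tabP[p e]|/e_tabP[p e]].
  apply/e_tabP; rewrite e ef //; last exact: enc_rowsums.
  split=> //; have := eps_e_mx hk i (l := l) (enc_rowsums b').
  rewrite e ef; last exact: enc_rowsums.
  by have := eps_nneg i (enc_tableau_like b); lia.
apply/f_tabP; rewrite e f_mx_e_mx //; split=> //.
rewrite phi_e_mx -?e; [|exact: enc_supported|exact: enc_supported|exact: enc_rowsums].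
by have := phi_nneg i (enc_tableau_like b'); lia.
Qed.

End Tableaux.

(** As [eps] and [phi] change by one along a string, it suffices that they are
    natural numbers and vanish exactly where the operators do. *)
Lemma string_crystal_of n (B : crystal n) : is_crystal B ->
  (forall i (b : B), exists2 p : nat, eps i b = Some p%:Z
     & (etil i b = None <-> p = 0%N)) ->
  (forall i (b : B), exists2 r : nat, phi i b = Some r%:Z
     & (ftil i b = None <-> r = 0%N)) ->
  string_crystal B.
Proof.
move=> cB hE hF i b.
have itE p : forall b : B, eps i b = Some p%:Z ->
    iter p (obind (etil i)) (Some b) <> None
    /\ iter p.+1 (obind (etil i)) (Some b) = None.
  elim: p => [|p IH] b0 e0.
    by split=> //=; have [p e1 e2] := hE i b0; apply/e2; move: e1; rewrite e0 => -[].
  have [p' e1 e2] := hE i b0; case E: (etil i b0) => [b1|]; last first.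
    by move: e1; rewrite e0 (proj1 e2 E).
  have [_ /(_ _ E)[_ e3 _] _ _ _] := cB i b0.
  by rewrite !(iterSr _ _ (Some b0)) /= E; apply: IH; rewrite e3 e0 /=; congr Some; lia.
have itF p : forall b : B, phi i b = Some p%:Z ->
    iter p (obind (ftil i)) (Some b) <> None
    /\ iter p.+1 (obind (ftil i)) (Some b) = None.
  elim: p => [|p IH] b0 e0.
    by split=> //=; have [p e1 e2] := hF i b0; apply/e2; move: e1; rewrite e0 => -[].
  have [p' e1 e2] := hF i b0; case E: (ftil i b0) => [b1|]; last first.
    by move: e1; rewrite e0 (proj1 e2 E).
  have [_ _ /(_ _ E)[_ _ e3] _ _] := cB i b0.
  by rewrite !(iterSr _ _ (Some b0)) /= E; apply: IH; rewrite e3 e0 /=; congr Some; lia.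
have [p ep _] := hE i b; have [r fr _] := hF i b.
by exists p, r; split; [|by []|exact: itE|exact: itF].
Qed.

Lemma string_crystal_Bkl n k l : (0 < k <= n)%N -> string_crystal (Bkl n k l).
Proof.
move=> hk; apply: string_crystal_of; first exact: is_crystal_Bkl.
  move=> i b; have := eps_nneg hk i (enc_tableau_like hk b) => /= p0.
  exists `|eps_val l i (enc b)|%N; first by congr Some; lia.
  by rewrite e_tab_None //=; split; lia.
move=> i b; have := phi_nneg hk i (enc_tableau_like hk b) => /= p0.
exists `|phi_val l i (enc b)|%N; first by congr Some; lia.
by rewrite f_tab_None //=; split; lia.
Qed.

(** * Minimal elements *)

Section Minimal.
Variables (n k : nat).
Hypothesis hk : (0 < k <= n)%N.
Implicit Types (x y : 'M[int]_(k, n.+1)).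

Local Notation kp := (kp n k).

Let kpE : (kp + k = n.+1)%N.
Proof. by rewrite /Defs.kp; lia. Qed.

Let kp_gt0 : (0 < kp)%N.
Proof. by rewrite /Defs.kp; lia. Qed.

(** Every diagonal [a - j] strictly between 0 and [kp] is constant. The
    encodings of the minimal tableaux are exactly the flat ones. *)
Definition flat x : Prop := forall j a, (0 < j < k)%N -> (j < a < j + kp)%N ->
  ent x j.+1 a.+1 = ent x j a.

Lemma sum_eps_val l x :
  \sum_i eps_val l i x = eps_val l ord0 x + \sum_(1 <= a < n.+1) eps_cl a x.
Proof. by rewrite big_ord_recl big_add1 big_mkord. Qed.

Lemma rise_first x a : (0 < a <= n)%N ->
  rise a x (bet n k a).+1 = ent x (bet n k a).+1 a.+1 - ent x (bet n k a) a.
Proof. by move=> ha; rewrite riseS // rise_lo add0r. Qed.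

Lemma gap_last l x j : supported x -> rowsums l x -> (0 < j < k)%N ->
  gap x j (j + kp) = ent x j.+1 (j + kp).+1 - ent x j (j + kp).
Proof.
move=> sx rx hj; rewrite /gap.
have := psum_high sx (j := j) (i := (j + kp)%N) (i' := n.+1) (leqnn _) ltac:(lia).
have := psum_high sx (j := j.+1) (i := (j + kp).+1) (i' := n.+1) (leqnn _) ltac:(lia).
rewrite !rx; try lia; rewrite psumS (psum_pred x j (i := (j + kp)%N)); last by lia.
by lia.
Qed.

Lemma gap_first x j : supported x -> gap x j j.+1 = ent x j j - ent x j.+1 j.+1.
Proof.
move=> sx; rewrite /gap /= psumS (psum_low sx (leqnn j.+1)).
case: j => [|j]; first by rewrite psum0 (ent_out x (j := 0)) //; lia.
by rewrite psumS (psum_low sx (leqnn j.+1)); lia.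
Qed.

(** The smallest admissible choice of the summation end in every [epsilon_a]
    produces the cost of [ctop]. *)
Lemma sum_rise_first l x : supported x -> rowsums l x ->
  \sum_(1 <= a < n.+1) rise a x (bet n k a).+1
  = l - ent x 1 1 + pcost k (gap x) (cval (ctop n k)).
Proof.
move=> sx rx; rewrite (sum_nat_split (p := kp.+1)); last by lia.
congr (_ + _).
  transitivity (\sum_(1 <= a < kp.+1) ent x 1 a.+1).
    rewrite !big_nat; apply: eq_bigr => a ha; rewrite rise_first; last by lia.
    by rewrite (_ : bet n k a = 0%N) ?ent_row0 ?subr0 // /bet; lia.
  rewrite -(rx 1%N); last by lia.
  rewrite -(psum_high sx (i := kp.+1)); try lia.
  by rewrite /psum [in RHS]big_ltn // [in RHS]big_add1 /= addrC addKr.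
rewrite /pcost -[kp.+1]add1n big_addn (_ : (n.+1 - kp)%N = k); last by lia.
rewrite !big_nat; apply: eq_bigr => j hj.
rewrite rise_first; last by lia.
have -> : bet n k (j + kp) = j by rewrite /bet addnK.
rewrite ctopE //; last by lia.
rewrite (_ : (j == 0)%N = false); last by lia.
by rewrite [(kp + j)%N]addnC (gap_last sx rx hj).
Qed.

(** Both kinds of defect are nonnegative: a path costs at least the minimum, and
    [epsilon_a] is the maximum of [rise]. *)
Lemma sum_eps_defect l x : supported x -> rowsums l x ->
  \sum_i eps_val l i x = l + (pcost k (gap x) (cval (ctop n k)) - mincost x)
    + \sum_(1 <= a < n.+1) (eps_cl a x - rise a x (bet n k a).+1).
Proof.
move=> sx rx; rewrite sum_eps_val sumrB (sum_rise_first sx rx) eps0E //.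
set S := \sum_(_ <= _ < _) _; lia.
Qed.

Lemma mincost_le x h : increasing k n.+1 h -> mincost x <= pcost k (gap x) h.
Proof. by move=> ph; have [_ /(_ _ ph)[]] := cmin_first hk x. Qed.

Lemma eps_cl_defect x a : (0 < a <= n)%N -> 0 <= eps_cl a x - rise a x (bet n k a).+1.
Proof. by move=> ha; have := eps_cl_ge hk ha x; lia. Qed.

Lemma sum_eps_ge l x : supported x -> rowsums l x -> l <= \sum_i eps_val l i x.
Proof.
move=> sx rx; rewrite (sum_eps_defect sx rx).
have := mincost_le x (ctop_increasing hk).
suff : 0 <= \sum_(1 <= a < n.+1) (eps_cl a x - rise a x (bet n k a).+1).
  by set S := \sum_(_ <= _ < _) _; lia.
by rewrite big_nat sumr_ge0 // => a ha; apply: eps_cl_defect; lia.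
Qed.

Lemma gap_const x j : (0 < j < k)%N ->
  (forall a, (j < a < j + kp)%N -> ent x j.+1 a.+1 = ent x j a) ->
  forall a, (j < a <= j + kp)%N -> gap x j a = gap x j j.+1.
Proof.
move=> hj d; elim=> [|a IH] ha; first by lia.
case: (eqVneq a j) => [->//|ne].
by rewrite gapS; [rewrite d; [rewrite IH|]|]; lia.
Qed.

Lemma gap_flat x j a : flat x -> (0 < j < k)%N -> (j < a <= j + kp)%N ->
  gap x j a = gap x j j.+1.
Proof. by move=> fx hj; apply: gap_const => // b hb; apply: fx. Qed.

Lemma rise_const x a j : (0 < a <= n)%N -> (bet n k a < j <= gam k a)%N ->
  (forall j', (bet n k a < j' < j)%N -> ent x j'.+1 a.+1 = ent x j' a) ->
  rise a x j = rise a x (bet n k a).+1.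
Proof.
move=> ha hj d; rewrite /rise (sum_nat_split (p := (bet n k a).+1)); last by lia.
by rewrite [X in _ + X]big_nat [X in _ + X]big1 ?addr0 // => i hi; rewrite d ?subrr.
Qed.

(** When all defects vanish, the rows agree away from the two extreme
    diagonals: by induction on the row, [rise] gives one inequality between
    neighbouring entries and the comparison of two paths gives the other. *)
Lemma flat_of_level l x : supported x -> rowsums l x ->
  \sum_i eps_val l i x = l -> flat x.
Proof.
move=> sx rx; rewrite (sum_eps_defect sx rx) => lE.
have D1 := mincost_le x (ctop_increasing hk).
have S0 : 0 <= \sum_(1 <= a < n.+1) (eps_cl a x - rise a x (bet n k a).+1).
  by rewrite big_nat sumr_ge0 // => a ha; apply: eps_cl_defect; lia.
have topmin : pcost k (gap x) (cval (ctop n k)) = mincost x.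
  by move: S0 lE; set S := \sum_(_ <= _ < _) _; lia.
have epsE a : (0 < a <= n)%N -> eps_cl a x = rise a x (bet n k a).+1.
  move=> ha; have := eps_cl_defect x ha;
    have : \sum_(1 <= a < n.+1) (eps_cl a x - rise a x (bet n k a).+1) = 0.
    by move: S0 lE; set S := \sum_(_ <= _ < _) _; lia.
  rewrite (bigD1_seq a) ?mem_index_iota ?iota_uniq //=.
  set T := \sum_(_ <- _ | _) _.
  have T0 : 0 <= T.
    rewrite /T big_seq_cond sumr_ge0 // => b /andP[]; rewrite mem_index_iota => hb _.
    by apply: eps_cl_defect; lia.
  by lia.
move: D1 S0 lE => _ _ _.
suff H : forall m j, (j < m)%N -> (0 < j < k)%N -> forall a, (j < a < j + kp)%N ->
    ent x j.+1 a.+1 = ent x j a.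
  by move=> j a hj ha; apply: (H j.+1 j).
elim=> [//|m IH] j jm hj.
have ge a : (j < a < j + kp)%N -> gap x j a <= gap x j a.+1.
  move=> ha; rewrite gapS; last by lia.
  have han : (0 < a <= n)%N by lia.
  have b1 : (bet n k a < j)%N by rewrite /bet; lia.
  have b2 : (j < gam k a)%N by rewrite /gam; lia.
  have r1 : rise a x j = rise a x (bet n k a).+1.
    apply: rise_const; [exact: han|lia|] => j' hj'.
    by apply: (IH j'); move: hj'; rewrite /bet; lia.
  have [_ /(_ j.+1 ltac:(lia))[r2 _]] := clo_top hk han x.
  move: r2; rewrite -eps_clE epsE // riseS; last by lia.
  by rewrite r1; lia.
have mono a b : (j < a <= b)%N -> (b <= j + kp)%N -> gap x j a <= gap x j b.
  elim: b => [|b IHb] hab hb; first by lia.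
  case: (eqVneq a b.+1) => [->//|ne].
  by apply: le_trans (IHb _ _) (ge _ _); lia.
have top : gap x j (j + kp) <= gap x j j.+1.
  (* This path is lowest possible up to row j and highest possible after it;
     the rows before j contribute nothing to the comparison with ctop. *)
  pose h s := if (s <= j)%N then s.+1 else (s + kp)%N.
  have ph : increasing k n.+1 h.
    split; rewrite /h //; first by rewrite ifF; lia.
    by move=> s hs; case: (leqP s j) => a1; case: (leqP s.+1 j) => a2; lia.
  have := mincost_le x ph; rewrite -topmin.
  have -> : pcost k (gap x) (cval (ctop n k)) = pcost k (gap x) (fun s => (s + kp)%N).
    by apply: eq_pcost => s hs; rewrite ctopE ?ifF; lia.
  rewrite -subr_ge0 /pcost -sumrB (bigD1_seq j) ?mem_index_iota ?iota_uniq //=.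
  rewrite big_seq_cond big1 ?addr0; first by rewrite /h leqnn; lia.
  move=> s /andP[]; rewrite mem_index_iota => hs ne; rewrite /h;
    case: (leqP s j) => sj; last by rewrite subrr.
  rewrite (@gap_const x s) ?subrr //; [|lia] => a; apply: IH; lia.
move=> a ha; have := gapS x j (a := a) ltac:(lia).
have := mono j.+1 a ltac:(lia) ltac:(lia);
  have := mono a.+1 (j + kp)%N ltac:(lia) ltac:(lia).
by have := ge a ha; lia.
Qed.

Section Flat.
Variables (l : int) (y : 'M[int]_(k, n.+1)).
Hypotheses (sy : supported y) (ry : rowsums l y) (fy : flat y).

Lemma pcost_flat h : increasing k n.+1 h ->
  pcost k (gap y) h = ent y 1 1 - ent y k k.
Proof.
move=> ph; transitivity (\sum_(1 <= s < k) gap y s s.+1).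
  rewrite /pcost !big_nat; apply: eq_bigr => j hj; apply: gap_flat => //.
  have := increasing_bounds ph (j := j) ltac:(lia).
  have := increasing_homo ph (i := j) (j := k) ltac:(lia).
  by case: ph => _ -> _; lia.
rewrite (diag_cost hk); last by lia.
rewrite psumS psum0 add0r (psum_pred y k (i := k)); last by lia.
by rewrite (psum_low sy (j := k) (i := k.-1)) ?add0r //; lia.
Qed.

Lemma rise_flat a c : (0 < a <= n)%N -> (bet n k a < c <= gam k a)%N ->
  rise a y c = rise a y (bet n k a).+1.
Proof.
move=> ha hc; apply: rise_const => // j hj; apply: fy.
  by move: hc hj; rewrite /gam; lia.
by move: hc hj; rewrite /gam /bet; lia.
Qed.

Lemma eps0_flat : eps_val l ord0 y = ent y k k.
Proof.
rewrite eps0E // /mincost pcost_flat; first by lia.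
by have [] := cmin_first hk y.
Qed.

Lemma eps_cl_flat a : (0 < a <= n)%N ->
  eps_cl a y = ent y (bet n k a).+1 a.+1 - ent y (bet n k a) a.
Proof.
move=> ha; have [hc _] := clo_top hk ha y.
by rewrite eps_clE rise_flat // rise_first.
Qed.

Lemma phi0_flat : phi_val l ord0 y = ent y k n.+1 - ent y 1 1 + ent y k k.
Proof.
rewrite phi0E // /mincost pcost_flat; first by lia.
by have [] := cmin_first hk y.
Qed.

Lemma phi_cl_flat a : (0 < a <= n)%N ->
  phi_cl a y = ent y (gam k a) a - ent y (gam k a).+1 a.+1.
Proof.
move=> ha; have hlh := lo_lt_hi hk ha; rewrite phi_clE // riseS; last by lia.
rewrite (rise_flat (c := gam k a)) //; last by lia.
by rewrite eps_cl_flat // rise_first //; lia.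
Qed.

Lemma level_of_flat : \sum_i eps_val l i y = l.
Proof.
rewrite (sum_eps_defect sy ry) big_nat big1 ?addr0 => [|a ha]; last first.
  by rewrite eps_cl_flat ?rise_first ?subrr //; lia.
rewrite /mincost !pcost_flat ?subrr ?addr0 //; first by have [] := cmin_first hk y.
exact: ctop_increasing.
Qed.

(** For a flat matrix [epsilon] is read off the first row and the differences
    along the last diagonal, [varphi] off the last row and the differences along
    the main one. The inner diagonals are constant and the rows have equal sums,
    so these agree up to the shift. *)
Lemma phi_flat_eps (i : 'I_n.+1) :
  phi_val l (i + inZp k) y = eps_val l i y.
Proof.
have vE : (i + inZp k : 'I_n.+1)
    = (if (i + k < n.+1)%N then i + k else i + k - n.+1)%N :> nat.
  rewrite /= (modn_small (m := k)); last by lia.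
  case: ltnP => h; first by rewrite modn_small.
  rewrite -[X in (X %% _)%N](subnK h) modnDr modn_small //.
  by have := ltn_ord i; lia.
have rowE j : (0 < j < k)%N ->
    ent y j j - ent y j.+1 j.+1 = ent y j.+1 (j + kp).+1 - ent y j (j + kp).
  move=> hj; rewrite -gap_first // -(gap_last sy ry) //.
  by rewrite (gap_flat fy (a := (j + kp)%N)); lia.
have interior m j : (0 < m < kp)%N -> (0 < j <= k)%N -> ent y j (j + m) = ent y 1 (1 + m).
  move=> hm; elim: j => [//|j IH] hj.
  case: (posnP j) => [->//|j0]; rewrite addSn fy; [|lia|lia].
  by apply: IH; lia.
have dsum j : (0 < j <= k)%N ->
  ent y j j + ent y j (j + kp) = ent y 1 1 + ent y 1 (1 + kp).
  elim: j => [//|j IH] hj; case: (posnP j) => [->//|j0].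
  by rewrite -IH ?addSn; [have := rowE j|]; lia.
case: (index_cases hk (i + inZp k)) => [e|[i0 hi]].
  have ikp : i = kp :> nat.
    by move: vE; rewrite e /=; case: ltnP; have := ltn_ord i; lia.
  have iN : i != ord0 by apply/eqP => e0; move: ikp; rewrite e0 /=; lia.
  rewrite e phi0_flat /eps_val (negbTE iN) eps_cl_flat; last by lia.
  rewrite ikp (_ : bet n k kp = 0%N) ?ent_row0 ?subr0; last by rewrite /bet subnn.
  by have := dsum k ltac:(lia); rewrite addnC kpE add1n; lia.
rewrite /phi_val i0 phi_cl_flat // vE; case: (ltnP (i + k) n.+1) => h.
  rewrite (_ : gam k (i + k) = k) ?(ent_out y (j := k.+1)) ?ltnn ?andbF ?subr0 //;
    last by rewrite /gam; lia.
  case: (index_cases hk i) => [->|[iN hi']]; first by rewrite eps0_flat.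
  rewrite /eps_val iN eps_cl_flat //.
  rewrite (_ : bet n k i = 0%N) ?ent_row0 ?subr0 1?addnC ?interior ?add1n //;
    rewrite /bet; lia.
have iN : (i == ord0) = false by apply/eqP => e0; move: h; rewrite e0 /=; lia.
rewrite /eps_val iN eps_cl_flat; last by have := ltn_ord i; lia.
have [j [ej ei]] : exists j, (i + k - n.+1 = j /\ i = j + kp :> nat)%N.
  by exists (i + k - n.+1)%N; lia.
have hj : (0 < j < k)%N.
  by have := ltn_ord i; move: hi; rewrite vE (ltnNge (i + k) n.+1) h /=; lia.
have eb : bet n k (j + kp) = j by rewrite /bet addnK.
have eg : gam k j = j by apply/minn_idPr; lia.
by rewrite ej ei eb eg rowE.
Qed.
End Flat.

End Minimal.

(** * Translation by a minimal element *)

Section Translation.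
Variables (n k : nat).
Hypothesis hk : (0 < k <= n)%N.
Variables (l m : int) (x y : 'M[int]_(k, n.+1)).
Hypotheses (sx : supported x) (rx : rowsums l x).
Hypotheses (sy : supported y) (ry : rowsums m y) (fy : flat y).

Lemma supportedB : supported (x - y).
Proof. by move=> j i h; rewrite entB sx // sy // subrr. Qed.

Lemma rowsumsB : rowsums (l - m) (x - y).
Proof. by move=> j hj; rewrite psumB rx // ry. Qed.

Lemma pcost_sub h : increasing k n.+1 h ->
  pcost k (gap (x - y)) h = pcost k (gap x) h - (ent y 1 1 - ent y k k).
Proof.
move=> ph; rewrite -(pcost_flat hk sy fy ph) /pcost -sumrB.
by apply: eq_bigr => j _; rewrite gapB.
Qed.

(** All paths have the same cost for the flat matrix [y], so that subtracting
    it does not move the minimizers; likewise [rise a y] is constant where its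
    maxima are looked for. *)
Lemma cmin_sub : cmin (x - y) = cmin x.
Proof.
apply: cseq_eq => j; apply: (cmin_uniq hk).
have [pc mc] := cmin_first hk x; split=> // h ph; rewrite !pcost_sub //.
have [m1 m2] := mc _ ph; split; first by lia.
by move=> le; apply: m2; lia.
Qed.

Lemma cmax_sub : cmax (x - y) = cmax x.
Proof.
apply: cseq_eq => j; apply: (cmax_uniq hk).
have [pc mc] := cmax_last hk x; split=> // h ph; rewrite !pcost_sub //.
have [m1 m2] := mc _ ph; split; first by lia.
by move=> le; apply: m2; lia.
Qed.

Lemma mincost_sub : mincost (x - y) = mincost x - (ent y 1 1 - ent y k k).
Proof. by rewrite /mincost cmin_sub pcost_sub //; have [] := cmin_first hk x. Qed.

Lemma rise_sub a c : rise a (x - y) c = rise a x c - rise a y c.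
Proof.
rewrite /rise -sumrB; apply: eq_bigr => j _; rewrite !entB; lia.
Qed.

Lemma clo_sub a : (0 < a <= n)%N -> clo a (x - y) = clo a x.
Proof.
move=> ha; apply: clo_uniq => //; have [hc h] := clo_top hk ha x; split=> // c hc'.
have [h1 h2] := h c hc';
  rewrite !rise_sub !(rise_flat hk fy ha hc') (rise_flat hk fy ha hc).
by split=> [|/h2]; lia.
Qed.

Lemma chi_sub a : (0 < a <= n)%N -> chi a (x - y) = chi a x.
Proof.
move=> ha; apply: chi_uniq => //; have [hc h] := chi_top hk ha x; split=> // c hc'.
have [h1 h2] := h c hc';
  rewrite !rise_sub !(rise_flat hk fy ha hc') (rise_flat hk fy ha hc).
by split=> [|/h2]; lia.
Qed.

Lemma eps_sub i : eps_val (l - m) i (x - y) = eps_val l i x - eps_val m i y.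
Proof.
case: (index_cases hk i) => [->|[i0 hi]].
  rewrite (eps0E hk rowsumsB) (eps0E hk rx) (eps0_flat hk sy ry fy).
  by rewrite mincost_sub entB; lia.
rewrite /eps_val i0 !eps_clE clo_sub // rise_sub; congr (_ - _).
have [hc _] := clo_top hk hi x; have [hc' _] := clo_top hk hi y.
by rewrite (rise_flat hk fy hi hc) (rise_flat hk fy hi hc').
Qed.

Lemma phi_sub i : phi_val (l - m) i (x - y) = phi_val l i x - phi_val m i y.
Proof.
case: (index_cases hk i) => [->|[i0 hi]].
  rewrite (phi0E hk rowsumsB) (phi0E hk rx) (phi0_flat hk sy ry fy).
  by rewrite mincost_sub entB; lia.
have := eps_sub i; rewrite /eps_val /phi_val i0 !phi_clE // rise_sub; lia.
Qed.

Lemma e_mx_sub i : e_mx i (x - y) = e_mx i x - y.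
Proof.
apply/matrixP => r s; rewrite /e_mx; case: (index_cases hk i) => [->|[-> hi]];
  rewrite ?eqxx !mxE.
  by rewrite cmin_sub; move: (x r s) (y r s) => u v; lia.
by rewrite clo_sub //; move: (x r s) (y r s) => u v; lia.
Qed.

Lemma f_mx_sub i : f_mx i (x - y) = f_mx i x - y.
Proof.
apply/matrixP => r s; rewrite /f_mx; case: (index_cases hk i) => [->|[-> hi]];
  rewrite ?eqxx !mxE.
  by rewrite cmax_sub; move: (x r s) (y r s) => u v; lia.
by rewrite chi_sub //; move: (x r s) (y r s) => u v; lia.
Qed.

End Translation.

(** * The minimal element with given [epsilon] *)

Section Parametrization.
Variables (n k : nat).
Hypothesis hk : (0 < k <= n)%N.
Implicit Types (x y : 'M[int]_(k, n.+1)) (f : nat -> int).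

Local Notation kp := (kp n k).

Let kpE : (kp + k = n.+1)%N.
Proof. by rewrite /Defs.kp; lia. Qed.

Let kp_gt0 : (0 < kp)%N.
Proof. by rewrite /Defs.kp; lia. Qed.

(** The inner diagonals carry the values [f 1], ..., [f (kp - 1)] prescribed for
    [epsilon], the last diagonal the partial sums of the values from [f kp] on,
    and the main diagonal completes every row to the total sum. *)
Definition flat_ent f (j i : nat) : int :=
  if i == j then f 0%N + \sum_(kp + j <= a < n.+1) f a
  else if (j < i < j + kp)%N then f (i - j)%N
  else if i == (j + kp)%N then \sum_(kp <= a < kp + j) f a else 0.

Definition flat_mx f : 'M[int]_(k, n.+1) :=
  \matrix_(r < k, s < n.+1) flat_ent f r.+1 s.+1.

Variable f : nat -> int.

Lemma ent_flat_mx j i : (0 < j <= k)%N -> (0 < i <= n.+1)%N ->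
  ent (flat_mx f) j i = flat_ent f j i.
Proof. by move=> hj hi; apply: ent_mx => // r s; rewrite mxE. Qed.

Lemma flat_mx_supported : supported (flat_mx f).
Proof.
move=> j i hji; case: (boolP ((0 < j <= k) && (0 < i <= n.+1))%N) => h;
  last exact: ent_out.
have [hj hi] := andP h; rewrite ent_flat_mx // /flat_ent.
by do 3![rewrite ifF; last by apply/negP; lia].
Qed.

Lemma flat_mx_diag j : (0 < j <= k)%N ->
  ent (flat_mx f) j j = f 0%N + \sum_(kp + j <= a < n.+1) f a.
Proof. by move=> hj; rewrite ent_flat_mx; [rewrite /flat_ent eqxx| |lia]. Qed.

Lemma flat_mx_mid j i : (0 < j <= k)%N -> (j < i < j + kp)%N ->
  ent (flat_mx f) j i = f (i - j)%N.
Proof.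
move=> hj hi; rewrite ent_flat_mx; [|by []|lia].
by rewrite /flat_ent hi (_ : (i == j) = false) //; apply/negP; lia.
Qed.

Lemma flat_mx_last j : (0 < j <= k)%N ->
  ent (flat_mx f) j (j + kp) = \sum_(kp <= a < kp + j) f a.
Proof.
move=> hj; rewrite ent_flat_mx // /flat_ent; last by lia.
by rewrite ltnn andbF eqxx ifF //; lia.
Qed.

Lemma flat_mx_rowsums : rowsums (\sum_(0 <= a < n.+1) f a) (flat_mx f).
Proof.
move=> j hj.
have -> : psum (flat_mx f) j n.+1 = \sum_(j <= i < (j + kp).+1) ent (flat_mx f) j i.
  apply: sum_trim; try lia; move=> i hi; apply: flat_mx_supported; apply/negP; lia.
rewrite big_nat_recr /=; last by lia.
rewrite big_ltn; last by lia.
rewrite flat_mx_last // flat_mx_diag //.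
have -> : \sum_(j.+1 <= i < j + kp) ent (flat_mx f) j i = \sum_(1 <= a < kp) f a.
  rewrite -[j.+1]add1n big_addn addKn !big_nat; apply: eq_bigr => a ha.
  by rewrite flat_mx_mid ?addnK //; lia.
have -> : \sum_(0 <= a < n.+1) f a = f 0%N + \sum_(1 <= a < n.+1) f a by rewrite big_ltn.
rewrite (sum_nat_split (m := 1) (p := kp) (q := n.+1)); last by lia.
rewrite (sum_nat_split (m := kp) (p := (kp + j)%N) (q := n.+1)); last by lia.
set A := \sum_(_ <= _ < n.+1) _; set B := \sum_(1 <= _ < _) _.
set C := \sum_(kp <= _ < _) _; lia.
Qed.

Lemma flat_mx_flat : flat (flat_mx f).
Proof. by move=> j a hj ha; rewrite !flat_mx_mid ?subSS //; lia. Qed.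

Lemma eps_flat_mx (i : 'I_n.+1) :
  eps_val (\sum_(0 <= a < n.+1) f a) i (flat_mx f) = f i.
Proof.
have [s r c] := And3 flat_mx_supported flat_mx_rowsums flat_mx_flat.
case: (index_cases hk i) => [->|[i0 hi]].
  by rewrite (eps0_flat hk s r c) flat_mx_diag ?kpE ?big_geq ?addr0 //; lia.
rewrite /eps_val i0 (eps_cl_flat hk c) //.
case: (ltngtP i kp) => h.
- rewrite (_ : bet n k i = 0%N) ?ent_row0 ?subr0; last by rewrite /bet; lia.
  by rewrite flat_mx_mid ?subn1 //; lia.
- have [j [ej hj]] : exists j, (i = j + kp :> nat /\ 0 < j < k)%N.
    by exists (i - kp)%N; lia.
  have -> : bet n k i = j by rewrite /bet ej addnK.
  rewrite ej -addSn !flat_mx_last; try lia.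
  by rewrite addnS big_nat_recr /= ?[(kp + j)%N]addnC; [rewrite addrAC subrr add0r|]; lia.
rewrite h (_ : bet n k kp = 0%N) ?ent_row0 ?subr0; last by rewrite /bet subnn.
by rewrite -[kp.+1]add1n flat_mx_last ?addn1 ?big_nat1 //; lia.
Qed.

End Parametrization.

Section MoreParametrization.
Variables (n k : nat).
Hypothesis hk : (0 < k <= n)%N.
Implicit Types (x y : 'M[int]_(k, n.+1)).

Local Notation kp := (kp n k).

Let kpE : (kp + k = n.+1)%N.
Proof. by rewrite /Defs.kp; lia. Qed.

Lemma flat_eps0 x : supported x -> rowsums 0 x -> flat x ->
  (forall i, eps_val 0 i x = 0) -> x = 0.
Proof.
move=> sx rx fx e0.
have eps0 a : (0 < a <= n)%N -> ent x (bet n k a).+1 a.+1 = ent x (bet n k a) a.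
  move=> ha; have hn : (a < n.+1)%N by lia.
  have := e0 (Ordinal hn); rewrite /eps_val ifF /= ?(eps_cl_flat hk fx) //.
    by lia.
  by apply/eqP => /(congr1 (@nat_of_ord _)) /=; lia.
have last j : (0 < j <= k)%N -> ent x j (j + kp) = 0.
  elim: j => [//|j IH] hj; have := eps0 (j + kp)%N.
  rewrite /bet addnK addSn => -> //; last by rewrite /Defs.kp; lia.
  by case: (posnP j) => [->|j0]; [rewrite ent_row0|apply: IH; lia].
have first i : (1 < i <= 1 + kp)%N -> ent x 1 i = 0.
  move=> hi; have := eps0 i.-1; rewrite prednK; last by lia.
  rewrite (_ : bet n k i.-1 = 0%N); last by rewrite /bet; lia.
  by rewrite ent_row0; apply; lia.
have off m j : (0 < m <= kp)%N -> (0 < j <= k)%N -> ent x j (j + m) = 0.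
  move=> hm; case: (eqVneq m kp) => [->|mk]; first exact: last.
  elim: j => [//|j IH] hj; case: (posnP j) => [->|j0]; first by apply: first; lia.
  by rewrite addSn fx; [apply: IH| |]; lia.
have off' j i : (0 < j <= k)%N -> i != j -> ent x j i = 0.
  move=> hj ne; case: (boolP (j <= i <= j + kp)%N) => h; last exact: sx.
  by have := off (i - j)%N j; rewrite subnKC; [apply|]; lia.
apply: ent_inj => j i hj hi; rewrite ent0.
case: (eqVneq i j) => [->|ne]; last exact: off'.
have := rx j hj; rewrite /psum (bigD1_seq j) ?mem_index_iota ?iota_uniq //=; last by lia.
by rewrite big1 ?addr0 // => s ne; apply: off'.
Qed.

Lemma flat_eps_inj l x y : supported x -> rowsums l x -> flat x ->
  supported y -> rowsums l y -> flat y ->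
  (forall i, eps_val l i x = eps_val l i y) -> x = y.
Proof.
move=> sx rx fx sy ry fy e; apply/eqP; rewrite -subr_eq0; apply/eqP.
have rs := rowsumsB rx ry; have es := eps_sub hk rx sy ry fy; rewrite subrr in rs es.
apply: flat_eps0 => //; first exact: supportedB.
  by move=> j a hj ha; rewrite !entB fx // fy.
by move=> i; rewrite es e subrr.
Qed.

(** Off the parallelogram the gaps of a matrix with constant row sums are 0. *)
Lemma tableau_like_of l x : supported x -> rowsums l x ->
  (forall j i, (0 < j <= k)%N -> (j <= i <= j + kp)%N -> 0 <= ent x j i) ->
  (forall j i, (0 < j < k)%N -> (j < i <= j + kp)%N -> 0 <= gap x j i) ->
  tableau_like l x.
Proof.
move=> sx rx nn gp; split=> // j i.
  case: (boolP ((0 < j <= k) && (0 < i <= n.+1))%N) => h; last by rewrite ent_out.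
  case: (boolP (j <= i <= j + kp)%N) => h'; last by rewrite sx.
  by apply: nn => //; case/andP: h.
move=> hj hi; case: (ltnP j i) => ji; last first.
  by rewrite /gap (psum_low sx) ?(psum_low sx) ?subrr //; lia.
case: (leqP i (j + kp)) => ij; first by apply: gp => //; lia.
rewrite /gap (psum_high sx (i' := n.+1)); try lia.
by rewrite (psum_high sx (j := j.+1) (i' := n.+1)) ?rx ?rx ?subrr //; lia.
Qed.

Lemma flat_mx_ge (M : int) (f : nat -> int) j i : 0 <= M -> (forall a, (a <= n)%N ->
  M <= f a) ->
  (0 < j <= k)%N -> (j <= i <= j + kp)%N -> M <= ent (flat_mx n k f) j i.
Proof.
move=> M0 Mf hj hi.
have kp0 : (0 < kp)%N by rewrite /Defs.kp; lia.
case: (eqVneq i j) => [->|ne].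
  rewrite (flat_mx_diag hk) //; have := Mf 0%N ltac:(lia).
  suff : 0 <= \sum_(kp + j <= a < n.+1) f a by set S := \sum_(_ <= _ < _) _; lia.
  by rewrite big_nat sumr_ge0 // => a ha; have := Mf a ltac:(lia); lia.
case: (eqVneq i (j + kp)%N) => [->|ne'].
  rewrite (flat_mx_last hk) // big_ltn; last by lia.
  have := Mf kp ltac:(lia).
  suff : 0 <= \sum_(kp.+1 <= a < kp + j) f a by set S := \sum_(_ <= _ < _) _; lia.
  by rewrite big_nat sumr_ge0 // => a ha; have := Mf a ltac:(lia); lia.
by rewrite (flat_mx_mid hk) //; [apply: Mf|]; lia.
Qed.

Lemma flat_mx_gap (f : nat -> int) j i : (0 < j < k)%N -> (j < i <= j + kp)%N ->
  gap (flat_mx n k f) j i = f (kp + j)%N.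
Proof.
move=> hj hi; rewrite (gap_flat hk (flat_mx_flat hk f)) //.
rewrite (gap_first hk _ (flat_mx_supported hk f)) !(flat_mx_diag hk); try lia.
rewrite [\sum_(kp + j <= _ < _) _]big_ltn; last by lia.
by rewrite addnS; set S := \sum_(_ <= _ < _) _; lia.
Qed.

Lemma flat_mx_tableau_like f : (forall a, (a <= n)%N -> 0 <= f a) ->
  tableau_like (\sum_(0 <= a < n.+1) f a) (flat_mx n k f).
Proof.
move=> f0; apply: tableau_like_of.
- exact: flat_mx_supported.
- exact: flat_mx_rowsums.
- by move=> j i hj hi; apply: flat_mx_ge.
by move=> j i hj hi; rewrite flat_mx_gap //; apply: f0; lia.
Qed.

End MoreParametrization.

(** * The automorphism *)

Section Sigma.
Variables (n k : nat).

Definition shift (la : Pcl n) : Pcl n := \row_i la 0 (i + inZp k).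

Fact shift_is_linear : linear shift.
Proof. by move=> c u v; apply/rowP => i; rewrite !mxE. Qed.

HB.instance Definition _ :=
  GRing.isLinear.Build int (Pcl n) (Pcl n) *:%R shift shift_is_linear.

Definition unshift (la : Pcl n) : Pcl n := \row_i la 0 (i - inZp k).

Lemma shiftK : cancel shift unshift.
Proof. by move=> la; apply/rowP => i; rewrite !mxE subrK. Qed.

Lemma unshiftK : cancel unshift shift.
Proof. by move=> la; apply/rowP => i; rewrite !mxE addrK. Qed.

Lemma shift_Lam i : shift (Lam i) = Lam (i - inZp k).
Proof. by apply/rowP => j; rewrite mxE !LamE -subr_eq opprK. Qed.

Lemma level_shift la : level (shift la) = level la.
Proof.
rewrite /level [RHS](reindex_inj (addIr (inZp k))).
by apply: eq_bigr => i _; rewrite mxE.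
Qed.

Lemma dominant_shift la : dominant la -> dominant (shift la).
Proof. by move=> d i; rewrite mxE. Qed.

(** If [epsilon] is a bijection onto a set of weights stable under the
    automorphism, then so is [varphi]. *)
Lemma phi_bij (B : crystal n) (A : set B) (P : set (Pcl n)) :
  (forall b, A b -> shift (phiw b) = epsw b) -> (forall la, P (shift la) <-> P la) ->
  set_bij A P (@epsw n B) -> set_bij A P (@phiw n B).
Proof.
move=> se sP [e1 e2 e3]; split.
- by move=> b Ab; apply/sP; rewrite se //; apply: e1.
- move=> b b' Ab Ab' e; apply: e2 => //.
  by move: Ab Ab'; rewrite !inE => Ab Ab'; rewrite -!se // e.
- move=> la Pla; have [b Ab e] := e3 (shift la) (proj2 (sP la) Pla).
  by exists b => //; rewrite -[LHS]shiftK se // e shiftK.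
Qed.

End Sigma.

(** * Extremal elements *)

Section Reflections.
Variables (n : nat) (B : crystal n).
Hypotheses (cB : is_crystal B) (strB : string_crystal B).

Lemma wt_iter_e i p (b b' : B) : iter p (obind (etil i)) (Some b) = Some b' ->
  wt b' = wt b + alpha i *+ p.
Proof.
elim: p b' => [|p IH] b' /=; first by case=> ->; rewrite addr0.
case E: (iter p _ _) => [b1|] //= e1; have [_ /(_ _ e1)[-> _ _] _ _ _] := cB i b1.
by rewrite (IH _ E) mulrSr [RHS]addrA.
Qed.

Lemma wt_iter_f i p (b b' : B) : iter p (obind (ftil i)) (Some b) = Some b' ->
  wt b' = wt b - alpha i *+ p.
Proof.
elim: p b' => [|p IH] b' /=; first by case=> ->; rewrite subr0.
case E: (iter p _ _) => [b1|] //= e1; have [_ _ /(_ _ e1)[-> _ _] _ _] := cB i b1.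
by rewrite (IH _ E) mulrSr [in RHS]opprD [RHS]addrA.
Qed.

Lemma iter_obind_le T (f : T -> option T) p q x : (p <= q)%N ->
  iter q (obind f) x <> None -> iter p (obind f) x <> None.
Proof.
move=> pq; rewrite -(subnK pq) iterD; case: (iter p _ _) => // h _; apply: h.
by elim: (q - p)%N => //= m ->.
Qed.

(** The strings of a regular crystal are long enough for the reflection, as
    [phi - eps] is the weight. *)
Lemma Srefl_wt i (b : B) : exists2 b', Srefl i b = Some b' &
  wt b' = wt b - alpha i *~ wt b 0 i.
Proof.
have [p [r [ep fr [e1 e2] [f1 f2]]]] := strB i b.
have [pe _ _ _ _] := cB i b; move: pe; rewrite ep fr /= => -[pe].
rewrite /Srefl; case: ifP => m0.
  have := @iter_obind_le _ (ftil i) `|wt b 0 i| r (Some b) ltac:(lia) f1.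
  case E: (iter _ _ _) => [b'|] // _; exists b' => //.
  by rewrite (wt_iter_f E) -[in RHS](gez0_abs m0).
have := @iter_obind_le _ (etil i) `|wt b 0 i| p (Some b) ltac:(lia) e1.
case E: (iter _ _ _) => [b'|] // _; exists b' => //.
rewrite (wt_iter_e E); move: (wt b 0 i) m0 => m m0.
have : m = - `|m|%N%:Z by lia.
by move: `|m|%N => q ->; rewrite mulrNz opprK.
Qed.

Lemma weyl_reach_trans (b b' b'' : B) :
  weyl_reach b b' -> weyl_reach b' b'' -> weyl_reach b b''.
Proof.
move=> h; elim=> // b1 b2 i _ h1 h2; exact: reach_step h1 h2.
Qed.

Lemma weyl_orbit_back i (la : Pcl n) (b b' : B) : (0 < n)%N ->
  wt b' = wt b - alpha i *~ wt b 0 i ->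
  weyl_orbit la (wt b') -> weyl_orbit la (wt b).
Proof.
move=> n0 e h; have := @weyl_step _ _ _ i h;
  suff -> : wt b' - alpha i *~ wt b' 0 i = wt b by [].
have -> : wt b' 0 i = - wt b 0 i.
  have entryE (al v : Pcl n) m : (v - al *~ m) 0 i = v 0 i - m * al 0 i.
    by rewrite -scaler_int !mxE intz.
  by rewrite e entryE alpha_diag //; lia.
by rewrite e mulrNz opprK subrK.
Qed.

End Reflections.

Section HighestWeight.
Variables (n k : nat).
Hypothesis hk : (0 < k <= n)%N.
Implicit Types (x y : 'M[int]_(k, n.+1)).

Definition diagonal x : Prop := forall j i, (0 < j <= k)%N -> i != j -> ent x j i = 0.

Lemma diagonal_uniq l x y : rowsums l x -> rowsums l y -> diagonal x -> diagonal y ->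
  x = y.
Proof.
have dE z : rowsums l z -> diagonal z -> forall j, (0 < j <= k)%N -> ent z j j = l.
  move=> rz dz j hj; rewrite -(rz j hj) /psum (bigD1_seq j) ?mem_index_iota ?iota_uniq //=; last by lia.
  by rewrite big1 ?addr0 // => s ne; apply: dz.
move=> rx ry dx dy; apply: ent_inj => j i hj hi.
by case: (eqVneq i j) => [->|ne]; rewrite ?(dE x) ?(dE y) // dx ?dy.
Qed.

(** A highest weight tableau has only the letter [j] in row [j]: row by row,
    [epsilon_a] bounds the number of letters [a + 1 > j]. *)
Lemma diagonal_of_eps l x : tableau_like l x ->
  (forall a, (0 < a <= n)%N -> eps_cl a x = 0) -> diagonal x.
Proof.
move=> tx e0; have [nn gp rs] := tx; have sx := tableau_like_supported hk tx.
suff H m j i : (j < m)%N -> (0 < j <= k)%N -> (j < i)%N -> ent x j i = 0.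
  move=> j i hj ne; case: (ltngtP i j) ne => // [ij|ji] _; last exact: (H j.+1).
  by apply: sx; apply/negP; lia.
elim: m j i => [//|m IH] j i jm hj ji.
case: (boolP ((i <= j + kp n k) && (i <= n.+1))%N) => h; last first.
  case: (boolP (i <= n.+1)%N) => h'; last by apply: ent_out; lia.
  by apply: sx; apply/negP; lia.
case: i ji h => // a ja ha; have han : (0 < a <= n)%N by lia.
have [_ /(_ j)[]] := clo_top hk han x.
  by move: ha; rewrite /bet /gam; lia.
rewrite -eps_clE e0 // => le _; apply/eqP; rewrite eq_le nn andbT.
suff <- : rise a x j = ent x j a.+1 by [].
have bj : (bet n k a < j)%N by move: ha; rewrite /bet; lia.
case: j hj jm ja ha le bj => // j hj jm ja ha le bj.
rewrite riseS; last by lia.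
have -> : ent x j a = 0.
  by case: (posnP j) => [->|j0]; [rewrite ent_row0|apply: IH; lia].
rewrite subr0 /rise big_nat big1 ?add0r // => i hi.
have -> : ent x i.+1 a.+1 = 0 by apply: IH; lia.
by case: (posnP i) => [->|i0]; rewrite ?ent_row0 ?subr0 // IH ?subr0 //; lia.
Qed.

Lemma sum_colsum l x : rowsums l x -> \sum_(1 <= a < n.+2) colsum x a = l *+ k.
Proof.
move=> rx; rewrite /colsum exchange_big /=.
rewrite (eq_big_nat _ _ (F2 := fun=> l)); last by move=> j hj; exact: rx.
by rewrite sumr_const_nat subn1.
Qed.

(** The weight determines the content, and the only tableau whose content is
    that of the highest weight tableau is that tableau. *)
Lemma diagonal_of_wt l x y : tableau_like l x -> tableau_like l y -> diagonal y ->
  wt_val l x = wt_val l y -> diagonal x.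
Proof.
move=> tx ty dy e; have [nn gp rs] := tx; have [_ _ rs'] := ty.
have sx := tableau_like_supported hk tx; have sy := tableau_like_supported hk ty.
have step a : (0 < a <= n)%N ->
    colsum x a.+1 - colsum y a.+1 = colsum x a - colsum y a.
  move=> ha; have hn : (a < n.+1)%N by lia.
  have /rowP/(_ (Ordinal hn)) := e; rewrite !wt_valE // ord_pred_val /=.
  by rewrite (_ : (a == 0)%N = false) ?prednK; lia.
have const a : (a <= n)%N -> colsum x a.+1 - colsum y a.+1 = colsum x 1 - colsum y 1.
  elim: a => [//|a IH] ha; rewrite step; last by lia.
  by apply: IH; lia.
have eq1 : colsum x 1 - colsum y 1 = 0.
  have : \sum_(1 <= a < n.+2) (colsum x a - colsum y a) = 0.
    by rewrite sumrB (sum_colsum rs) (sum_colsum rs') subrr.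
  rewrite (eq_big_nat _ _ (F2 := fun=> colsum x 1 - colsum y 1)); last first.
    by case=> // a ha; apply: const; lia.
  by rewrite sumr_const_nat subn1 /= => /eqP; rewrite mulrn_eq0 /= => /eqP.
have ceq a : (0 < a <= n.+1)%N -> colsum x a = colsum y a.
  by case: a => // a ha; have := const a ltac:(lia); lia.
have big a j : (k < a <= n.+1)%N -> (0 < j <= k)%N -> ent x j a = 0.
  move=> ha hj; have : colsum x a = 0.
    rewrite ceq; last by lia.
    by rewrite /colsum big_nat big1 // => i hi; apply: dy; lia.
  rewrite /colsum (bigD1_seq j) ?mem_index_iota ?iota_uniq //=.
  set T := \sum_(_ <- _ | _) _; have T0 : 0 <= T by apply: sumr_ge0 => i _; apply: nn.
  by have := nn j a; lia.
have full j : (j < k)%N -> l <= psum x (k - j) (k - j).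
  elim: j => [|j IH] hj.
    rewrite subn0 -(rs k) ?leqnn; last by lia.
    rewrite /psum (sum_nat_split (p := k.+1) (q := n.+2)); last by lia.
    by rewrite [X in _ + X]big_nat [X in _ + X]big1 ?addr0 // => i hi; apply: big; lia.
  have [m [e1 e2]] : exists m, (k - j = m.+1 /\ k - j.+1 = m)%N.
    by exists (k - j.+1)%N; lia.
  have := IH ltac:(lia); have := gp m m.+1 ltac:(lia) ltac:(lia).
  by rewrite e1 e2 /gap /=; lia.
move=> j i hj ne; case: (boolP ((j < i) && (i <= n.+1))%N) => h; last first.
  case: (boolP (i <= n.+1)%N) => h'; last by apply: ent_out; lia.
  by apply: sx; apply/negP; lia.
have := full (k - j)%N ltac:(lia); rewrite subKn; last by lia.
have := psum_mono hk j tx (i := j) (i' := i.-1) ltac:(lia).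
have := psum_mono hk j tx (i := i) (i' := n.+1) ltac:(lia).
rewrite (psum_pred x j (i := i)); last by lia.
by rewrite rs //; have := nn j i; lia.
Qed.

Definition hw_coef (l : nat) (a : nat) : int := if a == 0%N then l%:Z else 0.

Lemma sum_hw_coef (l : nat) : \sum_(0 <= a < n.+1) hw_coef l a = l.
Proof. by rewrite big_ltn // big_nat big1 ?addr0 //; case. Qed.

Lemma hw_tableau_like (l : nat) : tableau_like l (flat_mx n k (hw_coef l)).
Proof.
rewrite -{1}(sum_hw_coef l); apply: flat_mx_tableau_like => // a _.
by rewrite /hw_coef; case: eqP.
Qed.

Lemma hw_diagonal (l : nat) : diagonal (flat_mx n k (hw_coef l)).
Proof.
apply: (diagonal_of_eps (hw_tableau_like l)) => a ha.
have hn : (a < n.+1)%N by lia.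
have := eps_flat_mx hk (hw_coef l) (Ordinal hn).
rewrite /eps_val ifF ?sum_hw_coef /=; last first.
  by apply/eqP => /(congr1 (@nat_of_ord _)) /=; lia.
by rewrite /hw_coef (_ : (a == 0)%N = false); lia.
Qed.

End HighestWeight.

(** * Combinatorics of the perfect crystals *)

Section Perfect.
Variables (n k : nat).
Hypothesis hk : (0 < k <= n)%N.

Lemma level_wt_val l (x : 'M[int]_(k, n.+1)) : supported x -> rowsums l x ->
  level (wt_val l x) = 0.
Proof.
move=> sx rx; rewrite /level; under eq_bigr do rewrite wt_valE //.
by rewrite sumrB [X in _ - X](reindex_inj (@ord_pred_inj _)) subrr.
Qed.

Section Level.
Variable l : nat.
Implicit Types (b : Bkl n k l).

Lemma level_epsw b : level (epsw b) = \sum_i eps_val l i (enc b).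
Proof. by rewrite /level; apply: eq_bigr => i _; rewrite mxE. Qed.

Lemma flat_levelP b : flat (enc b) <-> level (epsw b) = l.
Proof.
have [sb rb] := conj (enc_supported hk b) (enc_rowsums hk b).
rewrite level_epsw; split; first exact: level_of_flat.
exact: flat_of_level.
Qed.

Lemma level_epsw_ge b : l%:Z <= level (epsw b).
Proof. by rewrite level_epsw; apply: sum_eps_ge;
  [|exact: enc_supported|exact: enc_rowsums]. Qed.

Lemma flat_surj (la : Pcl n) : Pplus l la ->
  exists2 b : Bkl n k l, flat (enc b) & epsw b = la.
Proof.
move=> [dla lla]; pose f a := la 0 (inord a).
have sf : \sum_(0 <= a < n.+1) f a = l.
  rewrite -lla /level big_mkord; apply: eq_bigr => i _.
  by rewrite /f inord_val.
have [b be] : exists b : tableau n k l, enc b = flat_mx n k f.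
  apply: tableau_like_enc => //; rewrite -sf; apply: flat_mx_tableau_like => // a _.
  exact: dla.
exists b; first by rewrite be; apply: flat_mx_flat.
apply/rowP => i; rewrite mxE /= be -sf eps_flat_mx //.
by rewrite /f inord_val.
Qed.

Lemma Bmin_flat b : Bmin (Bkl n k l) b <-> flat (enc b).
Proof.
rewrite flat_levelP; split=> [mb|lb b']; last by rewrite lb; apply: level_epsw_ge.
have [b0 f0 _] : exists2 b0 : Bkl n k l, flat (enc b0) & epsw b0 = Lam ord0 *+ l.
  apply: flat_surj; split.
    by move=> i; rewrite mulmxnE LamE; lia.
  rewrite /level (bigD1 ord0) //= big1 ?addr0; last first.
    by move=> i /negbTE i0; rewrite mulmxnE LamE i0 mul0rn.
  by rewrite mulmxnE LamE eqxx /= -natz; lia.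
apply/eqP; rewrite eq_le level_epsw_ge andbT.
by have := mb b0; rewrite (proj1 (flat_levelP b0) f0).
Qed.

Lemma shift_phi b : Bmin (Bkl n k l) b -> shift k (phiw b) = epsw b.
Proof.
move/Bmin_flat => fb; apply/rowP => i; rewrite !mxE /=.
by apply: phi_flat_eps => //; [exact: enc_supported|exact: enc_rowsums].
Qed.

Lemma epsw_bij : set_bij (Bmin (Bkl n k l)) (@Pplus n l) (@epsw n (Bkl n k l)).
Proof.
split.
- move=> b /Bmin_flat fb; split; last exact/flat_levelP.
  by move=> i; rewrite mxE /=; apply: eps_nneg => //; apply: enc_tableau_like.
- move=> b b'; rewrite !inE => /Bmin_flat fb /Bmin_flat fb' e; apply: (enc_inj hk).
  apply: (flat_eps_inj hk (l := l)) => //; try exact: enc_supported;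
    try exact: enc_rowsums.
  by move=> i; move/rowP/(_ i): e; rewrite !mxE.
- by move=> la /flat_surj[b fb e]; exists b => //; apply/Bmin_flat.
Qed.

Lemma Pplus_shift (la : Pcl n) : Pplus l (shift k la) <-> Pplus l la.
Proof.
rewrite /Pplus /= level_shift; split=> -[d e]; split=> //; last exact: dominant_shift.
by rewrite -(shiftK k la) => i; rewrite mxE.
Qed.

Lemma phiw_bij : set_bij (Bmin (Bkl n k l)) (@Pplus n l) (@phiw n (Bkl n k l)).
Proof. exact: phi_bij shift_phi Pplus_shift epsw_bij. Qed.

Lemma dominant_below (la : Pcl n) : dominant la -> l%:Z <= level la ->
  exists2 mu, Pplus l mu & dominant (la - mu).
Proof.
move=> dla lla; have [d dE] : exists d : nat, level la = l%:Z + d%:Z.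
  by exists `|level la - l%:Z|%N; lia.
elim: d la dla dE {lla} => [|d IH] la dla dE.
  exists la; first by split=> //; rewrite dE addr0.
  by move=> i; rewrite subrr mxE.
have [i i0] : exists i, 0 < la 0 i.
  apply: contrapT => none; suff : level la <= 0 by lia.
  by apply: sumr_le0 => i _; rewrite leNgt; apply/negP => h; apply: none; exists i.
have lamE j : (la - Lam i) 0 j = la 0 j - (j == i)%:Z by rewrite !mxE eqxx /=; case: eqP.
have [||mu mu1 mu2] := IH (la - Lam i).
- by move=> j; rewrite lamE; have := dla j; case: eqP => [->|_]; lia.
- rewrite /level; under eq_bigr do rewrite lamE.
  rewrite sumrB [X in _ - X](bigD1 i) //= eqxx [X in _ - (_ + X)]big1 ?addr0; last first.
    by move=> j /negbTE->.
  by move: dE; rewrite /level => ->; lia.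
exists mu => // j; have := mu2 j; rewrite mxE lamE => h.
by rewrite mxE; move: h; move: (la 0 j) ((- mu) 0 j) => u v; lia.
Qed.

Definition moment b : int := \sum_(1 <= a < n.+2) a%:Z * colsum (enc b) a.

Lemma moment_ge0 b : 0 <= moment b.
Proof.
have [nn _ _] := enc_tableau_like hk b; apply: sumr_ge0 => a _.
by apply: mulr_ge0 => //; apply: sumr_ge0 => j _; apply: nn.
Qed.

Lemma moment_e i b b' : i != ord0 -> etil i b = Some b' -> moment b' = moment b - 1.
Proof.
move=> i0 /e_tabP[//|_ e]; have hi : (0 < i <= n)%N.
  by case: (index_cases hk i) i0 => [->|[]].
transitivity (moment b + \sum_(1 <= a < n.+2) (i%:Z * (a == i)%:Z)
    - \sum_(1 <= a < n.+2) (i.+1%:Z * (a == i.+1)%:Z)).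
  rewrite /moment -big_split -sumrB /= !big_nat; apply: eq_bigr => a ha.
  rewrite e colsum_e //; have -> : (ord_pred i).+1 = i.
    by rewrite ord_pred_val ifF ?prednK //; lia.
  rewrite mulrBr mulrDr; congr (_ + _ - _).
    by case: eqVneq => [->|_]; rewrite ?mulr0.
  by case: eqVneq => [->|_]; rewrite ?mulr0.
by rewrite -!mulr_sumr !sum_nat_eqz; lia.
Qed.

Lemma moment_iter i p b b' : i != ord0 ->
  iter p (obind (etil i)) (Some b) = Some b' -> moment b' = moment b - p%:Z.
Proof.
move=> i0; elim: p b' => [|p IH] b' /=; first by case=> ->; rewrite subr0.
case E: (iter p _ _) => [b1|] //= e1; rewrite (moment_e i0 e1) (IH _ E); lia.
Qed.

(** Reflecting at an index where the weight is negative decreases the moment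
    of the content, so this leads to a classically dominant weight. *)
Lemma reach_dominant b : exists b' : Bkl n k l,
  [/\ weyl_reach b b', forall i, i != ord0 -> 0 <= wt b' 0 i
    & forall la, weyl_orbit la (wt b') -> weyl_orbit la (wt b)].
Proof.
have n0 : (0 < n)%N by lia.
have cB : is_crystal (Bkl n k l) by exact: is_crystal_Bkl.
have sB : string_crystal (Bkl n k l) by exact: string_crystal_Bkl.
have [N] : exists N : nat, moment b < N%:Z.
  by exists `|moment b|.+1%N; have := moment_ge0 b; lia.
elim: N b => [|N IH] b mb; first by have := moment_ge0 b; lia.
case: (pselect (exists2 i, i != ord0 & wt b 0 i < 0)) => [[i i0 w0]|none]; last first.
  exists b; split=> //; first exact: reach_refl.
  by move=> i i0; rewrite leNgt; apply/negP => h; apply: none; exists i.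
have [b1 e1 w1] := Srefl_wt cB sB i b.
have lt : moment b1 < moment b.
  move: e1; rewrite /Srefl leNgt w0 /= => /(moment_iter i0) ->.
  by move: w0; rewrite /=; lia.
have [b2 [r d o]] := IH b1 ltac:(lia).
exists b2; split=> //.
  by apply: weyl_reach_trans r; apply: reach_step e1; apply: reach_refl.
by move=> la /o; apply: weyl_orbit_back n0 w1.
Qed.

(** The weight singled out is that of the highest weight tableau. Reflections
    lead from an extremal element to one with classically dominant weight, and
    there extremality makes all [epsilon_a] with nonzero [a] vanish. *)
Lemma simple_Bkl : simple_crystal (Bkl n k l).
Proof.
have [u uE] := tableau_like_enc hk (hw_tableau_like hk l).
have du : diagonal (enc u) by rewrite uE; apply: hw_diagonal.
have tb (b : Bkl n k l) : tableau_like l (enc b) := enc_tableau_like hk b.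
exists (wt (u : Bkl n k l)); split.
- by apply: level_wt_val; [exact: enc_supported|exact: enc_rowsums].
- move=> b xb; have [b' [r d o]] := reach_dominant b; apply: o.
  suff -> : b' = u by apply: weyl_refl.
  apply: (enc_inj hk); apply: (diagonal_uniq hk (l := l)) => //; try exact: enc_rowsums.
  apply: (diagonal_of_eps hk (tb b')) => a ha.
  have hn : (a < n.+1)%N by lia.
  pose i := Ordinal hn;
    have i0 : i != ord0 by apply/eqP => /(congr1 (@nat_of_ord _)) /=; lia.
  have eE : eps_val l i (enc b') = eps_cl a (enc b') by rewrite /eps_val (negbTE i0).
  rewrite -eE; have := d i i0; rewrite /= mxE.
  have := eps_nneg hk i (tb b').
  case: (xb _ r i) => [/(e_tab_None hk)|/(f_tab_None hk)] ->; lia.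
exists u; split=> // b e; apply: (enc_inj hk).
apply: (diagonal_uniq hk (l := l)) => //; try exact: enc_rowsums.
by apply: (diagonal_of_wt hk (tb b) (tb u)).
Qed.

Lemma perfect_Bkl : perfect_combinatorics l (Bkl n k l).
Proof.
split.
- split; [exact: is_crystal_Bkl|exact: finite_finset|exact: string_crystal_Bkl|].
  by move=> b; apply: level_wt_val; [exact: enc_supported|exact: enc_rowsums].
- exact: simple_Bkl.
- split; first exact: level_epsw_ge.
  have [u uE] := tableau_like_enc hk (hw_tableau_like hk l).
  exists u; apply/flat_levelP; rewrite uE; exact: flat_mx_flat.
- move=> la dla lla; have [mu Pmu dmu] := dominant_below dla lla.
  have [_ _ /(_ mu Pmu)[b _ e]] := epsw_bij; have [_ _ /(_ mu Pmu)[b' _ e']] := phiw_bij.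
  by split; [exists b; rewrite e|exists b'; rewrite e'].
- by split; [exact: epsw_bij|exact: phiw_bij].
Qed.

End Level.
End Perfect.

(** * The limit *)

Section Limit.
Variables (n k : nat).
Hypothesis hk : (0 < k <= n)%N.
Implicit Types (nu : Bkinf n k) (x y : 'M[int]_(k, n.+1)).

Lemma val_supported nu : supported (val nu).
Proof. by have [] := proj1 (in_BkinfP _) (valP nu). Qed.

Lemma val_rowsums nu : rowsums 0 (val nu).
Proof. by have [] := proj1 (in_BkinfP _) (valP nu). Qed.

Lemma level_epsw_inf nu : level (epsw nu) = \sum_i eps_val 0 i (val nu).
Proof. by rewrite /level; apply: eq_bigr => i _; rewrite mxE. Qed.

Lemma Binfmin_flat nu : Binfmin (Bkinf n k) nu <-> flat (val nu).
Proof.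
have [s r] := conj (val_supported nu) (val_rowsums nu).
rewrite /Binfmin /= level_epsw_inf; split; first exact: flat_of_level.
exact: level_of_flat.
Qed.

Lemma shift_phi_inf nu : Binfmin (Bkinf n k) nu -> shift k (phiw nu) = epsw nu.
Proof.
move/Binfmin_flat => fb; apply/rowP => i; rewrite !mxE /=.
by apply: phi_flat_eps => //; [exact: val_supported|exact: val_rowsums].
Qed.

Lemma epsw_inf_bij : set_bij (Binfmin (Bkinf n k)) (@Pcl0 n) (@epsw n (Bkinf n k)).
Proof.
split=> //.
- move=> b b'; rewrite !inE => /Binfmin_flat fb /Binfmin_flat fb' e; apply: val_inj.
  apply: (flat_eps_inj hk (l := 0)) => //; try exact: val_supported;
    try exact: val_rowsums.
  by move=> i; move/rowP/(_ i): e; rewrite !mxE.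
- move=> la lla; pose f a := la 0 (inord a).
  have sf : \sum_(0 <= a < n.+1) f a = 0.
    transitivity (level la); last exact: lla.
    rewrite /level big_mkord; apply: eq_bigr => i _.
    by rewrite /f inord_val.
  have fin : in_Bkinf (flat_mx n k f).
    by apply/in_BkinfP; split; [exact: flat_mx_supported|rewrite -sf;
      exact: flat_mx_rowsums].
  exists (exist (@in_Bkinf n k) _ fin); first by apply/Binfmin_flat; apply: flat_mx_flat.
  apply/rowP => i; rewrite mxE /= -{1}sf eps_flat_mx //.
  by rewrite /f inord_val.
Qed.

Lemma associated_shift : associated_automorphism (Bkinf n k) (shift k).
Proof.
split; [exact: epsw_inf_bij| |exact: shift_phi_inf].
by apply: phi_bij shift_phi_inf _ epsw_inf_bij => la; rewrite /Pcl0 /= level_shift.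
Qed.

Lemma zero_flat : flat (0 : 'M[int]_(k, n.+1)).
Proof. by move=> j a _ _; rewrite !ent0. Qed.

Lemma eps_phi_zero (i : 'I_n.+1) :
  eps_val 0 i (0 : 'M[int]_(k, n.+1)) = 0 /\ phi_val 0 i (0 : 'M[int]_(k, n.+1)) = 0.
Proof.
have [s r] := conj (val_supported (b_infty n k)) (val_rowsums (b_infty n k)).
have := eps_sub hk r s r zero_flat i; have := phi_sub hk r s r zero_flat i.
by rewrite /= !subrr.
Qed.

Section Embed.
Variables (l : nat) (b : Bkl n k l).

Definition translate (b' : tableau n k l) : option (Bkinf n k) := insub (enc b' - enc b).

(** Subtraction of the encoding of [b]; the value [None] is taken only at
    [None]. *)
Definition embed : option (TBT (epsw b) (Bkl n k l) (- phiw b)) -> option (Bkinf n k) :=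
  obind translate.

Lemma translateP b' nu : translate b' = Some nu <-> val nu = enc b' - enc b.
Proof.
rewrite /translate; split; first by case: insubP => // u _ uE [<-].
by move=> <-; rewrite valK.
Qed.

Lemma translate_ex b' : exists nu, translate b' = Some nu.
Proof.
have h : in_Bkinf (enc b' - enc b).
  apply/in_BkinfP; split; first by apply: supportedB; apply: enc_supported.
  by rewrite -(subrr l%:Z); apply: rowsumsB; apply: enc_rowsums.
by exists (exist (@in_Bkinf n k) _ h); apply/translateP.
Qed.

Hypothesis fb : flat (enc b).

Lemma embed_embedding : embedding embed.
Proof.
have [sb rb] := conj (enc_supported hk b) (enc_rowsums hk b).
split; last first.
  move=> [b1|] [b2|] //=.
  - have [nu1 e1] := translate_ex b1; have [nu2 e2] := translate_ex b2.
    rewrite e1 e2 => -[e]; congr Some; apply: (enc_inj hk).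
    move/translateP: e1; move/translateP: e2; rewrite e => ->.
    by move=> /eqP; rewrite subr_eq subrK => /eqP.
  - by have [nu1 e1] := translate_ex b1; rewrite e1.
  - by have [nu2 e2] := translate_ex b2; rewrite e2.
split=> //.
- move=> i b1 b2 /(e_tabP hk)[_ e] /=.
  have [nu1 e1] := translate_ex b1; rewrite e1 /=; apply/esym.
  move/translateP: e1 => ->; rewrite (e_mx_sub hk _ sb fb) -e.
  by have [nu2 e2] := translate_ex b2; rewrite e2; move/translateP: e2 => <-;
    rewrite valK.
- move=> i b1 b2 /(f_tabP hk)[_ e] /=.
  have [nu1 e1] := translate_ex b1; rewrite e1 /=; apply/esym.
  move/translateP: e1 => ->; rewrite (f_mx_sub hk _ sb fb) -e.
  by have [nu2 e2] := translate_ex b2; rewrite e2; move/translateP: e2 => <-;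
    rewrite valK.
- move=> b1 nu /= /translateP e.
  have r1 := enc_rowsums hk b1.
  have eE i := eps_sub hk r1 sb rb fb i; have pE i := phi_sub hk r1 sb rb fb i.
  rewrite subrr in eE pE; split.
    apply/rowP => i; rewrite !mxE e eE pE /=; lia.
  by move=> i; rewrite e eE pE !mxE.
Qed.

Lemma embed_base : embed (Some b) = Some (b_infty n k).
Proof. by apply/translateP; rewrite subrr. Qed.

End Embed.
Arguments embed {l} b _.

(** Every element of the limit is bounded, and a minimal element whose entries
    and gaps exceed that bound absorbs it. *)
Lemma embed_surj nu : exists (l : nat) (b b' : Bkl n k l),
  [/\ (0 < l)%N, flat (enc b) & embed b (Some b') = Some nu].
Proof.
have [s r] := conj (val_supported nu) (val_rowsums nu).
pose M : nat := (1 + \sum_(p : 'I_k.+1 * 'I_n.+2)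
   (`|ent (val nu) p.1 p.2| + `|gap (val nu) p.1 p.2|))%N.
have bd j i : (j <= k)%N -> (i <= n.+1)%N ->
    - M%:Z <= ent (val nu) j i /\ - M%:Z <= gap (val nu) j i.
  rewrite -ltnS -[(i <= _)%N]ltnS => hj hi.
  have : (`|ent (val nu) j i| + `|gap (val nu) j i| <= M)%N.
    rewrite /M (bigD1 (Ordinal hj, Ordinal hi)) //=; lia.
  lia.
pose f (a : nat) : int := M.
have fM : \sum_(0 <= a < n.+1) f a = (M * n.+1)%N.
  by rewrite /f sumr_const_nat subn0; lia.
have f0 a : (a <= n)%N -> 0 <= f a by [].
have tf := flat_mx_tableau_like hk f0; rewrite fM in tf.
have [b be] := tableau_like_enc hk tf.
have [_ _ rb] := tf; have sb := flat_mx_supported hk f.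
have rx : rowsums (M * n.+1)%N (val nu + enc b).
  by move=> j hj; rewrite psumD r // be rb // add0r.
have xE j i : ent (val nu + enc b) j i = ent (val nu) j i + ent (flat_mx n k f) j i.
  by rewrite entD be.
have gE j i : gap (val nu + enc b) j i = gap (val nu) j i + gap (flat_mx n k f) j i.
  by rewrite gapD be.
have tx : tableau_like (M * n.+1)%N (val nu + enc b).
  apply: tableau_like_of => //.
  - by move=> j i h; rewrite xE s // sb.
  - move=> j i hj hi; rewrite xE;
    have [] := bd j i ltac:(lia) ltac:(rewrite /kp in hi; lia).
    have M0 : 0 <= M%:Z by [].
    have Mf a : (a <= n)%N -> M%:Z <= f a by [].
    by have := flat_mx_ge hk M0 Mf hj hi; lia.
  - move=> j i hj hi; rewrite gE flat_mx_gap // /f.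
    by have [] := bd j i ltac:(lia) ltac:(rewrite /kp in hi; lia); lia.
have [b' be'] := tableau_like_enc hk tx.
exists (M * n.+1)%N, b, b'; split; first by rewrite /M; lia.
  by rewrite be; apply: flat_mx_flat.
by apply/translateP; rewrite be' addrK.
Qed.

Lemma is_limit_Bkinf : is_limit (Bkl n k) (b_infty n k).
Proof.
split.
- exact: is_crystal_Bkinf.
- by apply/rowP => i; rewrite !mxE; have [-> ->] := eps_phi_zero i.
- by move=> i /=; have [-> ->] := eps_phi_zero i.
exists (@embed); split.
  move=> l b _ /(Bmin_flat hk) fb; split; [exact: embed_embedding|exact: embed_base].
move=> nu; have [l [b [b' [l0 fb e]]]] := embed_surj nu.
by exists l, b, b'; split=> //; apply/Bmin_flat.
Qed.

End Limit.

Theorem mainTheorem2 (n k : nat) (hk : (0 < k <= n)%N) :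
  [/\ is_limit (Bkl n k) (b_infty n k),
      forall l : nat, (0 < l)%N -> perfect_combinatorics l (Bkl n k l),
      (forall l : nat, (0 < l)%N -> has_crystal_base (Bkl n k l)) ->
        coherent_family (Bkl n k)
    & exists sigma : {linear Pcl n -> Pcl n},
      [/\ bijective sigma,
          forall i : 'I_n.+1, sigma (Lam i) = Lam (i - inZp k),
          associated_automorphism (Bkinf n k) sigma
        & forall (l : nat) (b : Bkl n k l), (0 < l)%N -> Bmin (Bkl n k l) b ->
            sigma (phiw b) = epsw b]].
Proof.
split.
- exact: is_limit_Bkinf.
- by move=> l _; apply: perfect_Bkl.
- move=> hb; split=> [l l0|]; first by split; [exact: hb|exact: perfect_Bkl].
  by exists (Bkinf n k), (b_infty n k); apply: is_limit_Bkinf.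
exists (shift k : {linear Pcl n -> Pcl n}); split.
- exact: Bijective (shiftK k) (unshiftK k).
- exact: shift_Lam.
- exact: associated_shift.
- by move=> l b _; apply: shift_phi.
Qed.
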